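(* Let $D$ be a Dirichlet–Ferguson process with parameter $\alpha$ on $(A,\mathcal{A})$ with associated Pólya sequence $\mathbf{X}$, and write $\mathbf{X}_n=(X_1,\ldots,X_n)$. For $n\ge1$, let $f^{(n)}$ and $h^{(n)}$ be real-valued symmetric measurable functions on $A^n$ such that $f^{(n)}(\mathbf{X}_n)$ and $h^{(n)}(\mathbf{X}_n)$ are square-integrable and $\mathbb{E}[f^{(n)}(\mathbf{X}_n)]=\mathbb{E}[h^{(n)}(\mathbf{X}_n)]=0$. Then $$\mathbb{E}\left[\int_{A^n}h^{(n)}\,\mathrm{d}D^{\otimes n}\int_{A^n}f^{(n)}\,\mathrm{d}D^{\otimes n}\right]=\sum_{s=1}^n\binom ns^2\prod_{l=1}^s\frac{s-l+1}{\alpha(A)+s+l-1}\,\mathbb{E}\bigl[\phi^{(s)}_{h^{(n)}}(\mathbf{X}_s)\,\phi^{(s)}_{f^{(n)}}(\mathbf{X}_s)\bigr].$$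
   Context: $(A,\mathcal{A})$ is a Polish space with its Borel $\sigma$-field and $\alpha$ is a finite positive measure on it ($0<\alpha(A)<\infty$). On a probability space $(\Omega,\mathcal{F},\mathbb{P})$, the Pólya sequence $\mathbf{X}=\{X_n:n\ge1\}$ with parameter $\alpha$ is a sequence of $A$-valued random variables such that, for every $k\ge1$ and $1\le j_1<\cdots<j_k$, $$\mathbb{P}(X_{j_1}\in da_1,\ldots,X_{j_k}\in da_k)=\prod_{i=1}^k\frac{\alpha(da_i)+\sum_{l=1}^{i-1}\delta_{a_l}(da_i)}{\alpha(A)+i-1}.$$ A Dirichlet–Ferguson process with parameter $\alpha$ is a random probability measure $D$ on $(A,\mathcal{A})$ such that for every finite measurable partition $(C_1,\ldots,C_n)$ of $A$ the vector $(D(C_1),\ldots,D(C_n))$ has a Dirichlet distribution with parameters $(\alpha(C_1),\ldots,\alpha(C_n))$. Standing convention: $D$ is the a.s. limit of the empirical measures $\frac1n\sum_{i=1}^n\mathbf{1}_C(X_i)$ of $\mathbf{X}$ (a.s. convergence for all $C\in\mathcal{A}$); then, conditionally on $D$, the $X_i$ are i.i.d. with law $D$. $D^{\otimes n}$ is the $n$-fold random product measure. Kernels $\phi^{(s)}_T$. Conventions: $(a)_{(b)}=a!/b!$ for integers $a\ge b\ge0$, empty products equal $1$, $\binom{a}{b}_*=\binom ab\mathbf{1}_{(a\ge b)}$. For $1\le m\le n$, $0\le r\le m$, $0\le p\le m-r$, $$\Phi(n,m,r,p)=(m-r)_{(m-r-p)}\frac{\prod_{s=1}^{m-(r+p)}[\alpha(A)+r+p+s-1]}{\prod_{s=1}^{m-r}[\alpha(A)+n+s-1]},$$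 and for $1\le q\le m\le n\le N$, $\Psi_N(q,n,m)=\sum_{r=0}^q\binom qr\binom{N-n}{m-r}_*\Phi(n,m,r,q-r)$. For each $N\ge1$, the reals $\theta_N^{(k,a)}$ ($1\le a\le k\le N$) are defined recursively: for $k=1,\ldots,N-1$, $\theta_N^{(k,k)}=\Psi_N(k,k,k)^{-1}$ and $\sum_{i=q}^k\sum_{j=q}^i\theta_N^{(i,j)}\Psi_N(q,k,j)=0$ for $q=1,\ldots,k-1$; moreover $\theta_N^{(N,a)}=-\sum_{s=a}^{N-1}\theta_N^{(s,a)}$ for $1\le a\le N-1$ and $\theta_N^{(N,N)}=1$. Put $\theta_{N*}^{(k,a)}=\theta_N^{(k,a)}\binom{N-a}{k-a}^{-1}$. For a symmetric $T:A^n\to\mathbb{R}$ with $T(\mathbf{X}_n)$ square-integrable and centered, and $1\le s\le n$, $$\phi_T^{(s)}(x_1,\ldots,x_s)=\sum_{a=1}^s\theta_{n*}^{(s,a)}\sum_{1\le j_1<\cdots<j_a\le s}\mathbb{E}[T(\mathbf{X}_n)\mid X_1=x_{j_1},\ldots,X_a=x_{j_a}].$$ (These are the kernels satisfying $T(\mathbf{X}_n)=\sum_{s=1}^n\sum_{1\le j_1<\cdots<j_s\le n}\phi_T^{(s)}(X_{j_1},\ldots,X_{j_s})$ a.s. with $\mathbb{E}[\phi_T^{(s)}(\mathbf{X}_s)\mid\mathbf{X}_{s-1}]=0$ a.s.) *)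

(* Defs.v *)
From HB Require Import structures.
From mathcomp Require Import all_boot all_order all_algebra all_fingroup.
From mathcomp Require Import all_classical all_reals all_analysis.
From mathcomp Require Import measurable_realfun.

Set Implicit Arguments.
Unset Strict Implicit.
Unset Printing Implicit Defensive.

Import Order.TTheory GRing.Theory Num.Theory.
Import numFieldNormedType.Exports.

Local Open Scope classical_set_scope.
Local Open Scope ring_scope.

HB.structure Definition CompleteMetric (K : numDomainType) :=
  { M of CompletePseudoMetric K M & Metric K M }.

Definition polish (R : realType) (T : topologicalType) : Prop :=
  (exists2 S : set T, countable S & dense S) /\
  exists (M : CompleteMetric.type R) (f : T -> M) (g : M -> T),
    [/\ cancel f g, cancel g f, continuous f & continuous g].

Notation borel A := (g_sigma_algebraType (@open A)).

Definition cons_pair d (T : measurableType d) n (x : T * n.-tuple T) :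
    n.+1.-tuple T :=
  [the n.+1.-tuple T of x.1 :: x.2].

Lemma measurable_cons_pair d (T : measurableType d) n :
  measurable_fun [set: T * n.-tuple T] (@cons_pair d T n).
Proof. exact: measurable_cons. Qed.

HB.instance Definition _ d (T : measurableType d) n :=
  isMeasurableFun.Build _ _ _ _ (@cons_pair d T n)
    (@measurable_cons_pair d T n).

Fixpoint prod_prob d (T : measurableType d) (R : realType) n :
    ('I_n -> probability T R) -> probability (n.-tuple T) R :=
  match n with
  | 0 => fun _ => \d_[tuple]
  | n'.+1 => fun mu => distribution
      (mu ord0 \x prod_prob (fun i => mu (lift ord0 i)))%E (@cons_pair d T n')
  end.

Definition gamma_kernel (R : realType) (a : R) : R -> R :=
  (fun x => x `^ (a - 1) * expR (- x)) \_ `]0, +oo[.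

Definition gamma_density_measure (R : realType) (a : R)
    (V : set R) : \bar R :=
  (\int[lebesgue_measure]_(x in V) (gamma_kernel a x)%:E)%E.

Section gamma_density_measure.
Context (R : realType) (a : R).

Lemma gamma_kernel_ge0 x : 0 <= gamma_kernel a x.
Proof.
by apply: restrict_ge0 => {}x _; rewrite mulr_ge0 ?powR_ge0 ?expR_ge0.
Qed.

Lemma measurable_gamma_kernel : measurable_fun [set: R] (gamma_kernel a).
Proof.
apply/measurable_restrict => //; apply: measurable_funTS.
apply: measurable_funM; first exact: measurable_powR.
by apply: measurableT_comp.
Qed.

Let gamma0 : gamma_density_measure a set0 = 0%E.
Proof. by rewrite /gamma_density_measure integral_set0. Qed.

Let gamma_ge0 V : (0 <= gamma_density_measure a V)%E.
Proof. by apply: integral_ge0 => x _; rewrite lee_fin gamma_kernel_ge0. Qed.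

Let gamma_sigma_additive : semi_sigma_additive (gamma_density_measure a).
Proof.
move=> F mF tF mUF; rewrite /gamma_density_measure ge0_integral_bigcup//=.
- apply: is_cvg_ereal_nneg_natsum_cond => n _ _.
  by apply: integral_ge0 => x _; rewrite lee_fin gamma_kernel_ge0.
- by apply/measurable_funTS/measurable_EFinP; exact: measurable_gamma_kernel.
- by move=> x _; rewrite lee_fin gamma_kernel_ge0.
Qed.

HB.instance Definition _ := isMeasure.Build _ _ _ (gamma_density_measure a)
  gamma0 gamma_ge0 gamma_sigma_additive.

End gamma_density_measure.

(* For 0 < a the mass of [gamma_density_measure a] is the (positive, finite)
   Euler integral Gamma(a), so normalizing gives the Gamma(a, 1) law; the Gamma
   law of parameter 0 is the point mass at 0. *)
Definition gamma_prob (R : realType) (a : R) : probability R R :=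
  let delta0 : probability R R := \d_(0 : R) in
  let normalized : probability R R :=
    mnormalize (gamma_density_measure a) delta0 in
  if 0 < a then normalized else delta0.

Definition normalize_tuple (R : realType) n
    (z : n.-tuple R) : n.-tuple R :=
  [tuple tnth z i / \sum_(j < n) tnth z j | i < n].

(* Law of (Z_i / sum_j Z_j)_i for independent Z_i of law Gamma(a_i, 1).  The
   parameters may vanish, but not all of them; a coordinate of parameter 0 is
   almost surely 0. *)
Definition dirichlet_law (R : realType) n (a : 'I_n -> R)
    (B : set (n.-tuple R)) : \bar R :=
  prod_prob (fun i => gamma_prob (a i)) (@normalize_tuple R n @^-1` B).

(* Sequences are indexed from 0: [X i] is the random variable X_{i+1}. *)
Section processes.
Context (R : realType) d (T : measurableType d).
Context d' (Omega : measurableType d') (P : probability Omega R).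
Variable alpha : {finite_measure set T -> \bar R}.

Definition total_mass : R := fine (alpha [set: T]).

(* [polya_weight s Bs] is the iterated integral, over a_{p+1} in B_1, ...,
   a_{p+k} in B_k, of the Polya predictive laws
     (alpha + sum_(l < i) delta_(a_l)) / (alpha(T) + i - 1),  p < i <= p + k,
   where s = [:: a_1; ...; a_p] and Bs = [:: B_1; ...; B_k]. *)
Fixpoint polya_weight (s : seq T) (Bs : seq (set T)) : \bar R :=
  if Bs is B :: Bs' then
    (((total_mass + (size s)%:R)^-1)%:E *
     \int[measure_add alpha (msum (fun l => \d_(nth point s l)) (size s))]_(a in B)
       polya_weight (rcons s a) Bs')%E
  else 1%E.

Definition polya_sequence (X : nat -> {RV P >-> T}) : Prop :=
  forall (k : nat) (j : 'I_k -> nat) (B : 'I_k -> set T), (0 < k)%N ->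
    (forall u v : 'I_k, (u < v)%N -> (j u < j v)%N) ->
    (forall i, measurable (B i)) ->
    P [set w | forall i, B i (X (j i) w)] =
    polya_weight [::] [seq B i | i : 'I_k].

(* A random probability measure is a random element of the space of
   probability measures with the sigma-algebra generated by evaluations. *)
Definition dirichlet_ferguson (D : {RV P >-> pprobability T R}) : Prop :=
  forall (k : nat) (C : 'I_k -> set T),
    (forall i, measurable (C i)) -> trivIset [set: 'I_k] C ->
    \bigcup_i C i = [set: T] ->
    forall B : set (k.-tuple R), measurable B ->
      P [set w | B [tuple fine (D w (C i)) | i < k]] =
      dirichlet_law (fun i => fine (alpha (C i))) B.

Definition empirical_limit (X : nat -> {RV P >-> T})
    (D : {RV P >-> pprobability T R}) : Prop :=
  forall C : set T, measurable C ->
    {ae P, forall w,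
      (fun m : nat => m%:R^-1 * \sum_(i < m) \1_C (X i w) : R) @ \oo
        --> fine (D w C)}.

Definition prefix_tuple (X : nat -> {RV P >-> T}) n (w : Omega) : n.-tuple T :=
  [tuple X i w | i < n].

(* [g] is a version of z |-> E[Y | Z = z]. *)
Definition is_cond_expectation d'' (S : measurableType d'')
    (Y : Omega -> R) (Z : Omega -> S) (g : S -> R) : Prop :=
  [/\ measurable_fun [set: S] g,
      P.-integrable [set: Omega] (fun w => (g (Z w))%:E) &
      forall B : set S, measurable B ->
        (\int[P]_(w in Z @^-1` B) (g (Z w))%:E =
         \int[P]_(w in Z @^-1` B) (Y w)%:E)%E].

End processes.

Definition symmetric_fun T (U : Type) n (f : n.-tuple T -> U) : Prop :=
  forall (sigma : 'S_n) (x : n.-tuple T),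
    f [tuple tnth x (sigma i) | i < n] = f x.

(* [c] stands for alpha(A). *)
Section kernels.
Context (R : realType) (c : R).

Definition fact_quot (a b : nat) : R := a`!%:R / b`!%:R.

Definition Phi (n m r p : nat) : R :=
  fact_quot (m - r) (m - r - p) *
  ((\prod_(1 <= s < (m - (r + p)).+1) (c + r%:R + p%:R + s%:R - 1)) /
   (\prod_(1 <= s < (m - r).+1) (c + n%:R + s%:R - 1))).

(* 'C(a, b) is 0 for a < b, as required of the starred binomial. *)
Definition Psi (N q n m : nat) : R :=
  \sum_(0 <= r < q.+1)
    'C(q, r)%:R * 'C(N - n, m - r)%:R * Phi n m r (q - r).

(* The equations determine [theta k a] for 1 <= a <= k <= N: for fixed k < N,
   the q-th one is solved for theta k q, with q decreasing from k - 1 to 1. *)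
Definition is_theta (N : nat) (theta : nat -> nat -> R) : Prop :=
  [/\ forall k, (1 <= k < N)%N -> theta k k = (Psi N k k k)^-1,
      forall k q, (1 <= k < N)%N -> (1 <= q < k)%N ->
        \sum_(q <= i < k.+1) \sum_(q <= j < i.+1)
          theta i j * Psi N q k j = 0,
      forall a, (1 <= a < N)%N ->
        theta N a = - \sum_(a <= s < N) theta s a &
      theta N N = 1].

Definition theta_star (N : nat) (theta : nat -> nat -> R) (k a : nat) : R :=
  theta k a / 'C(N - a, k - a)%:R.

(* [g a] stands for (x_1, ..., x_a) |-> E[T(X_1..X_n) | X_1 = x_1, ...,
   X_a = x_a]; the inner sum is over increasing a-tuples of indices. *)
Definition hoeffding_kernel (T : Type) (n : nat) (theta : nat -> nat -> R)
    (g : forall a, a.-tuple T -> R) (s : nat) (x : s.-tuple T) : R :=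
  \sum_(1 <= a < s.+1) theta_star n theta s a *
    \sum_(j : a.-tuple 'I_s | sorted ltn (map val j))
      g a (map_tuple (tnth x) j).

End kernels.

(* Main.v *)
(* Conditionally on D the X_i are i.i.d. with law D, so the left-hand side is
   E[h(X_1, ..., X_n) f(X_{n+1}, ..., X_{2n})], and both factors split into sums
   of Hoeffding kernels over the subsets S of the first block and T of the
   second.  The Polya prediction rule gives, for p in S \ T and K = (S \ p) u T,

     (alpha(A) + #|K|) E[phi_S psi_T] =
       sum_(k in T \ S) E[phi_(S \ p + k) psi_T],

   once the equations defining theta have been solved explicitly (through the
   Chu-Vandermonde identity) and reduced to the two-term recursion
   [theta_star_rec].  Moving S into T one point at a time yields 0 when
   #|S| <> #|T| and prod_(d <= s) d / (alpha(A) + s + d - 1) E[phi_T psi_T] when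
   S and T are disjoint of size s; there are 'C(n, s) ^ 2 such pairs.

   Conditional expectations are computed from one explicit version, obtained by
   integrating against the predictive laws, to which any other version is
   a.s. equal.  Exchangeability of X is derived from the a.s. convergence of the
   empirical measures. *)
From HB Require Import structures.
Require Import Defs.
From mathcomp Require Import all_boot all_order all_algebra all_fingroup.
From mathcomp Require Import all_classical all_reals all_analysis.
From mathcomp Require Import measurable_realfun giry ring lra zify.

Set Implicit Arguments.
Unset Strict Implicit.
Unset Printing Implicit Defensive.

Import Order.TTheory GRing.Theory Num.Theory.

Local Open Scope ring_scope.

(** The prediction rule yields a closed system because [K] contains the indices of both factors.
    When a new point is predicted from [K], a draw from alpha and a repetition of a point of [I]
    together give alpha(A) + #|I| times the predictive expectation given X_I alone; only repetitions
    of points of [K] outside [I] remain as extra terms. Hence the numbers E[E[h | X_I] E[f | X_J]]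
    satisfy linear relations among themselves, and what follows is finite combinatorics of set
    functions on 2n indices.

    Exchangeability requires an argument because a Polya sequence is specified along increasing
    indices only; the moments E[D(B_1) ... D(B_k)], on the other hand, are visibly symmetric. An
    explicit version of the conditional expectations is used because a given version is controlled
    only at the prefix of X, while the kernels evaluate it at other index tuples, and because the
    one-step recursion of the explicit version holds at every point rather than almost surely. *)

(** * Rising factorials, the Chu-Vandermonde identity and the closed form of [Psi] *)

Definition rising (R : realType) (b : R) (m : nat) : R :=
  \prod_(i < m) (b + i%:R).

Lemma rising0 (R : realType) (b : R) : rising b 0 = 1.
Proof. by rewrite /rising big_ord0. Qed.

Lemma risingS (R : realType) (b : R) m :
  rising b m.+1 = rising b m * (b + m%:R).
Proof. by rewrite /rising big_ord_recr. Qed.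

Lemma risingD (R : realType) (b : R) m k :
  rising b (m + k) = rising b m * rising (b + m%:R) k.
Proof.
elim: k => [|k IH]; first by rewrite addn0 rising0 mulr1.
by rewrite addnS !risingS IH -mulrA natrD addrA.
Qed.

Lemma rising_gt0 (R : realType) (b : R) m : 0 < b -> 0 < rising b m.
Proof. by move=> b0; apply: prodr_gt0 => i _; rewrite ltr_wpDr. Qed.

Lemma rising_neq0 (R : realType) (b : R) m : 0 < b -> rising b m != 0.
Proof. by move=> b0; rewrite gt_eqF// rising_gt0. Qed.

Lemma rising_prod_nat (R : realType) (b : R) m :
  \prod_(1 <= s < m.+1) (b + s%:R - 1) = rising b m.
Proof.
rewrite big_add1 big_mkord; apply: eq_bigr => i _.
by rewrite -natr1; ring.
Qed.

Lemma ffactnDr (M a u : nat) : (M ^_ (a + u) = M ^_ a * (M - a) ^_ u)%N.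
Proof.
elim: u => [|u IH]; first by rewrite addn0 ffactn0 muln1.
by rewrite addnS !ffactnSr IH subnDA mulnA.
Qed.

(** This is the value of 2F1(-q, -M; b; 1). By Pascal's rule the sum for q + 1 is the sum for (q, M,
    b) plus M / b times the sum for (q, M - 1, b + 1), so the induction keeps M and b general. *)
Lemma chu_vandermonde (R : realType) (q M : nat) (b : R) : 0 < b ->
  \sum_(u < q.+1) 'C(q, u)%:R * (M ^_ u)%:R / rising b u =
  rising (b + M%:R) q / rising b q.
Proof.
elim: q M b => [|q IH] M b b0.
  by rewrite big_ord_recl big_ord0 bin0 ffactn0 !rising0 mulr1 addr0.
have E : \sum_(u < q.+2) 'C(q.+1, u)%:R * (M ^_ u)%:R / rising b u =
   \sum_(u < q.+1) 'C(q, u)%:R * (M ^_ u)%:R / rising b u +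
   \sum_(u < q.+1) 'C(q, u)%:R * (M ^_ u.+1)%:R / rising b u.+1.
  rewrite big_ord_recl.
  rewrite (_ : \sum_(u < q.+1) 'C(q, u)%:R * (M ^_ u)%:R / rising b u =
     \sum_(u < q.+2) 'C(q, u)%:R * (M ^_ u)%:R / rising b u); last first.
    by rewrite [RHS]big_ord_recr/= bin_small// !mul0r addr0.
  rewrite [in RHS]big_ord_recl /= !bin0 -addrA; congr (_ + _).
  rewrite -big_split/=; apply: eq_bigr => u _.
  rewrite /bump/= add1n binS natrD; ring.
rewrite E IH//.
have E2 : \sum_(u < q.+1) 'C(q, u)%:R * (M ^_ u.+1)%:R / rising b u.+1 =
   M%:R / b * (rising (b + M%:R) q / rising (b + 1) q).
  have r1 u : rising b u.+1 = b * rising (b + 1) u.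
    by rewrite -add1n risingD /rising big_ord1 addr0.
  case: M {E} => [|M].
    by rewrite !mul0r big1// => u _; rewrite ffactnS mul0n mulr0 mul0r.
  rewrite -natr1 (_ : b + (M%:R + 1) = b + 1 + M%:R); last by ring.
  rewrite -IH ?addr_gt0// mulr_sumr; apply: eq_bigr => u _.
  rewrite ffactnS r1 natrM -natr1 /=.
  have := rising_neq0 u (addr_gt0 b0 (ltr01 : 0 < 1 :> R)).
  have : b != 0 by rewrite gt_eqF.
  by move=> ? ?; field; do ?[apply/andP; split].
rewrite E2 !risingS.
have -> : rising (b + 1) q = rising b q * (b + q%:R) / b.
  rewrite -risingS -add1n risingD /rising big_ord1 addr0.
  by rewrite [RHS]mulrAC divff ?mul1r// gt_eqF.
have := rising_neq0 q b0.
have bq : b + q%:R != 0 by rewrite gt_eqF// ltr_wpDr.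
have : b != 0 by rewrite gt_eqF.
by move=> ? ?; field; rewrite bq; do ?[apply/andP; split].
Qed.

(** After the substitution r = q - u the starred binomial and [Phi] combine into a falling
    factorial, and the sum is Chu-Vandermonde with base c + k + (j - q) and M = N - k - (j - q). *)
Lemma PsiE (R : realType) (c : R) (N q k j : nat) : 0 < c ->
  (q <= j <= k)%N -> (k <= N)%N ->
  Psi c N q k j = rising (c + q%:R) (j - q) * 'C(N - k, j - q)%:R *
    rising (c + N%:R) q / rising (c + k%:R) j.
Proof.
move=> c0 /andP[qj jk] kN; rewrite /Psi.
have ck0 : 0 < c + k%:R by rewrite ltr_wpDr.
rewrite big_mkord (reindex_inj rev_ord_inj)/=.
have E (u : 'I_q.+1) :
  'C(q, q.+1 - u.+1)%:R * 'C(N - k, j - (q.+1 - u.+1))%:R *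
    Phi c k j (q.+1 - u.+1) (q - (q.+1 - u.+1)) =
  rising (c + q%:R) (j - q) * 'C(N - k, j - q)%:R / rising (c + k%:R) (j - q) *
  ('C(q, u)%:R * ((N - k - (j - q)) ^_ u)%:R / rising (c + k%:R + (j - q)%:R) u).
  have uq : (u <= q)%N by rewrite -ltnS.
  rewrite !subSS subKn// bin_sub// /Phi /fact_quot.
  rewrite subnK// -subnDA subnK//.
  rewrite (_ : \prod_(1 <= s < (j - q).+1) _ = rising (c + q%:R) (j - q)); last first.
    rewrite -rising_prod_nat; apply: eq_bigr => s _.
    by rewrite -(addrA c) -natrD subnK.
  rewrite rising_prod_nat.
  have ->: (j - (q - u) = (j - q) + u)%N by lia.
  rewrite risingD.
  have EC (a : nat) : 'C(N - k, a)%:R = ((N - k) ^_ a)%:R / (a`!)%:R :> R.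
    rewrite -bin_ffact natrM mulfK// pnatr_eq0 -lt0n fact_gt0.
  rewrite !EC ffactnDr natrM.
  have := rising_neq0 (j - q) ck0.
  have : rising (c + k%:R + (j - q)%:R) u != 0 by rewrite rising_neq0// ltr_wpDr.
  have f1 : (j - q)`!%:R != 0 :> R by rewrite pnatr_eq0 -lt0n fact_gt0.
  have f2 : (j - q + u)`!%:R != 0 :> R by rewrite pnatr_eq0 -lt0n fact_gt0.
  by move=> ? ?; field; do ?[apply/andP; split].
rewrite (eq_bigr _ (fun u _ => E u)) -mulr_sumr chu_vandermonde; last first.
  by rewrite ltr_wpDr.
have -> : rising (c + k%:R) j =
    rising (c + k%:R) (j - q) * rising (c + k%:R + (j - q)%:R) q.
  by rewrite -risingD subnK.
have := rising_neq0 (j - q) ck0.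
have : rising (c + k%:R + (j - q)%:R) q != 0 by rewrite rising_neq0// ltr_wpDr.
(* If j - q > N - k, the truncated M is 0 and the sum has another value, but the binomial in front
   vanishes on both sides. *)
have [jqM|Mjq] := leqP (j - q) (N - k).
  have -> : c + k%:R + (j - q)%:R + (N - k - (j - q))%:R = c + N%:R.
    by rewrite -!addrA -!natrD; congr (_ + _%:R); lia.
  by move=> ? ?; field; do ?[apply/andP; split].
by rewrite bin_small// !(mulr0, mul0r).
Qed.

(** The coefficient of x^t in (1 + x)^M (1 + x)^(-M) = 1. *)
Lemma binomial_inverse (R : realType) (M t : nat) :
  \sum_(i < t.+1) 'C(M, i)%:R * ((-1) ^+ (t - i) * 'C(M + (t - i) - 1, t - i)%:R)
  = (t == 0)%:R :> R.
Proof.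
(* [a m i] is the coefficient of x^i in (1 + x)^(-m), and [aS] below is multiplication by 1 + x. For
   m = 0 the truncated subtraction gives the right values: 1 at i = 0 and 0 afterwards. *)
pose a m i : R := (-1) ^+ i * 'C(m + i - 1, i)%:R.
rewrite -[LHS]/(\sum_(i < t.+1) 'C(M, i)%:R * a M (t - i)%N).
have a0 m : a m 0%N = 1 by rewrite /a expr0 bin0 mul1r.
have aS m i : a m.+1 i.+1 + a m.+1 i = a m i.+1.
  rewrite /a exprS.
  have -> : (m.+1 + i.+1 - 1 = (m + i).+1)%N by lia.
  have -> : (m.+1 + i - 1 = m + i)%N by lia.
  have -> : (m + i.+1 - 1 = m + i)%N by lia.
  by rewrite binS natrD; ring.
elim: M t => [|M IH] t.
  rewrite big_ord_recl big1 ?addr0 => [|i _]; last by rewrite bin0n/= mul0r.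
  rewrite bin0 mul1r subn0 /a; case: t => [|t]; first by rewrite expr0 bin0 mul1r.
  by rewrite add0n subn1/= bin_small// mulr0.
case: t => [|t]; first by rewrite big_ord_recl big_ord0 bin0 a0 mul1r addr0.
rewrite -(IH t.+1) big_ord_recl [in RHS]big_ord_recl !bin0 !mul1r !subn0.
under eq_bigr do rewrite lift0 binS natrD mulrDl.
rewrite big_split/= [X in _ + (X + _)]big_ord_recr/=.
rewrite [X in _ + (_ + X)]big_ord_recl/= [in RHS]big_ord_recr/= bin0 mul1r.
rewrite subn1 -(aS M t) ?lift0 subnn !a0 mulr1/=.
set S1 := \sum_(i < t) _; set S2 := \sum_(i < t) _; set S3 := \sum_(i < t) _.
suff -> : S3 = S1 + S2 by ring.
rewrite -big_split/=; apply: eq_bigr => i _.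
rewrite ?lift0 -mulrDr !subSS; congr (_ * _).
have -> : (t - i = (t - i.+1).+1)%N by have := ltn_ord i; lia.
by rewrite aS.
Qed.

(** * Solving the equations for the Hoeffding coefficients *)

Section theta.
Context (R : realType) (c : R) (N : nat) (theta : nat -> nat -> R).
Hypotheses (c_gt0 : 0 < c) (thetaP : is_theta c N theta).

(** Once the double sum is exchanged, the equations at level k involve theta only through these
    partial sums, and triangularly; theta is recovered as a difference of two consecutive ones. *)
Let rowsum k j := \sum_(j <= i < k.+1) theta i j.

Lemma rowsum_system k q : (1 <= q <= k)%N -> (k < N)%N ->
  \sum_(q <= j < k.+1) rowsum k j * Psi c N q k j = (q == k)%:R.
Proof.
move=> /andP[q1 qk] kN; have [th1 th2 _ _] := thetaP.
have k1 : (1 <= k < N)%N by rewrite kN (leq_trans q1 qk).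
have [->|qk'] := eqVneq q k.
  rewrite big_nat1 /rowsum big_nat1 th1// mulVf// PsiE ?leqnn ?(ltnW kN)//.
  rewrite subnn bin0 rising0 !mul1r.
  by rewrite mulf_neq0// ?invr_eq0 rising_neq0// ltr_wpDr.
rewrite -[RHS](th2 k q k1) ?q1 ?ltn_neqAle ?qk'// /rowsum.
under eq_big_nat => j /andP[qj jk].
  rewrite mulr_suml (@big_nat_widenl _ _ _ _ q)//; over.
under [RHS]eq_big_nat => i /andP[qi ik].
  rewrite (@big_nat_widen _ _ _ _ _ k.+1)//; over.
rewrite [RHS](exchange_big_dep_nat xpredT)//=.
Qed.

(** Rescaled by rising factorials, the triangular system is a convolution with the coefficients of
    (1 + x)^(N - k), which [binomial_inverse] inverts. The formula also covers k = N, governed by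
    the last two clauses of [is_theta]: the binomial vanishes for j < N, and truncation makes it 1
    for j = N. *)
Lemma rowsumE k j : (1 <= j <= k)%N -> (k <= N)%N ->
  rowsum k j = (-1) ^+ (k - j) * 'C(N - j - 1, k - j)%:R *
    (rising c k / rising (c + N%:R) k) * (rising (c + k%:R) j / rising c j).
Proof.
move=> /andP[j1 jk]; rewrite leq_eqVlt => /orP[/eqP kN|kN].
  have [_ _ th3 th4] := thetaP.
  subst k; have [->|jN] := eqVneq j N.
    rewrite /rowsum big_nat1 th4 subnn bin0 expr0 !mul1r.
    have := rising_neq0 N c_gt0; have : rising (c + N%:R) N != 0.
      by rewrite rising_neq0// ltr_wpDr.
    by move=> ? ?; field; do ?[apply/andP; split].
  have jN' : (j < N)%N by rewrite ltn_neqAle jN.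
  rewrite /rowsum big_nat_recr//= th3 ?j1// subrr.
  by rewrite (@bin_small (N - j - 1)) ?mulr0 ?mul0r//; lia.
pose y j := rowsum k j * rising c j / rising (c + k%:R) j.
have ck m : rising (c + k%:R) m != 0 by rewrite rising_neq0// ltr_wpDr.
have cc m : rising c m != 0 by rewrite rising_neq0.
have cN m : rising (c + N%:R) m != 0 by rewrite rising_neq0// ltr_wpDr.
have yE q : (1 <= q <= k)%N ->
    \sum_(q <= j < k.+1) 'C(N - k, j - q)%:R * y j =
    (q == k)%:R * rising c k / rising (c + N%:R) k.
  move=> qk; transitivity
      (\sum_(q <= j < k.+1) rowsum k j * Psi c N q k j *
         (rising c q / rising (c + N%:R) q)).
    apply: eq_big_nat => i /andP[qi ik]; rewrite /y PsiE ?qi ?(ltnW kN)//.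
    have -> : rising c i = rising c q * rising (c + q%:R) (i - q).
      by rewrite -risingD subnKC.
    by field; rewrite ck cN ?cc.
  rewrite -mulr_suml rowsum_system// mulrA.
  by case: eqVneq => [->|_]; rewrite // !mul0r.
have yk : y k = rising c k / rising (c + N%:R) k.
  by have := yE k; rewrite leqnn andbT (leq_trans j1 jk) eqxx big_nat1 subnn bin0
     !mul1r; apply.
have ysol t : (t < k)%N -> y (k - t)%N = (-1) ^+ t * 'C(N - k + t - 1, t)%:R * y k.
  elim/ltn_ind: t => -[|t] IH tk; first by rewrite subn0 bin0 expr0 !mul1r.
  have kt : (0 < k - t.+1 <= k)%N by lia.
  have := yE _ kt.
  have -> : (k - t.+1 == k)%N = false by apply/negbTE; lia.
  rewrite !mul0r.
  have ktS : (k.+1 - (k - t.+1) = t.+2)%N by lia.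
  have shift (F : nat -> R) : \sum_(k - t.+1 <= i < k.+1) F i =
      \sum_(i < t.+2) F (i + (k - t.+1))%N.
    by rewrite -[X in \sum_(X <= _ < _) _]add0n big_addn ktS big_mkord.
  rewrite shift.
  (* The inverse coefficients times [y k] satisfy the same equation. By induction the terms i >= 1
     coincide, hence so do the terms i = 0. *)
  move=> E; have /(congr1 (fun z => z * y k)) := binomial_inverse R (N - k) t.+1.
  rewrite mul0r mulr_suml => /esym/(etrans E)/esym {E}.
  rewrite big_ord_recl [RHS]big_ord_recl.
  rewrite !bin0 !mul1r subn0 add0n subnn bin0 mul1r => E.
  apply/esym; move: E; set S1 := \sum_(i < _) _; set S2 := \sum_(i < _) _.
  suff -> : S1 = S2 by move=> E; exact: (addIr _ E).
  apply: eq_bigr => i _; rewrite lift0 -mulrA addnK; congr (_ * _).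
  have -> : (i.+1 + (k - t.+1) = k - (t.+1 - i.+1))%N by have := ltn_ord i; lia.
  by rewrite IH//; have := ltn_ord i; lia.
have kj : (k - j < k)%N by lia.
have := ysol _ kj; rewrite subKn//.
have -> : (N - k + (k - j) - 1 = N - j - 1)%N by lia.
rewrite yk /y => /(congr1 (fun z => z * (rising (c + k%:R) j / rising c j))) <-.
by field; rewrite cc ck.
Qed.

(** For j < k, theta k j is the difference of the partial sums at k and k - 1. Their binomials are
    both multiples of the one by which [theta_star] divides, so no binomial survives. *)
Lemma theta_starE k j : (1 <= j <= k)%N -> (k <= N)%N ->
  theta_star N theta k j =
    (-1) ^+ (k - j) * (rising c k * (c + k%:R + k%:R - 1) / rising (c + N%:R) k) *
    (rising (c + k%:R) j / (rising c j * (c + k%:R + j%:R - 1))).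
Proof.
move=> /andP[j1 jk] kN.
have ck m : rising (c + k%:R) m != 0 by rewrite rising_neq0// ltr_wpDr.
have cc m : rising c m != 0 by rewrite rising_neq0.
have cN m : rising (c + N%:R) m != 0 by rewrite rising_neq0// ltr_wpDr.
have j1' : 1 <= j%:R :> R by rewrite ler1n.
have k0 : 0 <= k%:R :> R by [].
have ckj : c + k%:R + j%:R - 1 != 0.
  by rewrite gt_eqF// -addrA ltr_pwDl ?subr_ge0// ltr_wpDr.
rewrite /theta_star.
have [jk'|jk'] := eqVneq j k.
  rewrite jk' subnn bin0 expr0 divr1 mul1r.
  have := @rowsumE k k; rewrite /rowsum big_nat1 subnn bin0 expr0 !mul1r => ->//.
    by rewrite jk' in ckj; field; rewrite ckj !cc cN.
  by rewrite leqnn andbT -jk'.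
have {}jk' : (j < k)%N by rewrite ltn_neqAle jk'.
have -> : theta k j = rowsum k j - rowsum k.-1 j.
  rewrite /rowsum (ltn_predK jk') big_nat_recr//=; ring.
rewrite !rowsumE ?j1//=; try lia.
case: k k0 jk jk' kN ck ckj => // k k0 jk jk' kN ck ckj /=.
have jk2 : (j <= k)%N by [].
rewrite subSn// exprS mulN1r.
have [m Em] : exists m, (N - j - 1 = m)%N by exists (N - j - 1)%N.
have EN : (N - j = m.+1)%N by lia.
have [t Et] : exists t, (k - j = t)%N by exists (k - j)%N.
rewrite Em EN Et.
have tm : (t <= m)%N by lia.
have C0 : 'C(m.+1, t.+1)%:R != 0 :> R by rewrite pnatr_eq0 -lt0n bin_gt0.
have m0 : m.+1%:R != 0 :> R by rewrite pnatr_eq0.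
have e1 : 'C(m, t)%:R = 'C(m.+1, t.+1)%:R * t.+1%:R / m.+1%:R :> R.
  apply: (mulIf m0); rewrite mulfVK// -!natrM; congr _%:R.
  by rewrite [LHS]mulnC mul_bin_diag mulnC.
have e2 : 'C(m, t.+1)%:R = 'C(m.+1, t.+1)%:R * (m - t)%:R / m.+1%:R :> R.
  apply: (mulIf m0); rewrite mulfVK// -!natrM; congr _%:R.
  by rewrite [LHS]mulnC (mul_bin_down m.+1 t.+1) subSS mulnC.
rewrite e1 e2 !risingS.
have -> : rising (c + k%:R) j = rising (c + k.+1%:R) j * (c + k%:R) / (c + k%:R + j%:R).
  have h : rising (c + k%:R) j.+1 = (c + k%:R) * rising (c + k.+1%:R) j.
    rewrite -[j.+1]add1n risingD /rising big_ord1 addr0; congr (_ * _).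
    by apply: eq_bigr => i _; rewrite -(natr1 k) !addrA.
  rewrite [_ * (c + k%:R)]mulrC -h risingS mulfK// gt_eqF//.
  by rewrite ltr_pwDl// ltr_wpDr.
have -> : (m - t)%:R = N%:R - k.+1%:R :> R.
  by rewrite -natrB//; congr _%:R; lia.
have -> : t.+1%:R = k.+1%:R - j%:R :> R.
  by rewrite -natrB ?(ltnW jk')//; have -> : (k.+1 - j = t.+1)%N by lia.
have NE : m.+1%:R = N%:R - j%:R :> R.
  by rewrite -natrB ?EN//; lia.
rewrite NE in m0 *.
have cNk : c + N%:R + k%:R != 0 by rewrite gt_eqF// !ltr_wpDr.
have ckj0 : c + k%:R + j%:R != 0 by rewrite gt_eqF// !ltr_wpDr.
rewrite -natr1 in ck ckj *.
have ckj1 : c + (k%:R + 1) + j%:R - 1 != 0 by [].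
by field; rewrite ?cNk ?cN ?cc ?ckj0 ?C0 ?m0 ?ckj.
Qed.

(** All that is kept of the closed form: N has dropped out of the coefficients, and c + k - 1 + q is
    what the prediction rule produces for q indices chosen among k - 1. *)
Lemma theta_star_rec k q : (1 <= q < k)%N -> (k <= N)%N ->
  theta_star N theta k q * (c + k%:R - 1 + q%:R) +
  theta_star N theta k q.+1 * (c + q%:R) = 0.
Proof.
move=> /andP[q1 qk] kN; rewrite !theta_starE ?q1 ?(ltnW qk) ?kN//.
have ck m : rising (c + k%:R) m != 0 by rewrite rising_neq0// ltr_wpDr.
have cc m : rising c m != 0 by rewrite rising_neq0.
have cN m : rising (c + N%:R) m != 0 by rewrite rising_neq0// ltr_wpDr.
have h1 : c + k%:R + q%:R - 1 != 0.
  rewrite gt_eqF// -addrA ltr_pwDl ?subr_ge0 ?ler1n//.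
  by rewrite ltr_wpDr.
have h2 : c + k%:R + q%:R != 0 by rewrite gt_eqF// !ltr_wpDr.
have h3 : c + q%:R != 0 by rewrite gt_eqF// !ltr_wpDr.
rewrite -(subnSK qk) exprS !risingS.
have -> : c + k%:R + q.+1%:R - 1 = c + k%:R + q%:R by rewrite -natr1; ring.
by field; rewrite ?h1 ?h2 ?h3 ?cc ?cN.
Qed.

(** The binomial counts the s-subsets of an N-set that contain a given a-subset, so this is the
    total coefficient of one conditional expectation in the sum of all the kernels. It cancels the
    denominator of [theta_star] and leaves a full column sum of theta. *)
Lemma theta_star_sum a : (1 <= a <= N)%N ->
  \sum_(a <= s < N.+1) theta_star N theta s a * 'C(N - a, s - a)%:R =
  (a == N)%:R.
Proof.
move=> /andP[a1 aN]; have [_ _ th3 th4] := thetaP.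
transitivity (rowsum N a).
  apply: eq_big_nat => s /andP[As sN]; rewrite /theta_star mulfVK//.
  by rewrite pnatr_eq0 -lt0n bin_gt0 leq_sub2r.
rewrite /rowsum; have [->|aN'] := eqVneq a N; first by rewrite big_nat1.
have aN2 : (a < N)%N by rewrite ltn_neqAle aN'.
by rewrite big_nat_recr//= th3 ?a1// subrr.
Qed.

End theta.

(** * Sums over the subsets of a finite set *)

Section finite_sums.
Context (R : nmodType) (V : finType).
Implicit Types (I K S : {set V}) (F : {set V} -> R).

Lemma reindex_setU1 (k : V) (Q : pred {set V}) F :
  \sum_(I : {set V} | (k \in I) && Q (I :\ k)) F I =
  \sum_(I : {set V} | (k \notin I) && Q I) F (k |: I).
Proof.
rewrite (reindex_onto (fun I : {set V} => k |: I) (fun I : {set V} => I :\ k)) => [|I /andP[kI _]].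
  apply: eq_bigl => I; rewrite setU11 /=.
  have [kI|kI] := boolP (k \in I); last by rewrite finset.setU1K// eqxx andbT.
  by apply/negP => /andP[_ /eqP E]; move: kI; rewrite -E setD11.
by rewrite finset.setD1K.
Qed.

Lemma sum_subset_setU1 (k : V) S F : k \notin S ->
  \sum_(I : {set V} | I \subset k |: S) F I =
  \sum_(I : {set V} | I \subset S) F I + \sum_(I : {set V} | I \subset S) F (k |: I).
Proof.
move=> kS; rewrite (bigID (fun I : {set V} => k \in I))/= addrC; congr (_ + _).
  apply: eq_bigl => I; have [kI|kI] := boolP (k \in I).
    by rewrite andbF; apply/esym/negP => /fintype.subsetP/(_ _ kI); exact/negP.
  rewrite andbT; apply/fintype.subsetP/fintype.subsetP => IS v vI; last first.
    by rewrite in_setU1 IS ?orbT.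
  have := IS _ vI; rewrite in_setU1 => /orP[/eqP vk|//].
  by rewrite -vk vI in kI.
rewrite (eq_bigl (fun I : {set V} => (k \in I) && (I :\ k \subset S))) => [|I].
  rewrite (reindex_setU1 k (fun I => I \subset S)); apply: eq_bigl => I.
  by have [IS|] := boolP (I \subset S);
    rewrite ?andbF// andbT; apply: contra kS; apply/fintype.subsetP.
by rewrite andbC finset.subDset.
Qed.

(** A set is of the form [k |: I] with k outside [I] in as many ways as it has points: k can be any
    of them. *)
Lemma sum_setU1_count S F :
  \sum_(I : {set V} | I \subset S) \sum_(k in S :\: I) F (k |: I) =
  \sum_(I : {set V} | I \subset S) F I *+ #|I|.
Proof.
transitivity (\sum_(k in S) \sum_(I : {set V} | (k \notin I) && (I \subset S))
   F (k |: I)).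
  rewrite (exchange_big_dep (mem S))/= => [|I k _]; last first.
    by rewrite finset.in_setD => /andP[].
  by apply: eq_bigr => k kS; apply: eq_bigl => I; rewrite finset.in_setD kS andbT andbC.
transitivity (\sum_(k in S) \sum_(I : {set V} | (k \in I) && (I \subset S)) F I).
  apply: eq_bigr => k kS.
  rewrite [RHS](eq_bigl (fun I : {set V} => (k \in I) && (I :\ k \subset S))); last first.
    move=> I; congr andb; rewrite finset.subDset; congr (I \subset _).
    by apply/esym; rewrite (finset.setUidPr _)// finset.sub1set.
  by rewrite (reindex_setU1 k (fun I => I \subset S)).
rewrite (exchange_big_dep (fun I : {set V} => I \subset S))/= => [|k I kS /andP[]//].
apply: eq_bigr => I IS; rewrite -sumr_const; apply: eq_bigl => k.
rewrite IS andbT; have [kI|] := boolP (k \in I); last by rewrite andbF.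
by rewrite (fintype.subsetP IS).
Qed.

End finite_sums.

Section subset_sums.
Context (R : realType) (V : finType).
Implicit Types (I K S T W : {set V}).

Lemma sum_between I W (w : nat -> R) : I \subset W ->
  \sum_(S : {set V} | (I \subset S) && (S \subset W)) w #|S| =
  \sum_(#|I| <= s < #|W|.+1) w s * 'C(#|W| - #|I|, s - #|I|)%:R.
Proof.
move=> IW; have cIW : (#|I| <= #|W|)%N by exact: fintype.subset_leq_card.
rewrite (reindex_onto (fun S : {set V} => I :|: S) (fun S : {set V} => S :\: I))/=; last first.
  move=> S /andP[IS _].
  by rewrite finset.setDE finset.setUIr finset.setUCr finset.setIT; apply/finset.setUidPr.
rewrite (eq_bigl (fun S : {set V} => S \subset W :\: I)); last first.
  move=> S; rewrite finset.subsetUl/= finset.subUset IW/= subsetD; congr andb.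
  rewrite finset.setDUl finset.setDv finset.set0U; apply/eqP/idP => [<-|/finset.setDidPl//].
  rewrite disjoint_sym finset.disjoints_subset finset.setDE finset.setCI finset.setCK.
  exact: finset.subsetUr.
rewrite (eq_bigr (fun S : {set V} => w (#|I| + #|S|)%N)); last first.
  move=> S; rewrite subsetD => /andP[_ dSI]; congr w.
  by rewrite cardsU disjoint_setI0 1?disjoint_sym// cards0 subn0.
have -> : \sum_(#|I| <= s < #|W|.+1) w s * 'C(#|W| - #|I|, s - #|I|)%:R =
  \sum_(i < (#|W| - #|I|).+1) w (#|I| + i)%N * 'C(#|W| - #|I|, i)%:R.
  rewrite -[X in \sum_(X <= _ < _) _]add0n big_addn subSn// big_mkord.
  by apply: eq_bigr => i _; rewrite addnK addnC.
have cD : #|W :\: I| = (#|W| - #|I|)%N by rewrite cardsD (finset.setIidPr IW).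
rewrite -cD (partition_big (fun S : {set V} => inord #|S| : 'I_(#|W :\: I|.+1)) predT)//=.
apply: eq_bigr => i _.
rewrite (eq_bigl (fun S : {set V} => S \in [set A : {set V} | A \subset W :\: I & #|A| == i])).
  rewrite (eq_bigr (fun=> w (#|I| + i)%N)) => [|S].
    by rewrite sumr_const cards_draws mulr_natr.
  by rewrite inE => /andP[_ /eqP ->].
move=> S; rewrite inE; have [/fintype.subset_leq_card cS|//] := boolP (S \subset _).
by rewrite -val_eqE/= inordK// ltnS.
Qed.

Lemma sum_subsets W (w : nat -> R) :
  \sum_(S : {set V} | S \subset W) w #|S| =
  \sum_(0 <= s < #|W|.+1) w s * 'C(#|W|, s)%:R.
Proof.
rewrite -[in RHS](cards0 V) -[in RHS](subn0 #|W|) -[in RHS](cards0 V).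
transitivity (\sum_(S : {set V} | (finset.set0 \subset S) && (S \subset W)) w #|S|).
  by apply: eq_bigl => S; rewrite finset.sub0set.
by rewrite sum_between ?finset.sub0set// cards0 subn0; apply: eq_bigr => s _; rewrite !subn0.
Qed.

End subset_sums.

(** * Hoeffding sums of set functions that obey the prediction rule *)

Section hoeffding_sums.
Context (R : realType) (V : finType) (c : R) (N : nat) (ts : nat -> nat -> R).
Hypotheses (c_gt0 : 0 < c)
  (ts_rec : forall k q, (1 <= q < k)%N -> (k <= N)%N ->
    ts k q * (c + k%:R - 1 + q%:R) + ts k q.+1 * (c + q%:R) = 0)
  (ts_sum : forall a, (1 <= a <= N)%N ->
    \sum_(a <= s < N.+1) ts s a * 'C(N - a, s - a)%:R = (a == N)%:R).
Implicit Types (I J K S T W : {set V}) (F : {set V} -> R).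

(** When [F I] is the conditional expectation given X_I, this is the Hoeffding kernel of order #|S|
    at X_S. The term of the empty set is harmless: [F] vanishes there for a centered statistic. *)
Definition hoeffding_sum F S : R :=
  \sum_(I : {set V} | I \subset S) ts #|S| #|I| * F I.

(* The hypothesis on [F] is the Polya prediction rule, in expectation: [p] is
   drawn from alpha or repeats a point of [K].  By [ts_rec] all the terms whose
   index set lies in [S] cancel. *)
Lemma hoeffding_sum_shift F K S p : p \notin K -> S \subset K -> (#|S| < N)%N ->
    F finset.set0 = 0 ->
    (forall I, I \subset S -> (c + #|K|%:R) * F (p |: I) =
       (c + #|I|%:R) * F I + \sum_(k in K :\: I) F (k |: I)) ->
  (c + #|K|%:R) * hoeffding_sum F (p |: S) =
  \sum_(k in K :\: S) hoeffding_sum F (k |: S).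
Proof.
move=> pK SK SN F0 FE.
have pS : p \notin S by apply: contra pK; exact/fintype.subsetP.
have cS k : k \notin S -> #|k |: S| = #|S|.+1 by move=> kS; rewrite cardsU1 kS.
have hE k : k \notin S -> hoeffding_sum F (k |: S) =
   \sum_(I : {set V} | I \subset S) ts #|S|.+1 #|I| * F I +
   \sum_(I : {set V} | I \subset S) ts #|S|.+1 #|I|.+1 * F (k |: I).
  move=> kS; rewrite /hoeffding_sum sum_subset_setU1// cS//; congr (_ + _).
  apply: eq_bigr => I IS; rewrite cardsU1 (_ : k \notin I)//.
  by apply: contra kS; exact/fintype.subsetP.
rewrite hE// (eq_bigr (fun k => \sum_(I : {set V} | I \subset S) ts #|S|.+1 #|I| * F I +
   \sum_(I : {set V} | I \subset S) ts #|S|.+1 #|I|.+1 * F (k |: I))); last first.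
  by move=> k; rewrite finset.in_setD => /andP[kS _]; exact: hE.
rewrite big_split/= sumr_const.
have cKS : #|K :\: S|%:R = #|K|%:R - #|S|%:R :> R.
  by rewrite cardsD (finset.setIidPr SK) natrB// fintype.subset_leq_card.
rewrite exchange_big/=.
set A := \sum_(I : {set V} | _) _.
(* [FE] eliminates p. The repeated points k are split into those in [S], which give subsets of [S]
   again, and those outside [S], which belong to the right-hand side. *)
rewrite mulrDr [X in _ + X](_ : _ = \sum_(I : {set V} | I \subset S)
   (ts #|S|.+1 #|I|.+1 * (c + #|I|%:R) * F I +
    (\sum_(k in S :\: I) ts #|S|.+1 #|k |: I| * F (k |: I) +
     \sum_(k in K :\: S) ts #|S|.+1 #|I|.+1 * F (k |: I)))); last first.
  rewrite mulr_sumr; apply: eq_bigr => I IS.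
  rewrite mulrCA FE// mulrDr mulrA; congr (_ + _).
  rewrite mulr_sumr [LHS](bigID (fun k => k \in S))/=; congr (_ + _).
    apply: eq_big => [k|k /andP[]].
      rewrite !finset.in_setD -andbA; congr andb.
      by have [kS|_] := boolP (k \in S); rewrite ?andbF// (fintype.subsetP SK).
    by rewrite finset.in_setD => /andP[kI _] kS; rewrite cardsU1 kI.
  apply: eq_bigl => k; rewrite !finset.in_setD andbC.
  have [kS|kS]//= := boolP (k \in S).
  by rewrite (_ : k \notin I)//; apply: contra kS; exact/fintype.subsetP.
rewrite big_split/= [X in _ + (_ + X)]big_split/=.
rewrite (sum_setU1_count S (fun I => ts #|S|.+1 #|I| * F I)).
rewrite !addrA; congr (_ + _).
rewrite -[RHS]mulr_natr cKS [RHS]mulrC -(subrK (c + #|S|%:R) (c + #|K|%:R)).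
rewrite (_ : c + #|K|%:R - (c + #|S|%:R) = #|K|%:R - #|S|%:R); last by ring.
rewrite mulrDl -addrA -addrA -[RHS]addr0; congr (_ + _).
(* The coefficient left on [F I] collects c + #|S| from the common part, c + #|I| from the
   prediction and #|I| from the recounting: it is the left-hand side of [ts_rec] with k = #|S| + 1.
   The empty set is outside the range of [ts_rec] and is handled by [F0]. *)
rewrite mulr_sumr -!big_split/= big1// => I IS.
have [->|I0] := eqVneq I finset.set0; first by rewrite F0 !(mulr0, mul0rn, addr0).
have := @ts_rec #|S|.+1 #|I|.
rewrite card_gt0 I0 ltnS fintype.subset_leq_card// SN => /(_ isT isT) E.
rewrite -mulr_natr.
transitivity ((ts #|S|.+1 #|I| * (c + #|S|.+1%:R - 1 + #|I|%:R) +
   ts #|S|.+1 #|I|.+1 * (c + #|I|%:R)) * F I); last by rewrite E mul0r.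
by rewrite -natr1; ring.
Qed.

(** After an exchange of sums the coefficient of [F I] is the sum of [ts #|S| #|I|] over the sets S
    between I and W; by [ts_sum] it is 1 for I = W and 0 for every other nonempty I. *)
Lemma hoeffding_decomposition F W : #|W| = N -> F finset.set0 = 0 ->
  F W = \sum_(S : {set V} | S \subset W) hoeffding_sum F S.
Proof.
move=> WN F0; rewrite /hoeffding_sum (exchange_big_dep (fun I => I \subset W))/=; last first.
  by move=> S I SW IS; exact: fintype.subset_trans SW.
rewrite (bigD1 W)//= [X in _ + X]big1 ?addr0 => [|I /andP[IW nIW]].
  rewrite (eq_bigl (pred1 W)) => [|S]; last by rewrite /= -finset.eqEsubset.
  rewrite big_pred1_eq WN; have [N0|N0] := posnP N.
    suff -> : W = finset.set0 by rewrite F0 mulr0.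
    by apply/eqP; rewrite -cards_eq0 WN N0.
  have := @ts_sum N; rewrite N0 leqnn eqxx big_nat1 subnn bin0 mulr1 => ->//.
  by rewrite mul1r.
have [->|I0] := eqVneq I finset.set0; first by rewrite big1// => S _; rewrite F0 mulr0.
rewrite -mulr_suml (eq_bigl (fun S => (I \subset S) && (S \subset W))) => [|S].
  rewrite (sum_between (fun s => ts s #|I|))// WN ts_sum.
    case: eqP => [IN|_]; last by rewrite mul0r.
    by case/eqP: nIW; apply/eqP; rewrite eqEcard IW WN IN leqnn.
  by rewrite card_gt0 I0 -WN fintype.subset_leq_card.
by rewrite andbC.
Qed.

Section bilinear.
Variable B : {set V} -> {set V} -> R.
Hypotheses (B0l : forall J, B finset.set0 J = 0) (B0r : forall I, B I finset.set0 = 0)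
  (Bl : forall p K I J, p \notin K -> I \subset K -> J \subset K ->
    (#|I| < N)%N -> (c + #|K|%:R) * B (p |: I) J =
       (c + #|I|%:R) * B I J + \sum_(k in K :\: I) B (k |: I) J).

Definition hoeffding_sum2 S T : R :=
  hoeffding_sum (fun I => hoeffding_sum (B I) T) S.

(** When d points of S lie outside T, there are d replacements for one of them and the denominator
    is c + s + d - 1 with s = #|T|; [coef] multiplies these factors down to distance 0. *)
Let coef s d : R := \prod_(i < d) (i.+1%:R / (c + s%:R + i%:R)).

Lemma hoeffding_sum2_shift S T p : p \in S -> p \notin T -> (#|S| <= N)%N ->
  (c + #|(S :\ p) :|: T|%:R) * hoeffding_sum2 S T =
  \sum_(k in T :\: S) hoeffding_sum2 (k |: (S :\ p)) T.
Proof.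
move=> pS pT SN; rewrite /hoeffding_sum2 -{2}(finset.setD1K pS).
rewrite hoeffding_sum_shift ?finset.subsetUl//.
- apply: eq_bigl => k; rewrite !inE; have [->|kp]/= := eqVneq k p.
    by rewrite pS (negbTE pT).
  by case: (k \in S).
- by rewrite !inE negb_or negb_and negbK eqxx.
- by rewrite (cardsD1 p S) pS in SN.
- by rewrite /hoeffding_sum big1// => J _; rewrite B0l mulr0.
move=> I IS; rewrite /hoeffding_sum mulr_sumr [X in _ = X + _]mulr_sumr.
rewrite [X in _ = _ + X]exchange_big/= -big_split/=; apply: eq_bigr => J JT.
rewrite mulrCA (Bl (K := (S :\ p) :|: T)).
- by rewrite mulrDr -mulr_sumr mulrCA.
- by rewrite !inE negb_or negb_and negbK eqxx.
- by rewrite (fintype.subset_trans IS)// finset.subsetUl.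
- by rewrite (fintype.subset_trans JT)// finset.subsetUr.
- rewrite (leq_ltn_trans (fintype.subset_leq_card IS))//.
  by rewrite (cardsD1 p S) pS in SN.
Qed.

(** Induction on #|S :\: T|: each exchange keeps #|S| and brings one more point into T. For equal
    sizes, T :\: S has as many points as S :\: T, so the shift has that many equal terms. If S is
    larger, it never fits into T, and every term is 0 by induction, or there is none left. *)
Lemma hoeffding_sum2_orth S T : (#|T| <= #|S| <= N)%N ->
  hoeffding_sum2 S T =
  if #|S| == #|T| then coef #|T| #|S :\: T| * hoeffding_sum2 T T else 0.
Proof.
have [d] := ubnP #|S :\: T|; elim: d S => // d IH S; rewrite ltnS => Sd /andP[TS SN].
have [ST|[p]] := finset.set_0Vmem (S :\: T).
  have {}ST : S \subset T by rewrite -finset.setD_eq0 ST.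
  have -> : S = T by apply/eqP; rewrite eqEcard ST.
  by rewrite eqxx finset.setDv cards0 /coef big_ord0 mul1r.
rewrite finset.in_setD => /andP[pT pS].
have := hoeffding_sum2_shift pS pT SN.
have cST : #|S :\: T| = #|(S :\ p) :\: T|.+1.
  rewrite (cardsD1 p) finset.in_setD pS pT add1n; congr _.+1.
  by apply: eq_card => x; rewrite !inE andbCA.
have cK : #|(S :\ p) :|: T| = (#|T| + #|(S :\ p) :\: T|)%N.
  rewrite cardsU [in RHS](cardsD (S :\ p) T).
  by rewrite addnBA ?fintype.subset_leq_card ?finset.subsetIl// addnC.
rewrite cK natrD addrA.
have ccK : c + #|T|%:R + #|(S :\ p) :\: T|%:R != 0.
  by rewrite gt_eqF// !ltr_wpDr.
have step k : k \in T :\: S -> hoeffding_sum2 (k |: S :\ p) T =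
   if #|S| == #|T| then coef #|T| #|(S :\ p) :\: T| * hoeffding_sum2 T T else 0.
  rewrite finset.in_setD => /andP[kS kT].
  have cS : #|k |: S :\ p| = #|S|.
    by rewrite cardsU1 !inE (negbTE kS) andbF/= add1n (cardsD1 p S) pS.
  have cST' : #|(k |: S :\ p) :\: T| = #|(S :\ p) :\: T|.
    by apply: eq_card => x; rewrite !inE; case: eqP => // ->; rewrite kT.
  rewrite IH ?cS ?TS ?SN// ?cST'//.
  by rewrite -ltnS -cST.
rewrite (eq_bigr _ step); case: eqP => cSE; last first.
  by rewrite big1// => /eqP; rewrite mulf_eq0 (negbTE ccK)/= => /eqP.
rewrite sumr_const => E.
have cTS : #|T :\: S| = #|S :\: T|.
  by rewrite !cardsD finset.setIC cSE.
apply: (mulfI ccK); rewrite E cTS cST /coef big_ord_recr/= -mulr_natr.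
by field.
Qed.

End bilinear.

Lemma hoeffding_sum2C (B : {set V} -> {set V} -> R) S T :
  hoeffding_sum2 B S T = hoeffding_sum2 (fun I J => B J I) T S.
Proof.
rewrite /hoeffding_sum2 /hoeffding_sum.
under eq_bigr do rewrite mulr_sumr.
rewrite exchange_big/=; apply: eq_bigr => J _; rewrite mulr_sumr.
by apply: eq_bigr => I _; rewrite mulrCA.
Qed.

Lemma hoeffding_covariance (B : {set V} -> {set V} -> R) (E : nat -> R) W1 W2 :
    (forall J, B finset.set0 J = 0) -> (forall I, B I finset.set0 = 0) ->
    (forall p K I J, p \notin K -> I \subset K -> J \subset K ->
      (#|I| < N)%N -> (c + #|K|%:R) * B (p |: I) J =
         (c + #|I|%:R) * B I J + \sum_(k in K :\: I) B (k |: I) J) ->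
    (forall p K I J, p \notin K -> I \subset K -> J \subset K ->
      (#|J| < N)%N -> (c + #|K|%:R) * B I (p |: J) =
         (c + #|J|%:R) * B I J + \sum_(k in K :\: J) B I (k |: J)) ->
    (forall T, (1 <= #|T| <= N)%N -> hoeffding_sum2 B T T = E #|T|) ->
    #|W1| = N -> #|W2| = N -> [disjoint W1 & W2] ->
  B W1 W2 = \sum_(1 <= s < N.+1) ('C(N, s)%:R ^+ 2 *
      \prod_(1 <= l < s.+1) ((s%:R - l%:R + 1) / (c + s%:R + l%:R - 1))) * E s.
Proof.
move=> B0l B0r Bl Br BE cW1 cW2 W12.
have hs0 S : hoeffding_sum (B finset.set0) S = 0.
  by rewrite /hoeffding_sum big1// => J _; rewrite B0l mulr0.
pose C s : R := \prod_(i < s) (i.+1%:R / (c + s%:R + i%:R)).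
have dE S T : S \subset W1 -> T \subset W2 -> hoeffding_sum2 B S T =
    if #|S| == #|T| then C #|T| * hoeffding_sum2 B T T else 0.
  move=> SW TW.
  have dST : S :&: T = finset.set0.
    apply: disjoint_setI0; apply: fintype.disjointWl SW _.
    by rewrite disjoint_sym; apply: fintype.disjointWl TW _; rewrite disjoint_sym.
  have SD : S :\: T = S by apply/finset.setDidPl; rewrite -finset.setI_eq0 dST.
  have TD : T :\: S = T by apply/finset.setDidPl; rewrite -finset.setI_eq0 finset.setIC dST.
  have SN : (#|S| <= N)%N by rewrite -cW1 fintype.subset_leq_card.
  have TN : (#|T| <= N)%N by rewrite -cW2 fintype.subset_leq_card.
  (* Orthogonality moves points of the larger set; when that is T, the two variables are exchanged
     and [Br] plays the part of [Bl]. *)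
  have [TS|ST] := leqP #|T| #|S|.
    rewrite (hoeffding_sum2_orth B0l Bl) ?TS ?SN// SD.
    by case: eqP => // ->.
  rewrite ltn_eqF// hoeffding_sum2C hoeffding_sum2_orth//.
  - by rewrite gtn_eqF.
  - by move=> p K I J pK IK JK IN; exact: Br.
  - by rewrite (ltnW ST).
have -> : B W1 W2 = \sum_(S : {set V} | S \subset W1)
   \sum_(T : {set V} | T \subset W2) hoeffding_sum2 B S T.
  rewrite (hoeffding_decomposition (F := fun I => B I W2) cW1) ?B0l//.
  apply: eq_bigr => S SW; rewrite /hoeffding_sum2 {2}/hoeffding_sum exchange_big/=.
  apply: eq_bigr => I IS.
  by rewrite -mulr_sumr -(hoeffding_decomposition cW2).
(* The order 0 is forced to 0 because [BE] says nothing about [E 0], while the Hoeffding sum at the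
   empty set vanishes. The sum over T contributes one binomial factor, the sum over S will
   contribute the other. *)
have -> : \sum_(S : {set V} | S \subset W1)
   \sum_(T : {set V} | T \subset W2) hoeffding_sum2 B S T =
  \sum_(S : {set V} | S \subset W1) ('C(N, #|S|)%:R * C #|S| *
    (if #|S| == 0%N then 0 else E #|S|)).
  apply: eq_bigr => S SW.
  have SN : (#|S| <= N)%N by rewrite -cW1 fintype.subset_leq_card.
  rewrite (eq_bigr (fun T : {set V} => if #|T| == #|S| then
      C #|S| * (if #|S| == 0%N then 0 else E #|S|) else 0)) => [|T TW].
    rewrite -big_mkcondr/= (eq_bigl (fun T => T \in
      [set A : {set V} | A \subset W2 & #|A| == #|S|])) => [|T]; last by rewrite inE.
    by rewrite sumr_const cards_draws cW2 -[LHS]mulr_natl mulrA.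
  rewrite dE// eq_sym; case: eqP => // TS; rewrite TS; congr (_ * _).
  have [S0|S0] := eqVneq #|S| 0%N.
    have /eqP : #|T| = 0%N by rewrite TS.
    by rewrite cards_eq0 => /eqP ->; rewrite /hoeffding_sum2 /hoeffding_sum big1//
      => I; rewrite finset.subset0 => /eqP->; rewrite [\sum_(_ | _) _]hs0 mulr0.
  by rewrite BE ?TS// lt0n S0.
rewrite (sum_subsets W1 (fun s => 'C(N, s)%:R * C s * (if s == 0%N then 0 else E s))) cW1.
rewrite big_ltn// eqxx mulr0 mul0r add0r; apply: eq_big_nat => s /andP[s1 sN].
rewrite gtn_eqF// mulrAC; congr (_ * _).
rewrite mulrAC -expr2; congr (_ * _).
rewrite big_add1 big_mkord /C !big_split/= ; congr (_ * _); last first.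
  by rewrite !prodfV; congr (_^-1); apply: eq_bigr => i _; rewrite -natr1; ring.
(* Numerators are matched in reverse order: [coef] runs through 1, ..., s and the statement through
   s, ..., 1. *)
rewrite [RHS](reindex_inj rev_ord_inj)/=; apply: eq_bigr => i _.
rewrite subnSK// natrB ?(ltnW (ltn_ord i))// -natr1; ring.
Qed.

End hoeffding_sums.

(** * Hoeffding kernels as sums over sets of indices *)

Lemma sorted_enum_ord s (I : {set 'I_s}) : sorted ltn [seq val i | i <- enum I].
Proof.
apply: (subseq_sorted ltn_trans (s2 := iota 0 s)); last exact: iota_ltn_sorted.
by rewrite -val_enum_ord map_subseq// /(enum (mem I)) enumT filter_subseq.
Qed.

(** An increasing tuple of indices is the enumeration of the set of its entries. *)
Lemma sum_sorted_tuples (R : nmodType) s a (F : seq 'I_s -> R) :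
  \sum_(j : a.-tuple 'I_s | sorted ltn (map val j)) F j =
  \sum_(I : {set 'I_s} | #|I| == a) F (enum I).
Proof.
transitivity (\sum_(l <- [seq tval j | j : a.-tuple 'I_s <- enum {: a.-tuple 'I_s}
    & sorted ltn (map val j)]) F l).
  by rewrite big_map big_filter big_enum_cond.
transitivity (\sum_(l <- [seq enum A | A : {set 'I_s} <- enum {: {set 'I_s}}
    & #|A| == a]) F l); last first.
  by rewrite big_map big_filter big_enum_cond.
apply: perm_big; apply: uniq_perm.
- rewrite map_inj_uniq; first by rewrite filter_uniq ?enum_uniq.
  by move=> x y xy; exact: val_inj.
- rewrite map_inj_uniq; first by rewrite filter_uniq ?enum_uniq.
  move=> I J IJ.
  by apply/setP => i; rewrite -mem_enum IJ mem_enum.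
move=> l; apply/mapP/mapP => -[].
  move=> j; rewrite mem_filter => /andP[sj _] ->.
  have uj : uniq j by rewrite -(map_inj_uniq val_inj) (sorted_uniq ltn_trans ltnn).
  exists [set i in j].
    by rewrite mem_filter mem_enum cardsE (card_uniqP uj) size_tuple eqxx.
  apply: (inj_map val_inj); apply: (irr_sorted_eq ltn_trans ltnn) => //.
    exact: sorted_enum_ord.
  move=> i; apply/mapP/mapP => -[x xj ->]; exists x => //.
    by rewrite mem_enum inE.
  by move: xj; rewrite mem_enum inE.
move=> I; rewrite mem_filter => /andP[/eqP cI _] ->.
have sI : size (enum I) == a by rewrite -cardE cI.
by exists (Tuple sI) => //; rewrite mem_filter mem_enum sorted_enum_ord.
Qed.

Section hoeffding_of_seq.
Context (R : realType) (T : pointedType) (ts : nat -> nat -> R) (k : seq T -> R).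

(** The kernel with subsets in place of increasing tuples and one function of sequences in place of
    a family indexed by the length. The empty subset adds a multiple of [k [::]], which is 0 in the
    centered case. *)
Definition hoeffding_seq s (t : seq T) : R :=
  \sum_(I : {set 'I_s}) ts s #|I| * k [seq nth point t (val i) | i <- enum I].

End hoeffding_of_seq.

Lemma hoeffding_kernelE (R : realType) (T : pointedType) n (theta : nat -> nat -> R)
    (k : seq T -> R) s (x : s.-tuple T) : k [::] = 0 ->
  hoeffding_kernel n theta (fun a (y : a.-tuple T) => k y) x =
  hoeffding_seq (theta_star n theta) k s x.
Proof.
move=> k0.
have cI (I : {set 'I_s}) : (#|I| < s.+1)%N by rewrite ltnS -[leqRHS]card_ord max_card.
pose G a := theta_star n theta s a *
  \sum_(I : {set 'I_s} | #|I| == a) k [seq nth point x (val i) | i <- enum I].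
transitivity (\sum_(a < s.+1) G a).
  rewrite -(big_mkord xpredT G) big_ltn// [G 0%N]/G.
  rewrite (big_pred1 finset.set0) => [|I]; last by rewrite cards_eq0.
  rewrite enum_set0 k0 mulr0 add0r; apply: eq_big_nat => a _; congr (_ * _).
  rewrite -(sum_sorted_tuples a (fun l => k [seq nth point x (val i) | i <- l])).
  apply: eq_bigr => j _; congr k; apply: eq_map => i /=; exact: tnth_nth.
rewrite /hoeffding_seq (partition_big (fun I : {set 'I_s} => Ordinal (cI I)) predT)//=.
apply: eq_bigr => a _; rewrite /G mulr_sumr; apply: eq_big => [I|I /eqP->//].
by rewrite -val_eqE.
Qed.

Lemma perm_enum_imset (V : finType) s (e : 'I_s -> V) (I : {set 'I_s}) : injective e ->
  perm_eq (enum (e @: I)) [seq e i | i <- enum I].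
Proof.
move=> einj; apply: uniq_perm; rewrite ?enum_uniq// ?map_inj_uniq ?enum_uniq//.
move=> v; rewrite mem_enum; apply/imsetP/mapP => -[i iI ->]; exists i => //.
  by rewrite mem_enum.
by move: iI; rewrite mem_enum.
Qed.

(** Symmetry of [k] is what absorbs the order: the image of [I] under [e] is enumerated in the order
    of [V], not in that of [e]. *)
Lemma hoeffding_sumE (R : realType) (T : pointedType) (ts : nat -> nat -> R)
    (k : seq T -> R) (V : finType) (x : V -> T) s (e : 'I_s -> V) :
    injective e -> (forall t t', perm_eq t t' -> k t = k t') ->
  hoeffding_sum ts (fun I => k [seq x v | v <- enum I]) (e @: [set: 'I_s]) =
  hoeffding_seq ts k s [seq x (e i) | i <- enum 'I_s].
Proof.
move=> einj ksym; rewrite /hoeffding_sum /hoeffding_seq.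
rewrite card_imset// cardsT card_ord.
rewrite (reindex_onto (fun I : {set 'I_s} => e @: I) (fun S => e @^-1: S))/=; last first.
  move=> S Se; apply/setP => v; apply/imsetP/idP => [[i]|vS].
    by rewrite inE => iS ->.
  by have /imsetP[i _ vE] := fintype.subsetP Se v vS; exists i; rewrite // inE -vE.
apply: eq_big => [I|I _].
  rewrite imsetS ?finset.subsetT//=; apply/eqP/setP => i.
  by rewrite inE mem_imset.
rewrite card_imset//; congr (_ * _).
rewrite (ksym _ _ (perm_map x (perm_enum_imset I einj))) -map_comp; congr k.
apply: eq_map => i /=.
by rewrite (nth_map i) ?size_enum_ord// nth_ord_enum.
Qed.

Import numFieldNormedType.Exports.

Local Open Scope classical_set_scope.
Local Open Scope ring_scope.

(** * Measures on tuples are determined by boxes *)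

Section tuple_boxes.
Context d (T : measurableType d).

Definition box k (B : 'I_k -> set T) : set (k.-tuple T) :=
  [set x | forall i, B i (tnth x i)].

Lemma measurable_box k (B : 'I_k -> set T) :
  (forall i, measurable (B i)) -> measurable (box B).
Proof.
move=> mB; rewrite (_ : box B = \bigcap_(i in [set: 'I_k]) (@tnth k T ^~ i @^-1` B i)).
  apply: fin_bigcap_measurable => // i _.
  by rewrite -[X in measurable X]setTI; exact: measurable_tnth.
apply/seteqP; split=> [x xB i _|x xB i]; first exact: (xB i).
exact: (xB i Logic.I).
Qed.

Definition boxes k : set (set (k.-tuple T)) :=
  [set box B | B in [set B : 'I_k -> set T | forall i, measurable (B i)]].

(** A generating cylinder constrains one coordinate, hence is a box whose other sides are the whole
    space. *)
Lemma measurable_boxes k : @measurable _ (k.-tuple T) = <<s @boxes k >>.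
Proof.
apply/seteqP; split; last first.
  apply: smallest_sub; first exact: sigma_algebra_measurable.
  by move=> _ [B mB <-]; exact: measurable_box.
apply: smallest_sub; first exact: smallest_sigma_algebra.
case: k => [|k]; first by rewrite big_ord0.
rewrite -bigcup_mkord_ord => A [i ik [B mB <-]].
apply: sub_sigma_algebra; exists (fun j => if j == inord i then B else setT).
  by move=> j /=; case: ifP.
apply/seteqP; split => [x /(_ (inord i))/=|x [_ Bx] j /=].
  by rewrite eqxx.
by case: eqP => // ->.
Qed.

Lemma boxes_setI k : setI_closed (@boxes k).
Proof.
move=> _ _ [B mB <-] [B' mB' <-]; exists (fun i => B i `&` B' i).
  by move=> i /=; exact: measurableI.
apply/seteqP; split => [x BB|x [Bx B'x] i]; last by split.
by split=> i; have [] := BB i.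
Qed.

Lemma boxes_setT k : boxes [set: k.-tuple T].
Proof. by exists (fun=> setT) => //=; apply/seteqP; split. Qed.

Lemma tuple_measure_unique (R : realType) k
    (m1 m2 : {measure set (k.-tuple T) -> \bar R}) :
    (m1 [set: _] < +oo)%E ->
    (forall B : 'I_k -> set T, (forall i, measurable (B i)) ->
      m1 (box B) = m2 (box B)) ->
  forall C, measurable C -> m1 C = m2 C.
Proof.
move=> m1fin m12 C mC.
apply: (measure_unique (@boxes k) (fun=> setT)) => //.
- exact: measurable_boxes.
- exact: boxes_setI.
- by move=> _; exact: boxes_setT.
- by rewrite bigcup_const.
- by move=> _ [B mB <-]; exact: m12.
Qed.

(** Conditional expectations of all orders are handled as a single function of finite sequences;
    measurability then has to be asked at each length. *)
Definition measurable_on_tuples d' (S : measurableType d') (u : seq T -> S) :=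
  forall k, measurable_fun [set: k.-tuple T] (fun x => u x).

Lemma measurable_seq d' d'' (S : measurableType d') (S' : measurableType d'')
    (I : Type) (J : seq I) (F : I -> S -> T) (u : seq T -> S') :
    (forall i, measurable_fun [set: S] (F i)) -> measurable_on_tuples u ->
  measurable_fun [set: S] (fun s => u [seq F i s | i <- J]).
Proof.
move=> mF mu.
apply: (measurableT_comp (f := fun x : (size J).-tuple T => u x)
  (g := fun s => map_tuple (F ^~ s) (in_tuple J))); first exact: mu.
apply/measurable_fun_tnthP => i; rewrite (_ : _ \o _ = F (tnth (in_tuple J) i))//.
by apply/funext => s; rewrite /= tnth_map.
Qed.

Lemma integral_boxes (R : realType) k
    (m1 m2 : {measure set (k.-tuple T) -> \bar R}) (G : k.-tuple T -> \bar R) :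
    (m1 [set: _] < +oo)%E ->
    (forall B : 'I_k -> set T, (forall i, measurable (B i)) ->
      m1 (box B) = m2 (box B)) ->
  (\int[m1]_x G x = \int[m2]_x G x)%E.
Proof.
move=> m1fin m12; apply: eq_measure_integral => C mC _.
exact: tuple_measure_unique.
Qed.

End tuple_boxes.

(** * Predicting the last draw in the iterated integral *)

Section polya_weights.
Context (R : realType) d (T : measurableType d).
Variable alpha : {finite_measure set T -> \bar R}.
Hypothesis alpha_gt0 : (0 < alpha [set: T])%E.
Local Notation c := (total_mass alpha).
Local Notation pw := (polya_weight alpha).
Implicit Types (s : seq T) (B : set T) (Bs : seq (set T)).

Lemma total_mass_gt0 : 0 < c.
Proof.
by rewrite /total_mass fine_gt0// alpha_gt0/= ltey_eq fin_num_measure.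
Qed.

Let measurables Bs := forall i, measurable (nth setT Bs i).

Let measurables_cons B Bs : measurables (B :: Bs) -> measurable B /\ measurables Bs.
Proof. by move=> mB; split => [|i]; [exact: (mB 0%N)|exact: (mB i.+1)]. Qed.

Let cs0 s : (c + (size s)%:R) != 0.
Proof. by rewrite gt_eqF// ltr_wpDr// total_mass_gt0. Qed.

Lemma polya_weight_ge0 s Bs : (0 <= pw s Bs)%E.
Proof.
elim: Bs s => [|B Bs IH] s //=.
rewrite mule_ge0//; last by apply: integral_ge0 => x _; exact: IH.
by rewrite lee_fin invr_ge0 addr_ge0// ltW// total_mass_gt0.
Qed.

Let wt B s : R := fine (alpha B) + \sum_(i < size s) \1_B (nth point s i).

Let wt_rcons B s a : wt B (rcons s a) = wt B s + \1_B a.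
Proof.
rewrite /wt size_rcons big_ord_recr/= nth_rcons ltnn eqxx addrA.
congr (_ + _ + _); apply: eq_bigr => i _.
by rewrite nth_rcons ltn_ord.
Qed.

Let measure_wt B s : measurable B ->
  measure_add alpha (msum (fun l => \d_(nth point s l)) (size s)) B = (wt B s)%:E.
Proof.
move=> mB; rewrite measure_addE /msum/= /wt EFinD fineK ?fin_num_measure//.
congr (_ + _)%E; rewrite -sumEFin; apply: eq_bigr => i _.
by [].
Qed.

(** The last draw comes from alpha, repeats a point of [s], or repeats the k-th draw, which must
    then lie in both sets. This is not the definition of [polya_weight], which unfolds from the
    first draw. *)
Let rcons_spec Bs := forall B s, measurable B ->
  ((c + (size s)%:R + (size Bs)%:R)%:E * pw s (rcons Bs B) =
   (wt B s)%:E * pw s Bs +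
   \sum_(k < size Bs) pw s (set_nth setT Bs k (nth setT Bs k `&` B)))%E.

Let wt_ge0 B s : 0 <= wt B s.
Proof. by rewrite addr_ge0// ?fine_ge0// sumr_ge0. Qed.

Let measurable_spec Bs := forall s,
  measurable_fun [set: T] (fun a => pw (rcons s a) Bs).

Let measurables_set_nth Bs k B : measurables Bs -> measurable B ->
  measurables (set_nth setT Bs k B).
Proof. by move=> mBs mB i; rewrite nth_set_nth/=; case: eqP. Qed.

(** The two properties need each other: splitting the integrals in the formula uses measurability in
    the drawn point, and measurability for a list with one more set is read off the formula for the
    shorter list. *)
Let polya_weight_specs k Bs : size Bs = k -> measurables Bs ->
  rcons_spec Bs /\ measurable_spec Bs.
Proof.
elim: k Bs => [|k IH] Bs sBs mBs.
  rewrite (size0nil sBs); split; last by move=> s /=; exact: measurable_cst.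
  move=> B s mB /=; rewrite addr0 big_ord0 adde0 mule1 muleA -EFinM mulfV//.
  by rewrite mul1e integral_cst// mul1e; exact: measure_wt.
split.
  case: Bs sBs mBs => // B0 Bs [sBs] /measurables_cons[mB0 mBs] B s mB /=.
  have [IHr IHm] := IH _ sBs mBs.
  set nu := measure_add _ _.
  have mSn (i : 'I_(size Bs)) :
      measurable_spec (set_nth setT Bs i (nth setT Bs i `&` B)).
    apply: (IH _ _ _).2; first by rewrite size_set_nth -sBs; exact/maxn_idPr.
    by apply: measurables_set_nth => //; apply: measurableI => //; exact: mBs.
  have nuge : (0 <= (c + (size s)%:R)^-1)%R.
    by rewrite invr_ge0 addr_ge0// ltW// total_mass_gt0.
  have mIH : measurable_fun B0 (fun a => pw (rcons s a) Bs).
    exact: measurable_funTS.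
  have mIHr : measurable_fun setT (fun a => pw (rcons s a) (rcons Bs B)).
    apply: (eq_measurable_fun (fun a =>
      ((c + (size s).+1%:R + (size Bs)%:R)^-1%:E * ((wt B s + \1_B a)%:E * pw (rcons s a) Bs +
       \sum_(k < size Bs) pw (rcons s a) (set_nth setT Bs k (nth setT Bs k `&` B))))%E)).
      move=> a _; rewrite -wt_rcons -IHr// size_rcons muleA -EFinM mulVf ?mul1e//.
      by rewrite gt_eqF// !ltr_wpDr// total_mass_gt0.
    apply: measurable_funeM; apply: emeasurable_funD.
      apply: emeasurable_funM => //; apply/measurable_EFinP.
      by apply: measurable_funD => //; exact: measurable_indic.
    apply: emeasurable_sum => i.
    exact: mSn.
  transitivity ((c + (size s)%:R)^-1%:E *
    \int[nu]_(a in B0) ((c + (size s).+1%:R + (size Bs)%:R)%:E * pw (rcons s a) (rcons Bs B)))%E.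
    rewrite ge0_integralZl//; first last.
    - by rewrite lee_fin !addr_ge0// ltW// total_mass_gt0.
    - by move=> a _; exact: polya_weight_ge0.
    - exact: measurable_funTS.
    rewrite muleCA; congr (_%:E * _)%E.
    by rewrite -!addrA -!natrD addSnnS.
  (* The draw [a] from [B0] has joined the history, so the weight of [B] is [wt B s + \1_B a]. Its
     second part restricts [a] to the intersection of [B0] and [B], which is the term k = 0 of the
     sum. *)
  transitivity ((c + (size s)%:R)^-1%:E *
    (\int[nu]_(a in B0) ((wt B s)%:E * pw (rcons s a) Bs) +
     \int[nu]_(a in B0) ((\1_B a)%:E * pw (rcons s a) Bs) +
     \sum_(k < size Bs) \int[nu]_(a in B0)
        pw (rcons s a) (set_nth setT Bs k (nth setT Bs k `&` B))))%E.
    congr (_ * _)%E; rewrite -ge0_integral_sum//; first last.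
    - by move=> n x _; exact: polya_weight_ge0.
    - by move=> n; apply: measurable_funTS; exact: mSn.
    have m1 : measurable_fun B0 (fun a => (wt B s)%:E * pw (rcons s a) Bs)%E.
      exact: measurable_funeM.
    have m2 : measurable_fun B0 (fun a => (\1_B a)%:E * pw (rcons s a) Bs)%E.
      apply: emeasurable_funM => //; apply/measurable_EFinP.
      exact: measurable_indic.
    rewrite -ge0_integralD//; first last.
    - by move=> a _; rewrite mule_ge0// ?lee_fin// polya_weight_ge0.
    - by move=> a _; rewrite mule_ge0// ?lee_fin// polya_weight_ge0.
    rewrite -ge0_integralD//; first last.
    - apply: emeasurable_sum => i; apply: measurable_funTS; exact: mSn.
    - by move=> a _; apply: sume_ge0 => i _; exact: polya_weight_ge0.
    - exact: emeasurable_funD.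
    - by move=> a _; rewrite adde_ge0// mule_ge0// ?lee_fin// polya_weight_ge0.
    apply: eq_integral => a _; have := IHr B (rcons s a) mB.
    rewrite size_rcons => ->; rewrite wt_rcons EFinD ge0_muleDl ?lee_fin//.
  have intC0 : (0 <= (c + (size s)%:R)^-1%:E)%E by rewrite lee_fin.
  have I0 (g : T -> R) : (forall a, 0 <= g a) ->
      (0 <= \int[nu]_(a in B0) ((g a)%:E * pw (rcons s a) Bs))%E.
    by move=> g0; apply: integral_ge0 => a _; rewrite mule_ge0 ?lee_fin ?polya_weight_ge0.
  have I1 (j : 'I_(size Bs)) : (0 <= \int[nu]_(a in B0)
      pw (rcons s a) (set_nth setT Bs j (nth setT Bs j `&` B)))%E.
    by apply: integral_ge0 => a _; exact: polya_weight_ge0.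
  have X1ge := I0 (fun=> wt B s) (fun=> wt_ge0 B s).
  have X2ge : (0 <= \int[nu]_(a in B0) ((\1_B a)%:E * pw (rcons s a) Bs))%E.
    exact: (I0 (fun a => \1_B a)).
  have X3ge : (0 <= \sum_(k < size Bs) \int[nu]_(a in B0)
      pw (rcons s a) (set_nth setT Bs k (nth setT Bs k `&` B)))%E.
    by apply: sume_ge0 => j _; exact: I1.
  rewrite (ge0_muleDr _ (adde_ge0 X1ge X2ge) X3ge) (ge0_muleDr _ X1ge X2ge).
  rewrite big_ord_recl /= -/nu addeA.
  congr (_ + _ + _)%E.
  - rewrite ge0_integralZl// ?lee_fin//; first by rewrite muleCA.
    by move=> a _; exact: polya_weight_ge0.
  - congr (_ * _)%E; rewrite integral_mkcondr; apply: eq_integral => a _.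
    by rewrite /patch indicE; case: (a \in B); rewrite ?mul1e ?mul0e.
  - by rewrite ge0_sume_distrr// => i _; apply: integral_ge0 => a _; exact: polya_weight_ge0.
case/lastP: Bs sBs mBs => // Bs B; rewrite size_rcons => -[sBs] mBs s.
have mB : measurable B.
  by have := mBs (size Bs); rewrite nth_rcons ltnn eqxx.
have {}mBs : measurables Bs.
  move=> i; have := mBs i; rewrite nth_rcons; case: ltngtP => [//|ik _|ik _].
    by rewrite nth_default// ltnW.
  by rewrite nth_default// ik.
have [IHr IHm] := IH _ sBs mBs.
have mSn (i : 'I_(size Bs)) :
    measurable_spec (set_nth setT Bs i (nth setT Bs i `&` B)).
  apply: (IH _ _ _).2; first by rewrite size_set_nth -sBs; exact/maxn_idPr.
  by apply: measurables_set_nth => //; apply: measurableI => //; exact: mBs.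
apply: (eq_measurable_fun (fun a =>
  ((c + (size s).+1%:R + (size Bs)%:R)^-1%:E * ((wt B s + \1_B a)%:E * pw (rcons s a) Bs +
   \sum_(k < size Bs) pw (rcons s a) (set_nth setT Bs k (nth setT Bs k `&` B))))%E)).
  move=> a _; rewrite -wt_rcons -IHr// size_rcons muleA -EFinM mulVf ?mul1e//.
  by rewrite gt_eqF// !ltr_wpDr// total_mass_gt0.
apply: measurable_funeM; apply: emeasurable_funD.
  apply: emeasurable_funM => //; apply/measurable_EFinP.
  by apply: measurable_funD => //; exact: measurable_indic.
by apply: emeasurable_sum => i; exact: mSn.
Qed.

Lemma polya_weight_rcons s Bs B :
  (forall i, measurable (nth setT Bs i)) -> measurable B ->
  ((c + (size s)%:R + (size Bs)%:R)%:E * pw s (rcons Bs B) =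
   (fine (alpha B) + \sum_(i < size s) \1_B (nth point s i))%:E * pw s Bs +
   \sum_(k < size Bs) pw s (set_nth setT Bs k (nth setT Bs k `&` B)))%E.
Proof. by move=> mBs mB; have [H _] := polya_weight_specs erefl mBs; exact: H. Qed.

End polya_weights.

(** * Mixed moments of D and laws along distinct indices *)

Lemma cvg_prod_seq (R : realType) (I : Type) (r : seq I) (f : I -> nat -> R) (l : I -> R) :
  (forall i, f i @ \oo --> l i) ->
  (fun m => \prod_(i <- r) f i m) @ \oo --> \prod_(i <- r) l i.
Proof.
move=> fl; elim: r => [|i r IH].
  by under eq_fun do rewrite big_nil; rewrite big_nil; exact: cvg_cst.
under eq_fun do rewrite big_cons.
by rewrite big_cons; apply: cvgM.
Qed.

Lemma prod_indic (R : realType) (I : finType) (T : Type) (A : I -> set T) (x : I -> T) :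
  \prod_i \1_(A i) (x i) = (`[< forall i, A i (x i) >])%:R :> R.
Proof.
case: (asboolP (forall i, A i (x i))) => [Ax|/existsNP[i Ax]].
  by rewrite big1// => i _; rewrite indicE mem_set.
by rewrite (bigD1 i)//= indicE memNset// mul0r.
Qed.

Section polya_law.
Context (R : realType) d (T : measurableType d).
Variable alpha : {finite_measure set T -> \bar R}.
Context d' (Omega : measurableType d') (P : probability Omega R).
Variables (X : nat -> {RV P >-> T}) (D : {RV P >-> pprobability T R}).
Hypotheses (X_polya : polya_sequence alpha X) (D_limit : empirical_limit X D).

Lemma measurable_random_probability (B : set T) : measurable B ->
  measurable_fun [set: Omega] (fun w => fine (D w B)).
Proof.
move=> mB; apply: (measurableT_comp (f := fine)) => //.
exact: (@measurable_kernel _ _ _ _ _ (kprobability (measurable_funPT D)) B mB).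
Qed.

Lemma polya_increasing k (j : 'I_k -> nat) (B : 'I_k -> set T) :
    (forall u v : 'I_k, (u < v)%N -> (j u < j v)%N) ->
    (forall i, measurable (B i)) ->
  P [set w | forall i, B i (X (j i) w)] =
  polya_weight alpha [::] [seq B i | i : 'I_k].
Proof.
move=> jinc mB; have [k0|k0] := posnP k; last exact: X_polya.
have -> : [seq B i | i : 'I_k] = [::] by apply/nilP; rewrite /nilp size_map size_enum_ord k0.
rewrite (_ : [set w | _] = setT) ?probability_setT//.
by apply/seteqP; split=> // w _ i; move: (ltn_ord i); rewrite {2}k0.
Qed.

Lemma measurable_event (I : finType) (j : I -> nat) (B : I -> set T) :
  (forall i, measurable (B i)) -> measurable [set w | forall i, B i (X (j i) w)].
Proof.
move=> mB; rewrite (_ : [set w | _] = \bigcap_(i in [set: I]) (X (j i) @^-1` B i)).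
  apply: fin_bigcap_measurable => // i _.
  by rewrite -[X in measurable X]setTI; exact: measurable_funPT.
by apply/seteqP; split=> [w wB i _|w wB i]; [exact: wB|exact: (wB i)].
Qed.

Let partial_sum (B : set T) m w : R := \sum_(i < m) \1_B (X i w).

(** Dominated convergence for products of block means. The expectation is already constant in m > 0:
    expanding the product gives m^k events of the same Polya probability. The left-hand side is
    symmetric in the sets, and exchangeability comes from there. *)
Lemma expectation_random_probabilities k (B : 'I_k -> set T) :
    (forall i, measurable (B i)) ->
  (\int[P]_w (\prod_(i < k) fine (D w (B i)))%:E =
  polya_weight alpha [::] [seq B i | i : 'I_k])%E.
Proof.
move=> mB.
(* The i-th factor is approximated by the empirical mean over the i-th block of
   length m, so that the indices met in the product are increasing. *)
pose blk i m w : R := m%:R^-1 * \sum_(l < m) \1_(B i) (X (i * m + l)%N w).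
pose f m w := (\prod_(i < k) blk i m w)%:E.
(* A block is the difference of two initial segments, whose empirical means are controlled by
   [D_limit]. *)
have blkE i m w : blk i m w = m%:R^-1 * partial_sum (B i) (i.+1 * m)%N w
     - m%:R^-1 * partial_sum (B i) (i * m)%N w.
  rewrite -mulrBr /partial_sum mulSn addnC big_split_ord/=.
  by rewrite [_ + \sum_(l < m) _]addrC addrK.
have blk_cvg : {ae P, forall w, forall i, (fun m => blk i m w) @ \oo --> fine (D w (B i))}.
  suff H : {ae P, forall w, forall n : nat, forall ni : (n < k)%N,
      (fun m => blk (Ordinal ni) m w) @ \oo --> fine (D w (B (Ordinal ni)))}.
    apply: filterS H => w H i; have := H i (ltn_ord i).
    by rewrite (_ : Ordinal _ = i)//; exact: val_inj.
  apply: ae_foralln => n; have /orP[kn|ni] := leqVgt k n.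
    by apply: aeW => w ni; move: kn; rewrite leqNgt ni.
  have := D_limit (mB (Ordinal ni)); apply: filterS => w emp ni'.
  rewrite (bool_irrelevance ni' ni); set i := Ordinal ni.
  have ps_cvg q : (fun m => m%:R^-1 * partial_sum (B i) (q * m)%N w) @ \oo -->
      q%:R * fine (D w (B i)).
    case: q => [|q].
      rewrite mul0r (_ : (fun _ => _) = cst 0); first exact: cvg_cst.
      by apply/funext => m; rewrite /partial_sum mul0n big_ord0 mulr0.
    rewrite (_ : (fun _ => _) = (fun m => q.+1%:R * ((q.+1 * m)%N%:R^-1 *
        partial_sum (B i) (q.+1 * m)%N w))); last first.
      by apply/funext => m; rewrite natrM invfM !mulrA mulfV// mul1r.
    apply: cvgM; first exact: cvg_cst.
    apply: (@cvg_comp _ _ _ (fun m => (q.+1 * m)%N)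
      (fun m => m%:R^-1 * partial_sum (B i) m w) _ \oo) emp.
    apply/cvgnyPge => M; near=> m; rewrite mulSn (@leq_trans m) ?leq_addr//.
    by near: m; exact: nbhs_infty_ge.
  under eq_fun do rewrite blkE.
  have -> : fine (D w (B i)) = i.+1%:R * fine (D w (B i)) - i%:R * fine (D w (B i)).
    by rewrite -mulrBl -natrB// subSnn mul1r.
  by apply: cvgB; exact: ps_cvg.
have mblk i m : measurable_fun setT (blk i m).
  apply: measurable_funM => //; apply: measurable_sum => l.
  by apply: (measurableT_comp (f := \1_(B i) : T -> R)).
have blk01 i m w : 0 <= blk i m w <= 1.
  rewrite /blk mulr_ge0 ?invr_ge0 ?sumr_ge0//=.
  have [->|m0] := posnP m; first by rewrite big_ord0 mulr0.
  rewrite ler_pdivrMl ?ltr0n// mulr1.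
  rewrite (@le_trans _ _ (\sum_(l < m) 1))//; last by rewrite sumr_const card_ord.
  by apply: ler_sum => l _; rewrite indicE; case: (_ \in _).
have [] := @dominated_convergence _ _ _ P setT measurableT f
  (fun w => (\prod_(i < k) fine (D w (B i)))%:E) (cst 1%E).
- by move=> m; apply/measurable_EFinP; apply: measurable_prod => i _.
- apply/measurable_EFinP; apply: measurable_prod => i _.
  exact: measurable_random_probability.
- apply: filterS blk_cvg => w cw _; apply: cvg_EFin; first exact: nearW.
  exact: cvg_prod_seq.
- exact: finite_measure_integrable_cst.
- apply: aeW => w m _; rewrite /f /= lee_fin normr_prod.
  apply: (@le_trans _ _ (\prod_(i < k) 1)); last by rewrite big1.
  apply: ler_prod => i _; rewrite normr_ge0/=.
  by have /andP[b0 b1] := blk01 i m w; rewrite ger0_norm.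
move=> _ _ /= /cvg_lim <- //; apply: cvg_lim => //; apply: cvg_near_cst.
near=> m.
have m0 : (0 < m)%N by near: m; exact: nbhs_infty_gt.
(* A choice function [phi] picks one index in each block, and i * m + phi i increases with i, so the
   Polya law applies. *)
transitivity (\int[P]_w ((m%:R ^- k) * \sum_(phi : {ffun 'I_k -> 'I_m})
    (`[< forall i, B i (X (i * m + phi i)%N w) >])%:R)%:E)%E.
  apply: eq_integral => w _; rewrite /f /blk big_split/= prodr_const card_ord.
  rewrite exprVn bigA_distr_bigA; congr (_ * _)%:E.
  apply: eq_bigr => phi _.
  by rewrite (prod_indic _ B (fun i => X (i * m + phi i)%N w)).
pose A (phi : {ffun 'I_k -> 'I_m}) := [set w | forall i, B i (X (i * m + phi i)%N w)].
have mA phi : measurable (A phi) by exact: measurable_event.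
have PA phi : P (A phi) = polya_weight alpha [::] [seq B i | i : 'I_k].
  apply: polya_increasing => // u v uv.
  rewrite (@leq_trans (u * m + m))// ?ltn_add2l//.
  by rewrite (@leq_trans (v * m))// ?leq_addr// addnC -mulSn leq_mul2r uv orbT.
transitivity (\int[P]_w ((m%:R ^- k)%:E * \sum_(phi : {ffun 'I_k -> 'I_m})
    (\1_(A phi) w)%:E))%E.
  apply: eq_integral => w _; rewrite EFinM -sumEFin; congr (_ * _)%E.
rewrite ge0_integralZl//; last 2 first.
- by apply: emeasurable_sum => phi; apply/measurable_EFinP; exact: measurable_indic.
- by move=> w _; apply: sume_ge0 => phi _; rewrite lee_fin.
rewrite ge0_integral_sum//; last first.
- by move=> phi; apply/measurable_EFinP; exact: measurable_indic.
rewrite (eq_bigr (fun=> polya_weight alpha [::] [seq B i | i : 'I_k])); last first.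
  by move=> phi _; rewrite integral_indic// setIT; exact: PA.
rewrite -(PA [ffun=> Ordinal m0]) -(fineK (fin_num_measure P _ (mA _))).
rewrite sumEFin -EFinM sumr_const card_ffun !card_ord -[X in _ * X]mulr_natl mulrA.
by rewrite natrX mulVf ?mul1r// expf_neq0// pnatr_eq0 -lt0n.
Unshelve. all: by end_near. Qed.

(** Sorting the indices reduces to the increasing case, and the product of the D(B_i) does not see
    the permutation. *)
Lemma polya_injective k (j : 'I_k -> nat) (B : 'I_k -> set T) : injective j ->
    (forall i, measurable (B i)) ->
  P [set w | forall i, B i (X (j i) w)] =
  (\int[P]_w (\prod_(i < k) fine (D w (B i)))%:E)%E.
Proof.
move=> jinj mB.
pose t := [tuple j i | i < k].
have [s st] : exists s : 'S_k, forall u v : 'I_k, (u < v)%N -> (j (s u) < j (s v))%N.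
  have : perm_eq (sort leq t) t by rewrite perm_sort.
  have ss : size (sort leq t) == k by rewrite size_sort size_tuple.
  move=> /(@tuple_permP _ _ (Tuple ss) t)[s tE]; exists s => u v uv.
  have sorted_t : sorted ltn (sort leq t).
    rewrite ltn_sorted_uniq_leq sort_sorted ?andbT; last exact: leq_total.
    by rewrite sort_uniq map_inj_uniq ?enum_uniq.
  have h (x : 'I_k) : nth 0%N (sort leq t) x = j (s x).
    rewrite tE -tnth_nth tnth_mktuple tnth_mktuple//.
  by rewrite -!h; apply: (sorted_ltn_nth ltn_trans) => //; rewrite inE (eqP ss).
transitivity (P [set w | forall i, B (s i) (X (j (s i)) w)]).
  congr (P _); apply/seteqP; split=> w wB i; first exact: wB.
  by rewrite -(permKV s i).
have mBs i : measurable (B (s i)) by exact: mB.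
rewrite (@polya_increasing _ (j \o s) (B \o s))//.
rewrite -expectation_random_probabilities//; apply: eq_integral => w _; congr (_%:E).
by rewrite [RHS](reindex_inj (@perm_inj _ s)).
Qed.

Lemma polya_law (J : seq nat) (Bs : seq (set T)) : uniq J -> size Bs = size J ->
    (forall i, measurable (nth setT Bs i)) ->
  P [set w | forall i, (i < size J)%N -> nth setT Bs i (X (nth 0%N J i) w)] =
  polya_weight alpha [::] Bs.
Proof.
move=> uJ sBs mBs.
have := @polya_injective (size J) (fun i => nth 0%N J i) (fun i => nth setT Bs i).
rewrite expectation_random_probabilities//.
have -> : [seq nth setT Bs i | i : 'I_(size J)] = Bs.
  apply: (@eq_from_nth _ setT); first by rewrite size_map size_enum_ord sBs.
  move=> i; rewrite size_map size_enum_ord => iJ.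
  by rewrite (nth_map (Ordinal iJ)) ?size_enum_ord// nth_enum_ord.
move=> <-//; last by move=> u v /eqP; rewrite nth_uniq// => /eqP/val_inj.
congr (P _); apply/seteqP; split=> w wB i; first exact: wB.
by move=> iJ; exact: (wB (Ordinal iJ)).
Qed.

End polya_law.

(** * The prediction rule for nonnegative integrands *)

Section seq_boxes.
Context d (T : measurableType d).
Implicit Types (s : seq T) (Bs : seq (set T)).

Definition seq_box Bs : set (seq T) :=
  [set s | forall i, (i < size Bs)%N -> nth setT Bs i (nth point s i)].

Lemma seq_box_rcons Bs B s a : size s = size Bs ->
  seq_box (rcons Bs B) (rcons s a) <-> seq_box Bs s /\ B a.
Proof.
move=> ss; rewrite /seq_box/= size_rcons; split=> [H|[H Ba] i].
  split=> [i iB|]; last first.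
    by have := H (size Bs) (ltnSn _); rewrite !nth_rcons ss ltnn eqxx.
  by have := H i (leqW iB); rewrite !nth_rcons ss iB.
rewrite !nth_rcons ss ltnS leq_eqVlt => /orP[/eqP->|iB]; first by rewrite ltnn eqxx.
by rewrite iB; exact: H.
Qed.

Lemma seq_box_set_nth Bs B s k : (k < size Bs)%N ->
  seq_box (set_nth setT Bs k (nth setT Bs k `&` B)) s <->
  seq_box Bs s /\ B (nth point s k).
Proof.
move=> kB; have sE : size (set_nth setT Bs k (nth setT Bs k `&` B)) = size Bs.
  by rewrite size_set_nth; exact/maxn_idPr.
rewrite /seq_box/= sE; split=> [H|[H Bk] i iB].
  split=> [i iB|]; last by have := H k kB; rewrite nth_set_nth/= eqxx => -[].
  by have := H i iB; rewrite nth_set_nth/=; case: eqP => [->[]|].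
by rewrite nth_set_nth/=; case: eqP => [->|_]; [split => //|]; exact: H.
Qed.

Lemma integral_seq_boxes (R : realType) k
    (m1 m2 : {measure set (k.-tuple T) -> \bar R}) (G : k.-tuple T -> \bar R) :
    (m1 [set: _] < +oo)%E ->
    (forall Bs, size Bs = k -> (forall i, measurable (nth setT Bs i)) ->
      m1 [set x | seq_box Bs x] = m2 [set x | seq_box Bs x]) ->
  (\int[m1]_x G x = \int[m2]_x G x)%E.
Proof.
move=> m1oo H; apply: integral_boxes => // B mB.
have := H [seq B i | i : 'I_k]; rewrite size_map size_enum_ord => /(_ erefl).
have BE (i : 'I_k) : nth setT [seq B i | i : 'I_k] i = B i.
  by rewrite (nth_map i) ?size_enum_ord// nth_ord_enum.
have <- : [set x : k.-tuple T | seq_box [seq B i | i : 'I_k] x] = box B.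
  apply/seteqP; split=> x; rewrite /seq_box/= size_map size_enum_ord => xB i.
    by have := xB i (ltn_ord i); rewrite BE -tnth_nth.
  by move=> ik; rewrite (BE (Ordinal ik)) -(tnth_nth point x (Ordinal ik)); exact: xB.
apply=> i; have [ik|ki] := ltnP i k; first by rewrite (BE (Ordinal ik)).
by rewrite nth_default// size_map size_enum_ord.
Qed.

End seq_boxes.

Section image_measure.
Context d1 d2 (T1 : measurableType d1) (T2 : measurableType d2) (R : realType).
Variables (f : T1 -> T2) (mf : measurable_fun [set: T1] f).
Variable mu : {measure set T1 -> \bar R}.

(** The [let] records the measurability proof in the term, so that the measure structure can be
    inferred for a function that is not packaged as a measurable one. *)
Definition image_measure : set T2 -> \bar R := let _ := mf in pushforward mu f.

Let f_mixin := isMeasurableFun.Build _ _ _ _ _ mf.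
Let f_pack : {mfun T1 >-> T2} := HB.pack f f_mixin.

Let image0 : image_measure set0 = 0%E.
Proof. exact: (measure0 (pushforward mu f_pack)). Qed.

Let image_ge0 A : (0 <= image_measure A)%E.
Proof. exact: (measure_ge0 (pushforward mu f_pack)). Qed.

Let image_sigma_additive : semi_sigma_additive image_measure.
Proof. exact: (@measure_semi_sigma_additive _ _ _ (pushforward mu f_pack)). Qed.

HB.instance Definition _ :=
  isMeasure.Build _ _ _ image_measure image0 image_ge0 image_sigma_additive.

Lemma ge0_integral_image (g : T2 -> \bar R) :
  measurable_fun setT g -> (forall x, 0 <= g x)%E ->
  (\int[image_measure]_x g x = \int[mu]_x g (f x))%E.
Proof. by move=> mg g0; rewrite ge0_integral_pushforward. Qed.

End image_measure.

Lemma measurable_rcons_tuple d d' (S : measurableType d) (T : measurableType d')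
    k (g : S -> k.-tuple T) (f : S -> T) :
    measurable_fun [set: S] g -> measurable_fun [set: S] f ->
  measurable_fun [set: S] (fun s => rcons_tuple (g s) (f s)).
Proof.
move=> mg mf; apply/measurable_fun_tnthP => i.
have [ik|ki] := ltnP i k.
  rewrite (_ : _ \o _ = @tnth k T ^~ (Ordinal ik) \o g).
    by apply: measurableT_comp => //; exact: measurable_tnth.
  by apply/funext => s /=; rewrite !(tnth_nth (f s))/= nth_rcons size_tuple ik.
rewrite (_ : _ \o _ = f)//; apply/funext => s /=.
rewrite (tnth_nth (f s))/= nth_rcons size_tuple ltnNge ki/=.
by rewrite (_ : (i : nat) = k) ?eqxx//; apply/eqP; rewrite eqn_leq ki -ltnS ltn_ord.
Qed.

Section polya_prediction.
Context (R : realType) d (T : measurableType d).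
Variable alpha : {finite_measure set T -> \bar R}.
Hypothesis alpha_gt0 : (0 < alpha [set: T])%E.
Context d' (Omega : measurableType d') (P : probability Omega R).
Variables (X : nat -> {RV P >-> T}) (D : {RV P >-> pprobability T R}).
Hypotheses (X_polya : polya_sequence alpha X) (D_limit : empirical_limit X D).
Local Notation c := (total_mass alpha).

Definition subsample (J : seq nat) (w : Omega) : seq T := [seq X i w | i <- J].

Local Notation sample := subsample.

Lemma measurable_sample d'' (S : measurableType d'') (J : seq nat) (u : seq T -> S) :
  measurable_on_tuples u -> measurable_fun [set: Omega] (fun w => u (sample J w)).
Proof. by move=> mu; apply: measurable_seq. Qed.

Let YT (J : seq nat) (w : Omega) : (size J).-tuple T :=
  map_tuple (fun i => X i w) (in_tuple J).

Let measurable_YT J : measurable_fun setT (YT J).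
Proof.
apply/measurable_fun_tnthP => i; rewrite (_ : _ \o _ = X (tnth (in_tuple J) i))//.
by apply/funext => w; rewrite /= tnth_map.
Qed.

Lemma sample_law J Bs : uniq J -> size Bs = size J ->
    (forall i, measurable (nth setT Bs i)) ->
  P [set w | seq_box Bs (sample J w)] = polya_weight alpha [::] Bs.
Proof.
move=> uJ sB mB; rewrite -(polya_law X_polya D_limit uJ sB mB).
congr (P _); apply/seteqP; split=> w; rewrite /seq_box/= sB => wB i iJ.
  by have := wB i iJ; rewrite (nth_map 0%N).
by rewrite (nth_map 0%N)//; exact: wB.
Qed.

(** Exchangeability: by [sample_law] the law of X along distinct indices depends on their number
    only. *)
Lemma integral_sample_perm (J J' : seq nat) (G : seq T -> \bar R) :
    uniq J -> uniq J' -> size J = size J' -> measurable_on_tuples G ->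
    (forall s, 0 <= G s)%E ->
  (\int[P]_w G (sample J w) = \int[P]_w G (sample J' w))%E.
Proof.
move=> uJ uJ' sJ mG G0.
pose YT' w : (size J).-tuple T := tcast (esym sJ) (YT J' w).
have mYT' : measurable_fun setT YT'.
  apply/measurable_fun_tnthP => i.
  rewrite (_ : _ \o _ = X (tnth (in_tuple J') (cast_ord sJ i)))//.
  by apply/funext => w; rewrite /= tcastE tnth_map esymK.
have YT'E w : YT' w = sample J' w :> seq T by rewrite val_tcast.
have mGJ := mG (size J).
have := @integral_seq_boxes _ _ _ _ (image_measure (@measurable_YT J) P)
  (image_measure mYT' P) (fun x : (size J).-tuple T => G x).
rewrite !ge0_integral_image//.
have -> : (\int[P]_w G (YT' w) = \int[P]_w G (sample J' w))%E.
  by apply: eq_integral => w _; rewrite YT'E.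
apply.
  by change (P (YT J @^-1` setT) < +oo)%E; rewrite preimage_setT probability_setT ltry.
move=> Bs sB mB; change (P [set w | seq_box Bs (sample J w)] = P [set w | seq_box Bs (YT' w)]).
rewrite sample_law// -(@sample_law J')// ?sB//.
by congr (P _); apply/seteqP; split=> w /=; rewrite YT'E.
Qed.

(** Both sides integrate [G] against measures on tuples, so boxes suffice, and there the identity is
    [polya_weight_rcons] with an empty history. *)
Lemma polya_prediction_ge0 K p (G : seq T -> \bar R) :
    uniq (rcons K p) -> measurable_on_tuples G -> (forall s, 0 <= G s)%E ->
  ((c + (size K)%:R)%:E * \int[P]_w G (sample (rcons K p) w) =
   \int[P \x alpha]_z G (rcons (sample K z.1) z.2) +
   \sum_(k <- K) \int[P]_w G (rcons (sample K w) (X k w)))%E.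
Proof.
move=> uKp mG G0.
have uK : uniq K by move: uKp; rewrite rcons_uniq => /andP[].
have c0 := total_mass_gt0 alpha_gt0.
have cK0 : 0 <= c + (size K)%:R by rewrite addr_ge0// ltW.
pose T0 w := rcons_tuple (YT K w) (X p w).
pose T1 (z : Omega * T) := rcons_tuple (YT K z.1) z.2.
pose T2 k w := rcons_tuple (YT K w) (X (nth 0%N K k) w).
have mT0 : measurable_fun setT T0 by exact: measurable_rcons_tuple.
have mT1 : measurable_fun setT T1.
  apply: measurable_rcons_tuple; last exact: measurable_snd.
  apply: (@measurableT_comp _ _ _ _ _ _ (YT K)); first exact: measurable_YT.
  exact: measurable_fst.
have mT2 k : measurable_fun setT (T2 k) by exact: measurable_rcons_tuple.
pose m1 := mscale (NngNum cK0) (image_measure mT0 P).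
pose m2 := measure_add (image_measure mT1 (P \x alpha)%E)
  (msum (fun k => image_measure (@mT2 k) P) (size K)).
have mGK := mG (size K).+1.
have := @integral_seq_boxes _ _ _ _ m1 m2 (fun x : (size K).+1.-tuple T => G x).
rewrite ge0_integral_mscale// ge0_integral_measure_add//.
rewrite ge0_integral_measure_sum// !ge0_integral_image//.
under eq_bigr do rewrite ge0_integral_image//.
rewrite (big_nth 0%N) big_mkord.
have -> : (\int[P]_w G (T0 w) = \int[P]_w G (sample (rcons K p) w))%E.
  by apply: eq_integral => w _; rewrite /subsample map_rcons.
apply.
  change ((c + (size K)%:R)%:E * P (T0 @^-1` setT) < +oo)%E.
  by rewrite preimage_setT probability_setT mule1 ltry.
case/lastP => // Bs B; rewrite size_rcons => -[sBs] mB.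
have mBl : measurable B by have := mB (size Bs); rewrite nth_rcons ltnn eqxx.
have {}mB i : measurable (nth setT Bs i).
  have := mB i; rewrite nth_rcons; case: ltngtP => [//|ik _|ik _].
    by rewrite nth_default// ltnW.
  by rewrite nth_default// ik.
have sYK w : size (sample K w) = size Bs by rewrite size_map.
transitivity ((P \x alpha)%E (T1 @^-1` [set x | seq_box (rcons Bs B) x]) +
    \sum_(k < size K) P (T2 k @^-1` [set x | seq_box (rcons Bs B) x]))%E;
  last by rewrite -[RHS]/(measure_add (image_measure mT1 (P \x alpha)%E)
    (msum (fun k => image_measure (@mT2 k) P) (size K))
    [set x : (size K).+1.-tuple T | seq_box (rcons Bs B) x]) measure_addE.
change ((c + (size K)%:R)%:E * P (T0 @^-1` [set x | seq_box (rcons Bs B) x]) =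
  (P \x alpha)%E (T1 @^-1` [set x | seq_box (rcons Bs B) x]) +
    \sum_(k < size K) P (T2 k @^-1` [set x | seq_box (rcons Bs B) x]))%E.
have -> : T0 @^-1` [set x | seq_box (rcons Bs B) x] =
    [set w | seq_box (rcons Bs B) (sample (rcons K p) w)].
  by apply/seteqP; split=> w; rewrite /= /subsample map_rcons.
rewrite sample_law ?size_rcons ?sBs//; last first.
  by move=> i; rewrite nth_rcons; case: ifP => // _; case: ifP.
have := polya_weight_rcons alpha_gt0 [::] mB mBl.
rewrite /= addr0 sBs => ->; rewrite big_ord0 addr0; congr (_ + _)%E.
  have -> : T1 @^-1` [set x | seq_box (rcons Bs B) x] =
     [set w | seq_box Bs (sample K w)] `*` B.
    by apply/seteqP; split=> -[w a] h; apply/(seq_box_rcons _ _ (sYK w)).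
  have mBK : measurable [set w | seq_box Bs (sample K w)].
    rewrite (_ : [set w | _] =
        \bigcap_(i in `I_(size Bs)) (X (nth 0%N K i) @^-1` nth setT Bs i)).
      apply: fin_bigcap_measurable => // i _.
      by rewrite -[X in measurable X]setTI; exact: measurable_funPT.
    by apply/seteqP; split=> w wB i iB; have := wB i iB;
      rewrite (nth_map 0%N)// -sBs.
  rewrite product_measure1E// fineK ?fin_num_measure// muleC.
  by rewrite -(@sample_law K Bs).
apply: eq_bigr => k _.
have kB : (k < size Bs)%N by rewrite sBs.
rewrite -(@sample_law K)//; first last.
- by move=> i; rewrite nth_set_nth/=; case: eqP => // _; exact: measurableI.
- by rewrite size_set_nth (maxn_idPr _).
congr (P _); apply/seteqP; split=> w.
  move=> h; have [h1 h2] := (seq_box_set_nth _ _ kB).1 h.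
  apply: (seq_box_rcons _ _ (sYK w)).2.
  by split => //; move: h2; rewrite (nth_map 0%N).
move=> h; have [h1 h2] := (seq_box_rcons _ _ (sYK w)).1 h.
apply: (seq_box_set_nth _ _ kB).2.
by split => //; rewrite (nth_map 0%N).
Qed.

End polya_prediction.

(** * The prediction rule for real integrands *)

Lemma fine_integrable d (T : measurableType d) (R : realType)
    (mu : {measure set T -> \bar R}) (D : set T) (f : T -> \bar R) :
    measurable D -> mu.-integrable D f ->
  mu.-integrable D (fun x => (fine (f x))%:E) /\
  (\int[mu]_(x in D) (fine (f x))%:E = \int[mu]_(x in D) f x)%E.
Proof.
move=> mD iF; have mf := measurable_int _ iF.
have mff : measurable_fun D (fun x => (fine (f x))%:E).
  by apply/measurable_EFinP; apply: measurableT_comp.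
split.
  apply: (le_integrable mD _ _ iF) => // x Dx.
  by case: (f x) => [r| |] //=; rewrite normr0 leey.
apply: ae_eq_integral => //; have := integrable_ae mD iF.
by apply: filterS => x fx Dx; rewrite fineK// fx.
Qed.

Section polya_integrals.
Context (R : realType) d (T : measurableType d).
Variable alpha : {finite_measure set T -> \bar R}.
Hypothesis alpha_gt0 : (0 < alpha [set: T])%E.
Context d' (Omega : measurableType d') (P : probability Omega R).
Variables (X : nat -> {RV P >-> T}) (D : {RV P >-> pprobability T R}).
Hypotheses (X_polya : polya_sequence alpha X) (D_limit : empirical_limit X D).
Local Notation c := (total_mass alpha).
Local Notation sample := (subsample X).
Implicit Types (u v : seq T -> R) (I J K : seq nat).

Lemma integral_sample_law J J' u : uniq J -> uniq J' -> size J = size J' ->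
    measurable_on_tuples u ->
  (\int[P]_w (u (sample J w))%:E = \int[P]_w (u (sample J' w))%:E)%E.
Proof.
move=> uJ uJ' sJ mu; rewrite integralE [RHS]integralE.
have mE : measurable_on_tuples (fun s => (u s)%:E) by move=> k; apply/measurable_EFinP; exact: mu.
pose U s := (u s)%:E.
rewrite -[fun w => (u (sample J w))%:E]/(U \o sample J).
rewrite -[fun w => (u (sample J' w))%:E]/(U \o sample J').
rewrite (funepos_comp U (sample J)) (funepos_comp U (sample J')).
rewrite (funeneg_comp U (sample J)) (funeneg_comp U (sample J')).
congr (_ - _)%E; apply: (integral_sample_perm X_polya D_limit uJ uJ' sJ).
- move=> k; have := measurable_funepos (mE k).
  by rewrite (funepos_comp U (fun x : k.-tuple T => x : seq T)).
- exact: funepos_ge0.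
- move=> k; have := measurable_funeneg (mE k).
  by rewrite (funeneg_comp U (fun x : k.-tuple T => x : seq T)).
- exact: funeneg_ge0.
Qed.

Lemma Rintegral_sample_law J J' u : uniq J -> uniq J' -> size J = size J' ->
    measurable_on_tuples u ->
  \int[P]_w u (sample J w) = \int[P]_w u (sample J' w).
Proof.
by move=> uJ uJ' sJ mu; rewrite /Rintegral (integral_sample_law uJ uJ' sJ mu).
Qed.

Let mabs u : measurable_on_tuples u -> measurable_on_tuples (fun s => (`|u s|)%:E).
Proof.
move=> mu k; apply/measurable_EFinP.
by apply: (@measurableT_comp _ _ _ _ _ _ (fun x : R => `|x|)) => //; exact: mu.
Qed.

Lemma integrable_sample_law J J' u : uniq J -> uniq J' -> size J = size J' ->
    measurable_on_tuples u ->
    P.-integrable setT (fun w => (u (sample J w))%:E) ->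
  P.-integrable setT (fun w => (u (sample J' w))%:E).
Proof.
move=> uJ uJ' sJ mu /integrableP[_ uoo]; apply/integrableP; split.
  by apply/measurable_EFinP; exact: measurable_sample.
move: uoo; under eq_integral do rewrite abse_EFin.
rewrite (integral_sample_perm X_polya D_limit uJ uJ' sJ (mabs mu))//.
Qed.

Lemma measurable_rcons_sample K u : measurable_on_tuples u ->
  measurable_fun setT (fun z : Omega * T => u (rcons (sample K z.1) z.2)).
Proof.
move=> mu.
(* [None] marks the fresh coordinate, so that the extended sample is again a map over a list of
   indices. *)
pose F (o : option nat) (z : Omega * T) := if o is Some i then X i z.1 else z.2.
rewrite (_ : (fun _ => _) =
  (fun z => u [seq F o z | o <- rcons (map Some K) None])); last first.
  by apply/funext => z; rewrite map_rcons -map_comp.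
apply: measurable_seq => // -[i|]; last exact: measurable_snd.
by apply: (@measurableT_comp _ _ _ _ _ _ (X i)) => //; exact: measurable_fst.
Qed.

Lemma measurable_rcons_sample_nth K k u : measurable_on_tuples u ->
  measurable_fun setT (fun w => u (rcons (sample K w) (X k w))).
Proof.
move=> mu; rewrite (_ : (fun _ => _) = (fun w => u (sample (rcons K k) w))).
  exact: measurable_sample.
by apply/funext => w; rewrite /subsample map_rcons.
Qed.

Section prediction.
Variables (K : seq nat) (p : nat) (u : seq T -> R).
Hypotheses (uKp : uniq (rcons K p)) (mu : measurable_on_tuples u)
  (iu : P.-integrable setT (fun w => (u (sample (rcons K p) w))%:E)).

(** The identity for |u| bounds at once every term that the signed identity has to subtract. *)
Let abs_fin : (\int[P \x alpha]_z `|u (rcons (sample K z.1) z.2)|%:E +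
   \sum_(k <- K) \int[P]_w `|u (rcons (sample K w) (X k w))|%:E < +oo)%E.
Proof.
have := polya_prediction_ge0 alpha_gt0 X_polya D_limit uKp (mabs mu).
move=> <- //; move/integrableP : iu => [_].
under eq_integral do rewrite abse_EFin.
move=> ioo; apply: lte_mul_pinfty => //.
by rewrite lee_fin addr_ge0// ltW// total_mass_gt0.
Qed.

Lemma integrable_prediction_prod :
  (P \x alpha)%E.-integrable setT (fun z => (u (rcons (sample K z.1) z.2))%:E).
Proof.
apply/integrableP; split.
  by apply/measurable_EFinP; exact: measurable_rcons_sample.
under eq_integral do rewrite abse_EFin.
apply: le_lt_trans abs_fin; rewrite leeDl// sume_ge0// => k _.
by apply: integral_ge0 => w _; rewrite lee_fin.
Qed.

Lemma integrable_prediction_old k : k \in K ->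
  P.-integrable setT (fun w => (u (rcons (sample K w) (X k w)))%:E).
Proof.
move=> kK; apply/integrableP; split.
  by apply/measurable_EFinP; exact: measurable_rcons_sample_nth.
under eq_integral do rewrite abse_EFin.
apply: le_lt_trans abs_fin; rewrite (big_rem k)//=.
rewrite addeCA leeDl// adde_ge0//.
  by apply: integral_ge0 => z _; rewrite lee_fin.
by apply: sume_ge0 => l _; apply: integral_ge0 => w _; rewrite lee_fin.
Qed.

Lemma integrable_prediction_new :
  P.-integrable setT (fun w => (\int[alpha]_a u (rcons (sample K w) a))%:E).
Proof.
exact: (fine_integrable measurableT (integrable_fubini_F integrable_prediction_prod)).1.
Qed.

End prediction.

Lemma Rintegral_prediction K p u : uniq (rcons K p) -> measurable_on_tuples u ->
    P.-integrable setT (fun w => (u (sample (rcons K p) w))%:E) ->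
  (c + (size K)%:R) * \int[P]_w u (sample (rcons K p) w) =
  \int[P]_w (\int[alpha]_a u (rcons (sample K w) a)) +
  \sum_(k <- K) \int[P]_w u (rcons (sample K w) (X k w)).
Proof.
move=> uKp mu iu.
transitivity (\int[(P \x alpha)%E]_z u (rcons (sample K z.1) z.2) +
  \sum_(k <- K) \int[P]_w u (rcons (sample K w) (X k w))); last first.
  congr (_ + _); have iQ := integrable_prediction_prod uKp mu iu.
  rewrite /Rintegral; congr fine; rewrite -integral12_prod_meas1//.
  by rewrite (fine_integrable measurableT (integrable_fubini_F iQ)).2.
have nonneg v : measurable_on_tuples v -> (forall s, 0 <= v s) ->
    P.-integrable setT (fun w => (v (sample (rcons K p) w))%:E) ->
    (c + (size K)%:R) * \int[P]_w v (sample (rcons K p) w) =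
    \int[(P \x alpha)%E]_z v (rcons (sample K z.1) z.2) +
    \sum_(k <- K) \int[P]_w v (rcons (sample K w) (X k w)).
  move=> mv v0 iv.
  have mE : measurable_on_tuples (fun s => (v s)%:E).
    by move=> k; apply/measurable_EFinP; exact: mv.
  have := polya_prediction_ge0 alpha_gt0 X_polya D_limit uKp mE.
  have iQ := integrable_prediction_prod uKp mv iv.
  rewrite /Rintegral => /(_ _)/(congr1 fine); rewrite fineM//=; last exact: integrable_fin_num.
  move=> ->; last by move=> s; rewrite lee_fin.
  rewrite (eq_big_seq (fun k =>
    (fine (\int[P]_w (v (rcons (sample K w) (X k w)))%:E))%:E)); last first.
    move=> k kK; rewrite fineK//; apply: integrable_fin_num => //.
    exact: (integrable_prediction_old uKp mv iv kK).
  by rewrite sumEFin fineD//; exact: integrable_fin_num.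
pose up s := Num.max (u s) 0; pose un s := Num.max (- u s) 0.
have uE s : u s = up s - un s.
  by rewrite /up /un; case: (lerP (u s) 0) => us0; case: (lerP (- u s) 0) => us1; lra.
have mup : measurable_on_tuples up.
  by move=> k; apply: measurable_maxr => //; exact: mu.
have mun : measurable_on_tuples un.
  by move=> k; apply: measurable_maxr => //; apply: measurableT_comp => //; exact: mu.
have up0 s : 0 <= up s by rewrite le_max lexx orbT.
have un0 s : 0 <= un s by rewrite le_max lexx orbT.
have iup : P.-integrable setT (fun w => (up (sample (rcons K p) w))%:E).
  apply: (le_integrable measurableT _ _ iu).
    by apply/measurable_EFinP; exact: measurable_sample.
  move=> w _ /=; rewrite lee_fin ger0_norm// /up ge_max ler_norm/=.
  exact: normr_ge0.
have iun : P.-integrable setT (fun w => (un (sample (rcons K p) w))%:E).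
  apply: (le_integrable measurableT _ _ iu).
    by apply/measurable_EFinP; exact: measurable_sample.
  move=> w _ /=; rewrite lee_fin ger0_norm// /un ge_max -normrN ler_norm/=.
  exact: normr_ge0.
under eq_Rintegral do rewrite uE.
rewrite RintegralB// mulrBr (nonneg up)// (nonneg un)//.
under [X in _ = X + _]eq_Rintegral do rewrite uE.
rewrite RintegralB//; first last.
- exact: (integrable_prediction_prod uKp mun iun).
- exact: (integrable_prediction_prod uKp mup iup).
rewrite [\sum_(k <- K) \int[P]_w u _](_ : _ =
   \sum_(k <- K) \int[P]_w up (rcons (sample K w) (X k w)) -
   \sum_(k <- K) \int[P]_w un (rcons (sample K w) (X k w))); first by ring.
rewrite -sumrB big_seq [RHS]big_seq; apply: eq_bigr => k kK.
under eq_Rintegral do rewrite uE.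
rewrite RintegralB//.
- exact: (integrable_prediction_old uKp mup iup kK).
- exact: (integrable_prediction_old uKp mun iun kK).
Qed.

End polya_integrals.

(** * Square integrability and the one-step predictive operator *)

Lemma integrable_mul_L2 d (T : measurableType d) (R : realType)
    (mu : {measure set T -> \bar R}) (f g : T -> R) :
    measurable_fun setT f -> measurable_fun setT g ->
    mu.-integrable setT (fun x => (f x ^+ 2)%:E) ->
    mu.-integrable setT (fun x => (g x ^+ 2)%:E) ->
  mu.-integrable setT (fun x => (f x * g x)%:E).
Proof.
move=> mf mg f2 g2; apply: (le_integrable measurableT _ _ (integrableD measurableT f2 g2)).
  by apply/measurable_EFinP; exact: measurable_funM.
move=> x _ /=; rewrite lee_fin normrM [leRHS]ger0_norm ?addr_ge0 ?sqr_ge0//.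
have := sqr_ge0 (`|f x| - `|g x|); rewrite sqrrB !real_normK ?num_real//.
have := mulr_ge0 (normr_ge0 (f x)) (normr_ge0 (g x)).
set a := _ * _; move: (f x ^+ 2) (g x ^+ 2) => b e; rewrite mulr2n; lra.
Qed.

Lemma integrable_L2 d (T : measurableType d) (R : realType)
    (P : {finite_measure set T -> \bar R}) (f : T -> R) : measurable_fun setT f ->
    P.-integrable setT (fun x => (f x ^+ 2)%:E) -> P.-integrable setT (fun x => (f x)%:E).
Proof.
move=> mf f2.
rewrite (_ : (fun x => (f x)%:E) = (fun x => (f x * cst 1 x)%:E)); last first.
  by apply/funext => x; rewrite mulr1.
apply: integrable_mul_L2 => //.
exact: (finite_measure_integrable_cst P (1 ^+ 2)).
Qed.

Lemma integrable_sqrD d (T : measurableType d) (R : realType)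
    (mu : {measure set T -> \bar R}) (f g : T -> R) :
    measurable_fun setT f -> measurable_fun setT g ->
    mu.-integrable setT (fun x => (f x ^+ 2)%:E) ->
    mu.-integrable setT (fun x => (g x ^+ 2)%:E) ->
  mu.-integrable setT (fun x => ((f x + g x) ^+ 2)%:E).
Proof.
move=> mf mg f2 g2.
under eq_fun do rewrite sqrrD !EFinD.
apply: integrableD => //; apply: integrableD => //.
by apply: integrableD => //; exact: integrable_mul_L2.
Qed.

Lemma integrable_sqrZ d (T : measurableType d) (R : realType)
    (mu : {measure set T -> \bar R}) (k : R) (f : T -> R) :
    mu.-integrable setT (fun x => (f x ^+ 2)%:E) ->
  mu.-integrable setT (fun x => ((k * f x) ^+ 2)%:E).
Proof.
move=> f2; under eq_fun do rewrite exprMn EFinM.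
exact: integrableZl.
Qed.

Lemma integrable_sqr_sum d (T : measurableType d) (R : realType) (I : eqType)
    (r : seq I) (mu : {measure set T -> \bar R}) (f : I -> T -> R) :
    (forall i, measurable_fun setT (f i)) ->
    (forall i, i \in r -> mu.-integrable setT (fun x => (f i x ^+ 2)%:E)) ->
  mu.-integrable setT (fun x => ((\sum_(i <- r) f i x) ^+ 2)%:E).
Proof.
move=> mf; elim: r => [|i r IH] f2.
  by under eq_fun do rewrite big_nil expr0n; exact: integrable0.
under eq_fun do rewrite big_cons; apply: integrable_sqrD => //.
- exact: measurable_sum.
- by apply: f2; rewrite mem_head.
- by apply: IH => j jr; apply: f2; rewrite in_cons jr orbT.
Qed.

(** Cauchy-Schwarz against the constant 1, in a form that applies to the section at every point
    rather than almost every one: when mu has positive mass and f^2 has infinite integral, the bound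
    is +oo. *)
Lemma sqr_Rintegral_le d (T : measurableType d) (R : realType)
    (mu : {finite_measure set T -> \bar R}) (f : T -> R) : measurable_fun setT f ->
  (((\int[mu]_x f x) ^+ 2)%:E <=
   (fine (mu setT))%:E * \int[mu]_x (f x ^+ 2)%:E)%E.
Proof.
move=> mf; set S := (\int[mu]_x _)%E; set m := fine (mu setT).
have m0 : 0 <= m by rewrite fine_ge0.
have S0 : (0 <= S)%E by apply: integral_ge0 => x _; rewrite lee_fin sqr_ge0.
have [mz|mz] := eqVneq m 0.
  have muT0 : mu setT = 0%E by rewrite -(fineK (fin_num_measure mu _ measurableT)) -/m mz.
  rewrite mz mul0e /Rintegral.
  have -> : (\int[mu]_x (f x)%:E = 0)%E.
    apply: null_set_integral => //; exact/measurable_EFinP.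
  by rewrite /= expr0n.
have m1 : 0 < m by rewrite lt_neqAle eq_sym mz.
have [Soo|Sfin] := eqVneq S +oo%E; first by rewrite Soo mulry gtr0_sg// mul1e leey.
have Sf : S \is a fin_num by rewrite ge0_fin_numE// ltey.
have f2 : mu.-integrable setT (fun x => (f x ^+ 2)%:E).
  apply/integrableP; split.
    by apply/measurable_EFinP; exact: measurable_funX.
  under eq_integral do rewrite gee0_abs ?lee_fin ?sqr_ge0//.
  by rewrite -/S ltey.
have i1 : mu.-integrable setT (fun=> (1%:E : \bar R)).
  exact: finite_measure_integrable_cst.
have if1 : mu.-integrable setT (fun x => (f x)%:E).
  exact: integrable_L2.
set I := \int[mu]_x f x; pose t := I / m.
(* Expand [0 <= int (f - t)^2] at the minimizing constant [t]. *)
have : 0 <= \int[mu]_x (f x - t) ^+ 2 by apply: Rintegral_ge0 => x _; exact: sqr_ge0.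
have -> : \int[mu]_x (f x - t) ^+ 2 = \int[mu]_x (f x ^+ 2 - (2 * t) * f x + t ^+ 2 * 1).
  by apply: eq_Rintegral => x _; ring.
rewrite RintegralD//; first last.
- exact: (integrableZl measurableT (t ^+ 2) i1).
- exact (integrableB measurableT f2 (integrableZl measurableT (2 * t) if1)).
rewrite RintegralB//; last exact: (integrableZl measurableT (2 * t) if1).
rewrite !RintegralZl// Rintegral_cst// mul1r -/I -/m.
have -> : \int[mu]_x f x ^+ 2 = fine S by [].
rewrite -(fineK Sf) -EFinM lee_fin.
have -> : fine S - 2 * t * I + t ^+ 2 * m = fine S - I ^+ 2 / m.
  by rewrite /t; field.
by rewrite subr_ge0 ler_pdivrMr// mulrC.
Qed.

Section prediction_kernel.
Context (R : realType) d (T : measurableType d).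
Variable alpha : {finite_measure set T -> \bar R}.
Hypothesis alpha_gt0 : (0 < alpha [set: T])%E.
Local Notation c := (total_mass alpha).

(** The explicit version of E[u(X_1, ..., X_(k+1)) | X_1, ..., X_k], defined at every point [s] of
    length k; for measurable [u], the alpha-integral has its default value 0 where the section is
    not integrable. *)
Definition predict (u : seq T -> R) (s : seq T) : R :=
  (\int[alpha]_a u (rcons s a) + \sum_(b <- s) u (rcons s b)) / (c + (size s)%:R).

Definition symmetric_kernel (u : seq T -> R) :=
  forall s t, perm_eq s t -> u s = u t.

Lemma predict_symmetric u : symmetric_kernel u -> symmetric_kernel (predict u).
Proof.
move=> su s t st; have ust a : u (rcons s a) = u (rcons t a).
  by apply: su; rewrite -!cats1 perm_cat2r.
rewrite /predict (perm_size st) (perm_big _ st)/=.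
by under eq_Rintegral do rewrite ust; under eq_bigr do rewrite ust.
Qed.

Lemma measurable_nth_tuple k i : measurable_fun [set: k.-tuple T] (fun x => nth point x i).
Proof.
have [ik|ki] := ltnP i k.
  rewrite (_ : (fun _ => _) = @tnth k T ^~ (Ordinal ik)); first exact: measurable_tnth.
  by apply/funext => x; rewrite (tnth_nth point).
rewrite (_ : (fun _ => _) = cst point); first exact: measurable_cst.
by apply/funext => x; rewrite nth_default// size_tuple.
Qed.

Lemma measurable_on_tuples_map (I : Type) (J : seq I) (pos : I -> nat) (u : seq T -> R) :
  measurable_on_tuples u ->
  measurable_on_tuples (fun s => u [seq nth point s (pos i) | i <- J]).
Proof.
move=> mu k.
apply: (@measurable_seq _ _ _ _ _ _ I J
  (fun i (x : k.-tuple T) => nth point x (pos i)) u) => //.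
by move=> i; exact: measurable_nth_tuple.
Qed.

Lemma measurable_Rintegral_fst d' (S : measurableType d') (f : S * T -> R) :
  measurable_fun setT f -> measurable_fun setT (fun x => \int[alpha]_a f (x, a)).
Proof.
move=> mf; apply: measurableT_comp => //.
rewrite (_ : (fun _ => _) = (fun x => (\int[alpha]_a (EFin \o f)^\+ (x, a) -
    \int[alpha]_a (EFin \o f)^\- (x, a))%E)); last first.
  apply/funext => x; rewrite integralE.
  rewrite -[fun a => (f (x, a))%:E]/((EFin \o f) \o pair x).
  by rewrite (funepos_comp (EFin \o f) (pair x)) (funeneg_comp (EFin \o f) (pair x)).
have mEf : measurable_fun setT (EFin \o f) by exact/measurable_EFinP.
apply: emeasurable_funB.
  apply: (measurable_fun_fubini_tonelli_F (m2 := alpha) (EFin \o f)^\+%E) => //.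
  exact: measurable_funepos.
apply: (measurable_fun_fubini_tonelli_F (m2 := alpha) (EFin \o f)^\-%E) => //.
exact: measurable_funeneg.
Qed.

Lemma measurable_predict u : measurable_on_tuples u -> measurable_on_tuples (predict u).
Proof.
move=> mu k.
rewrite (_ : (fun _ => _) = fun x : k.-tuple T =>
   (\int[alpha]_a u (rcons x a) + \sum_(i < k) u (rcons x (tnth x i))) / (c + k%:R)); last first.
  by apply/funext => x; rewrite /predict big_tuple size_tuple.
apply: measurable_funM => //; apply: measurable_funD.
  apply: (measurable_Rintegral_fst (f := fun z : k.-tuple T * T => u (rcons z.1 z.2))).
  apply: (measurableT_comp (f := fun x : k.+1.-tuple T => u x)
    (g := fun z : k.-tuple T * T => rcons_tuple z.1 z.2)); first exact: mu.
  by apply: measurable_rcons_tuple; [exact: measurable_fst|exact: measurable_snd].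
apply: measurable_sum => i.
apply: (measurableT_comp (f := fun x : k.+1.-tuple T => u x)
    (g := fun x : k.-tuple T => rcons_tuple x (tnth x i))); first exact: mu.
by apply: measurable_rcons_tuple => //; exact: measurable_tnth.
Qed.

End prediction_kernel.

Section predict_moments.
Context (R : realType) d (T : measurableType d).
Variable alpha : {finite_measure set T -> \bar R}.
Hypothesis alpha_gt0 : (0 < alpha [set: T])%E.
Context d' (Omega : measurableType d') (P : probability Omega R).
Variables (X : nat -> {RV P >-> T}) (D : {RV P >-> pprobability T R}).
Hypotheses (X_polya : polya_sequence alpha X) (D_limit : empirical_limit X D).
Local Notation c := (total_mass alpha).
Local Notation sample := (subsample X).
Implicit Types (u v : seq T -> R) (I J K : seq nat).

Definition square_integrable u k :=
  P.-integrable setT (fun w => (u (sample (iota 0 k) w) ^+ 2)%:E).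

Lemma square_integrable_sample u J : measurable_on_tuples u ->
    square_integrable u (size J) -> uniq J ->
  P.-integrable setT (fun w => (u (sample J w) ^+ 2)%:E).
Proof.
move=> mu u2 uJ.
apply: (integrable_sample_law X_polya D_limit (J := iota 0 (size J))
  (u := fun s => u s ^+ 2)) => //.
- exact: iota_uniq.
- by rewrite size_iota.
- by move=> k; apply: measurable_funX; exact: mu.
Qed.

(** The prediction rule for u^2 controls both parts of [predict]: the alpha-integral through
    Cauchy-Schwarz, the repetitions directly. *)
Lemma square_integrable_predict u k : measurable_on_tuples u ->
  square_integrable u k.+1 -> square_integrable (predict alpha u) k.
Proof.
move=> mu u2; rewrite /square_integrable.
set K := iota 0 k.
have uK : uniq K by exact: iota_uniq.
have sK : size K = k by rewrite size_iota.
have uKk : uniq (rcons K k) by rewrite rcons_uniq uK mem_iota ltnn andbF.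
have mu2 : measurable_on_tuples (fun s => u s ^+ 2).
  by move=> l; apply: measurable_funX; exact: mu.
have u2K : P.-integrable setT (fun w => (u (sample (rcons K k) w) ^+ 2)%:E).
  by apply: square_integrable_sample; rewrite ?size_rcons ?sK.
have iQ := integrable_prediction_prod alpha_gt0 X_polya D_limit uKk mu2 u2K.
have iK := integrable_prediction_old alpha_gt0 X_polya D_limit uKk mu2 u2K.
have muE i : measurable_fun setT (fun w => u (rcons (sample K w) (X i w))).
  exact: measurable_rcons_sample_nth.
have muQ := measurable_rcons_sample X K mu.
have mI : measurable_fun setT (fun w => \int[alpha]_a u (rcons (sample K w) a)).
  exact: (measurable_Rintegral_fst alpha muQ).
under eq_fun do rewrite /predict mulrC size_map sK big_map.
apply: integrable_sqrZ; apply: integrable_sqrD => //.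
- exact: measurable_sum.
- have := integrableZl measurableT (fine (alpha setT)) (integrable_fubini_F iQ).
  apply: le_integrable => //; first by apply/measurable_EFinP; exact: measurable_funX.
  move=> w _; rewrite gee0_abs ?lee_fin ?sqr_ge0//.
  rewrite (le_trans _ (lee_abs _))//; apply: sqr_Rintegral_le.
  apply: (@measurableT_comp _ _ _ _ _ _
    (fun z : Omega * T => u (rcons (sample K z.1) z.2)) _ (pair w)) => //.
- by apply: integrable_sqr_sum => // i iK'; exact: iK.
Qed.

End predict_moments.

(** * Prediction of a product of two functions of subsamples *)

Section Rintegral_complements.
Context d (T : measurableType d) (R : realType) (mu : {measure set T -> \bar R}).

(** [fine] sends every infinite value to 0, also the one given to a difference of two infinite
    parts. *)
Lemma Rintegral_nonintegrable (f : T -> R) : measurable_fun setT f ->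
  ~ mu.-integrable setT (EFin \o f) -> \int[mu]_x f x = 0.
Proof.
move=> mf nif; rewrite /Rintegral integralE.
have mEf : measurable_fun setT (EFin \o f) by exact/measurable_EFinP.
have pge0 : (0 <= \int[mu]_x (EFin \o f)^\+ x)%E by exact: integral_ge0.
have nge0 : (0 <= \int[mu]_x (EFin \o f)^\- x)%E by exact: integral_ge0.
case E1 : (\int[mu]_x _)%E pge0 => [p| |] // _;
  case E2 : (\int[mu]_x _)%E nge0 => [q| |] // _.
exfalso; apply: nif; apply/integrableP; split => //.
rewrite -[X in integral _ _ X]/(abse \o (EFin \o f)) fune_abse ge0_integralD//.
- by rewrite E1 E2 -EFinD ltry.
- exact: measurable_funepos.
- exact: measurable_funeneg.
Qed.

(** If f is not integrable and r is nonzero, both sides have the default value 0. A factor can thus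
    leave the alpha-integral at every w, not just almost every w. *)
Lemma Rintegral_mulr (f : T -> R) (r : R) : measurable_fun setT f ->
  \int[mu]_x (f x * r) = (\int[mu]_x f x) * r.
Proof.
move=> mf; have [->|r0] := eqVneq r 0.
  rewrite mulr0; under eq_Rintegral do rewrite mulr0.
  by rewrite /Rintegral integral0.
have [fi|nfi] := pselect (mu.-integrable setT (EFin \o f)); first exact: RintegralZr.
rewrite !Rintegral_nonintegrable ?mul0r//; first exact: measurable_funM.
move=> fri; apply: nfi; have := integrableZl measurableT r^-1 fri.
by apply: eq_integrable => // x _; rewrite /= -EFinM mulrCA mulVf// mulr1.
Qed.

Lemma Rintegral_sum (I : eqType) (r : seq I) (f : I -> T -> R) :
    (forall i, i \in r -> mu.-integrable setT (EFin \o f i)) ->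
  \int[mu]_x (\sum_(i <- r) f i x) = \sum_(i <- r) \int[mu]_x f i x /\
  mu.-integrable setT (fun x => (\sum_(i <- r) f i x)%:E).
Proof.
elim: r => [|i r IH] fi.
  split; last by under eq_fun do rewrite big_nil; exact: integrable0.
  rewrite big_nil; under eq_Rintegral do rewrite big_nil.
  by rewrite /Rintegral integral0.
have [IH1 IH2] := IH (fun j jr => fi j (mem_behead (s := i :: r) jr)).
have fii := fi i (mem_head _ _).
rewrite big_cons -IH1; split.
  by under eq_Rintegral do rewrite big_cons; rewrite RintegralD.
under eq_fun do rewrite big_cons EFinD.
exact: (integrableD measurableT fii IH2).
Qed.

End Rintegral_complements.

Section predict_shift.
Context (R : realType) d (T : measurableType d).
Variable alpha : {finite_measure set T -> \bar R}.
Hypothesis alpha_gt0 : (0 < alpha [set: T])%E.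
Context d' (Omega : measurableType d') (P : probability Omega R).
Variables (X : nat -> {RV P >-> T}) (D : {RV P >-> pprobability T R}).
Hypotheses (X_polya : polya_sequence alpha X) (D_limit : empirical_limit X D).
Local Notation c := (total_mass alpha).
Local Notation sample := (subsample X).
Implicit Types (u v : seq T -> R) (I J K : seq nat).

(** The prediction rule for [K] and p, applied to the product. The new point does not affect v(X_J),
    so the alpha-draw and the repetitions of points of [I] add up to c + #I times [predict u]. *)
Lemma predict_shift u v K p I J :
    measurable_on_tuples u -> measurable_on_tuples v ->
    square_integrable X u (size I).+1 -> square_integrable X v (size J) ->
    uniq (rcons K p) -> uniq I -> uniq J -> {subset I <= K} -> {subset J <= K} ->
  (c + (size K)%:R) * \int[P]_w (u (sample (rcons I p) w) * v (sample J w)) =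
  (c + (size I)%:R) * \int[P]_w (predict alpha u (sample I w) * v (sample J w)) +
  \sum_(k <- K | k \notin I) \int[P]_w (u (sample (rcons I k) w) * v (sample J w)).
Proof.
move=> mu mv u2 v2 uKp uI uJ IK JK.
have [pK uK] : p \notin K /\ uniq K by move: uKp; rewrite rcons_uniq => /andP[].
have pI : p \notin I by apply: contra pK => /IK.
(* [G] reads both factors off a single sequence laid out along [rcons K p]; replacing its last entry
   changes the argument of [u] alone. *)
pose pos i := index i (rcons K p).
pose G s := u [seq nth point s (pos i) | i <- rcons I p] *
            v [seq nth point s (pos i) | i <- J].
have mG : measurable_on_tuples G.
  by move=> k; apply: measurable_funM; exact: measurable_on_tuples_map.
have posK w a i : i \in K -> nth point (rcons (sample K w) a) (pos i) = X i w.
  move=> iK; have iK' : (index i K < size K)%N by rewrite index_mem.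
  have -> : pos i = index i K by rewrite /pos -cats1 index_cat iK.
  by rewrite nth_rcons size_map iK' (nth_map 0%N)// nth_index.
have posp w a : nth point (rcons (sample K w) a) (pos p) = a.
  have -> : pos p = size K by rewrite /pos -cats1 index_cat (negbTE pK) /= eqxx addn0.
  by rewrite nth_rcons size_map ltnn eqxx.
have GE w a : G (rcons (sample K w) a) = u (rcons (sample I w) a) * v (sample J w).
  rewrite /G map_rcons posp; congr (u (rcons _ _) * v _).
    by apply/eq_in_map => i iI; apply: posK; exact: IK.
  by apply/eq_in_map => i iJ; apply: posK; exact: JK.
have sE J' i w : sample (rcons J' i) w = rcons (sample J' w) (X i w).
  by rewrite /subsample map_rcons.
have GpE w : G (sample (rcons K p) w) = u (sample (rcons I p) w) * v (sample J w).
  by rewrite sE GE sE.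
have iG : P.-integrable setT (fun w => (G (sample (rcons K p) w))%:E).
  under eq_fun do rewrite GpE; apply: integrable_mul_L2.
  - exact: measurable_sample.
  - exact: measurable_sample.
  - apply: (square_integrable_sample X_polya D_limit) => //.
      by rewrite size_rcons.
    by rewrite rcons_uniq pI.
  - exact: (square_integrable_sample X_polya D_limit).
have := Rintegral_prediction alpha_gt0 X_polya D_limit uKp mG iG.
have inew := integrable_prediction_new alpha_gt0 X_polya D_limit uKp mG iG.
have iold := integrable_prediction_old alpha_gt0 X_polya D_limit uKp mG iG.
under eq_Rintegral do rewrite GpE.
move=> ->.
have newE w : \int[alpha]_a G (rcons (sample K w) a) =
    (\int[alpha]_a u (rcons (sample I w) a)) * v (sample J w).
  under eq_Rintegral do rewrite GE; rewrite Rintegral_mulr//.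
  exact: (measurableT_comp (measurable_rcons_sample X I mu) (pair1_measurable _)).
have oldE k w : G (rcons (sample K w) (X k w)) =
    u (rcons (sample I w) (X k w)) * v (sample J w) by rewrite GE.
under [X in X + _ = _]eq_Rintegral do rewrite newE.
under [X in _ + X = _]eq_bigr do under eq_Rintegral do rewrite oldE.
have inew' : P.-integrable setT
    (fun w => ((\int[alpha]_a u (rcons (sample I w) a)) * v (sample J w))%:E).
  by move: inew; under eq_fun do rewrite newE.
have iold' k : k \in K -> P.-integrable setT
    (fun w => (u (rcons (sample I w) (X k w)) * v (sample J w))%:E).
  by move=> kK; have := iold k kK; under eq_fun do rewrite oldE.
rewrite (bigID (mem I))/= addrA; congr (_ + _); last first.
  by apply: eq_bigr => k _; apply: eq_Rintegral => w _; rewrite sE.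
rewrite -big_filter (perm_big I)/=; last first.
  apply: uniq_perm => //; first exact: filter_uniq.
  by move=> i; rewrite mem_filter; apply/andP/idP => [[]//|iI]; split => //; exact: IK.
have [sumE isum] := @Rintegral_sum _ _ _ P _ I
  (fun k w => u (rcons (sample I w) (X k w)) * v (sample J w))
  (fun k kI => iold' k (IK k kI)).
rewrite -sumE -RintegralD//.
have cI : c + (size I)%:R != 0.
  by rewrite gt_eqF// ltr_wpDr// total_mass_gt0.
transitivity (\int[P]_w ((c + (size I)%:R) *
    (predict alpha u (sample I w) * v (sample J w)))).
  apply: eq_Rintegral => w _; rewrite /predict size_map big_map.
  by rewrite mulrA [_ * (_ / _)]mulrC divfK// mulrDl mulr_suml.
rewrite RintegralZl//.
apply: (eq_integrable measurableT (fun w =>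
  ((c + (size I)%:R)^-1 * ((\int[alpha]_a u (rcons (sample I w) a)) * v (sample J w) +
   \sum_(k <- I) u (rcons (sample I w) (X k w)) * v (sample J w)))%:E)).
  move=> w _; rewrite /= /predict size_map big_map; congr (_%:E).
  by rewrite -mulr_suml -mulrDl mulrA; congr (_ * _); rewrite mulrC.
exact: (integrableZl measurableT _ (integrableD measurableT inew' isum)).
Qed.

End predict_shift.

(** * Conditional expectations as iterated predictions *)

Section projection_kernels.
Context (R : realType) d (T : measurableType d).
Variable alpha : {finite_measure set T -> \bar R}.
Hypothesis alpha_gt0 : (0 < alpha [set: T])%E.
Context d' (Omega : measurableType d') (P : probability Omega R).
Variables (X : nat -> {RV P >-> T}) (D : {RV P >-> pprobability T R}).
Hypotheses (X_polya : polya_sequence alpha X) (D_limit : empirical_limit X D).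
Local Notation c := (total_mass alpha).
Local Notation sample := (subsample X).

Lemma sample_iota n w : sample (iota 0 n) w = prefix_tuple X n w.
Proof.
apply: (@eq_from_nth _ point); first by rewrite size_map size_iota size_tuple.
move=> i; rewrite size_map size_iota => ni.
rewrite (nth_map 0%N) ?size_iota// nth_iota// add0n.
by rewrite -(tnth_nth point (prefix_tuple X n w) (Ordinal ni)) tnth_mktuple.
Qed.

(** Extension by 0 to sequences of other lengths, so that [predict] can be iterated without a change
    of type. *)
Definition seq_extension n (f : n.-tuple T -> R) (s : seq T) : R :=
  oapp f 0 (insub s).

Lemma seq_extensionE n (f : n.-tuple T -> R) (x : n.-tuple T) :
  seq_extension f x = f x.
Proof. by rewrite /seq_extension valK. Qed.

Lemma measurable_seq_extension n (f : n.-tuple T -> R) :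
  measurable_fun setT f -> measurable_on_tuples (seq_extension f).
Proof.
move=> mf k; have [kn|kn] := eqVneq k n.
  by subst k; under eq_fun do rewrite seq_extensionE.
rewrite (_ : (fun _ => _) = cst 0); first exact: measurable_cst.
by apply/funext => x; rewrite /seq_extension insubF// size_tuple (negbTE kn).
Qed.

Lemma seq_extension_symmetric n (f : n.-tuple T -> R) :
  symmetric_fun f -> symmetric_kernel (seq_extension f).
Proof.
move=> sf s t st; have [sn|sn] := boolP (size s == n); last first.
  by rewrite /seq_extension !insubF// -?(perm_size st); exact/negbTE.
have tn : size t == n by rewrite -(perm_size st).
move: st; rewrite -[s]/(val (Tuple sn)) -[t]/(val (Tuple tn)) => /tuple_permP[p pE].
rewrite !seq_extensionE -(sf p (Tuple tn)); congr f; exact: val_inj.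
Qed.

Variables (n : nat) (f : n.-tuple T -> R).
Hypotheses (f_sym : symmetric_fun f) (f_meas : measurable_fun setT f)
  (f_sqr : P.-integrable setT (fun w => (f (prefix_tuple X n w) ^+ 2)%:E)).

(* [projection s] is E[f(X_1, ..., X_n) | X_1, ..., X_a] at the point [s] of
   length [a], obtained by integrating the missing coordinates one by one
   against the Polya predictive laws. *)
Definition projection (s : seq T) : R :=
  iter (n - size s) (predict alpha) (seq_extension f) s.

Lemma projection_full (x : n.-tuple T) : projection x = f x.
Proof. by rewrite /projection size_tuple subnn/= seq_extensionE. Qed.

Lemma projection_predict s : (size s < n)%N -> projection s = predict alpha projection s.
Proof.
move=> sn; rewrite /projection -(subnSK sn) iterS /predict.
by under [in RHS]eq_Rintegral do rewrite size_rcons;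
  under [in RHS]eq_bigr do rewrite size_rcons.
Qed.

Lemma measurable_projection : measurable_on_tuples projection.
Proof.
move=> k; rewrite /projection; under eq_fun do rewrite size_tuple.
suff H m : measurable_on_tuples (iter m (predict alpha) (seq_extension f)) by exact: H.
elim: m => [|m IH]; first exact: measurable_seq_extension.
exact: measurable_predict.
Qed.

Lemma projection_symmetric : symmetric_kernel projection.
Proof.
move=> s t st; rewrite /projection (perm_size st).
suff H m : symmetric_kernel (iter m (predict alpha) (seq_extension f)) by exact: H.
elim: m => [|m IH]; first exact: seq_extension_symmetric.
exact: predict_symmetric.
Qed.

Lemma square_integrable_projection k : square_integrable X projection k.
Proof.
(* Beyond length n nothing is integrated out, and the extension is 0. *)
have [kn|nk] := leqP k n; last first.
  rewrite /square_integrable (_ : (fun _ => _) = cst 0%E); first exact: integrable0.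
  apply/funext => w; rewrite /projection size_map size_iota (eqP (ltnW nk : n - k == 0)%N)/=.
  by rewrite /seq_extension insubF ?expr0n// size_map size_iota gtn_eqF.
rewrite -(subKn kn).
elim: (n - k)%N (leq_subr k n) => [_|m IH mn].
  rewrite subn0 /square_integrable; under eq_fun do rewrite sample_iota projection_full.
  exact: f_sqr.
have := IH (ltnW mn); rewrite -(subnSK mn).
move/(square_integrable_predict alpha_gt0 X_polya D_limit measurable_projection).
apply: eq_integrable => // w _; rewrite -projection_predict//.
by rewrite size_map size_iota; lia.
Qed.

Lemma square_integrable_sample_projection J : uniq J ->
  P.-integrable setT (fun w => (projection (sample J w) ^+ 2)%:E).
Proof.
move=> uJ; apply: (square_integrable_sample X_polya D_limit) => //.
- exact: measurable_projection.
- exact: square_integrable_projection.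
Qed.

(** The tower property, one coordinate at a time: in [predict_shift] with [I] = [K] no repetition
    term is left and the factor c + b cancels. *)
Lemma projection_tower v a b : measurable_on_tuples v -> square_integrable X v a ->
    (a <= b <= n)%N ->
  \int[P]_w (projection (sample (iota 0 b) w) * v (sample (iota 0 a) w)) =
  \int[P]_w (projection (sample (iota 0 a) w) * v (sample (iota 0 a) w)).
Proof.
move=> mv v2 /andP[]; elim: b => [|b IH].
  by rewrite leqn0 => /eqP ->.
rewrite leq_eqVlt => /orP[/eqP->//|]; rewrite ltnS => ab bn.
rewrite -IH ?(ltnW bn)// -[b.+1]addn1 iotaD add0n cats1.
have c0 : c + b%:R != 0 by rewrite gt_eqF// ltr_wpDr// total_mass_gt0.
have := predict_shift alpha_gt0 X_polya D_limit (u := projection) (v := v)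
  (K := iota 0 b) (p := b) (I := iota 0 b) (J := iota 0 a) measurable_projection mv.
rewrite !size_iota rcons_uniq !iota_uniq mem_iota ltnn andbF.
move=> /(_ (square_integrable_projection b.+1) v2 isT isT isT) H.
have {H} := H (fun _ => id).
rewrite [X in _ = _ + X]big_seq_cond [X in _ = _ + X]big_pred0 ?addr0; last first.
  by move=> k; rewrite andbN.
move=> /(_ _)/(mulfI c0) ->.
  apply: eq_Rintegral => w _; rewrite -projection_predict//.
  by rewrite size_map size_iota.
by move=> k; rewrite !mem_iota/= !add0n => ka; exact: leq_trans ka ab.
Qed.

(** The tower property with a = 0 and v = 1 identifies the value at the empty sequence with the
    mean. *)
Lemma projection_nil : \int[P]_w f (prefix_tuple X n w) = 0 -> projection [::] = 0.
Proof.
move=> f0; have v2 : square_integrable X (fun=> 1 : R) 0.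
  by rewrite /square_integrable; exact: finite_measure_integrable_cst.
have := @projection_tower (fun=> 1) 0 n (fun k => measurable_cst _) v2.
rewrite leqnn => /(_ isT).
under eq_Rintegral do rewrite mulr1 sample_iota projection_full.
rewrite f0; under eq_Rintegral do rewrite mulr1.
have E : \int[P]_w projection [::] = projection [::].
  by rewrite /Rintegral integral_cst//= probability_setT mule1.
by move=> H; rewrite -E H.
Qed.

End projection_kernels.

(** * Any version of a conditional expectation agrees almost surely with [projection] *)

Section projection_uniqueness.
Context (R : realType) d (T : measurableType d).
Variable alpha : {finite_measure set T -> \bar R}.
Hypothesis alpha_gt0 : (0 < alpha [set: T])%E.
Context d' (Omega : measurableType d') (P : probability Omega R).
Variables (X : nat -> {RV P >-> T}) (D : {RV P >-> pprobability T R}).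
Hypotheses (X_polya : polya_sequence alpha X) (D_limit : empirical_limit X D).
Local Notation sample := (subsample X).
Variables (n : nat) (f : n.-tuple T -> R).
Hypotheses (f_meas : measurable_fun setT f)
  (f_sqr : P.-integrable setT (fun w => (f (prefix_tuple X n w) ^+ 2)%:E)).
Local Notation projection := (projection alpha f).

Variables (a : nat) (g : a.-tuple T -> R).
Hypotheses (an : (a <= n)%N)
  (g_cond : is_cond_expectation P (fun w => f (prefix_tuple X n w))
     (prefix_tuple X a) g).

Let ge := seq_extension g.
Let diff s := ge s - projection s.

Let measurable_ge : measurable_on_tuples ge.
Proof. by case: g_cond => mg _ _; exact: measurable_seq_extension. Qed.

Let measurable_proj : measurable_on_tuples projection.
Proof. exact: measurable_projection. Qed.

Let measurable_diff : measurable_on_tuples diff.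
Proof.
by move=> k; apply: measurable_funB; [exact: measurable_ge|exact: measurable_proj].
Qed.

Let Z := sample (iota 0 a).

Let ZE w : Z w = prefix_tuple X a w. Proof. exact: sample_iota. Qed.

Let integrable_ge : P.-integrable setT (fun w => (ge (Z w))%:E).
Proof.
case: g_cond => _ ig _; apply: eq_integrable ig => // w _.
by rewrite ZE /ge seq_extensionE.
Qed.

Let integrable_proj : P.-integrable setT (fun w => (projection (Z w))%:E).
Proof.
apply: integrable_L2; first exact: measurable_sample.
apply: (square_integrable_sample_projection alpha_gt0 X_polya D_limit) => //.
exact: iota_uniq.
Qed.

Let integrable_diff : P.-integrable setT (fun w => (diff (Z w))%:E).
Proof. exact (integrableB measurableT integrable_ge integrable_proj). Qed.

Let measurable_boolR (b : seq T -> bool) :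
  measurable_on_tuples b -> measurable_on_tuples (fun s => (b s)%:R : R).
Proof.
move=> mb k; rewrite (_ : (fun _ => _) = (\1_[set x : k.-tuple T | b x] : k.-tuple T -> R)).
  by apply: measurable_indic; have := mb k measurableT [set true] Logic.I;
     rewrite setTI.
apply/funext => x; rewrite indicE.
by have -> : (x \in [set x : k.-tuple T | b x]) = b x by apply/idP/idP; rewrite inE.
Qed.

Let bool_mul (k : seq T -> R) (b : seq T -> bool) :
    measurable_on_tuples k -> measurable_on_tuples (fun s => (b s)%:R : R) ->
    P.-integrable setT (fun w => (k (Z w))%:E) ->
  P.-integrable setT (fun w => (k (Z w) * (b (Z w))%:R)%:E).
Proof.
move=> mk mb; apply: le_integrable => //.
  apply/measurable_EFinP; apply: measurable_funM.
    exact: (measurable_sample X (iota 0 a) mk).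
  exact: (measurable_sample X (iota 0 a) mb).
move=> w _ /=; rewrite lee_fin normrM.
by case: (b _); rewrite ?normr1 ?mulr1// normr0 mulr0.
Qed.

(** On events of the first a variables both functions integrate like f: [g] by hypothesis,
    [projection] by the tower property with v the indicator. *)
Let test (b : seq T -> bool) : measurable_on_tuples b ->
  \int[P]_w (diff (Z w) * (b (Z w))%:R) = 0.
Proof.
move=> mb.
have mbR := measurable_boolR mb.
have mB : measurable [set x : a.-tuple T | b x].
  by have := mb a measurableT [set true] Logic.I; rewrite setTI.
under eq_Rintegral do rewrite /diff mulrBl.
rewrite RintegralB//; [|exact: bool_mul..].
have b2 : square_integrable X (fun s => (b s)%:R : R) a.
  apply: (le_integrable measurableT _ _ (finite_measure_integrable_cst P 1 measurableT)).
    apply/measurable_EFinP; apply: measurable_funX.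
    exact: (measurable_sample X (iota 0 a) mbR).
  by move=> w _ /=; rewrite lee_fin; case: (b _); rewrite ?expr1n ?expr0n ?normr1 ?normr0.
have ann : (a <= n <= n)%N by rewrite an leqnn.
rewrite -[X in _ - X](projection_tower alpha_gt0 X_polya D_limit f_meas f_sqr mbR b2 ann).
apply/eqP; rewrite subr_eq0; apply/eqP.
have [_ _ /(_ _ mB) H] := g_cond.
transitivity (\int[P]_(w in prefix_tuple X a @^-1` [set x | b x]) g (prefix_tuple X a w)).
  rewrite [RHS]Rintegral_mkcond; apply: eq_Rintegral => w _.
  rewrite patchE ZE /ge seq_extensionE; case: ifPn; rewrite ?inE/= => bZ.
    by rewrite bZ mulr1.
  have /negbTE -> : ~~ b (prefix_tuple X a w).
    by apply/negP => bw; move: bZ; rewrite notin_setE; apply.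
  by rewrite mulr0.
rewrite /Rintegral H -[LHS]/(Rintegral P (prefix_tuple X a @^-1` [set x | b x])
   (fun w => f (prefix_tuple X n w))) Rintegral_mkcond.
apply: eq_Rintegral => w _.
rewrite patchE -/Z ZE sample_iota projection_full; case: ifPn; rewrite ?inE/= => bZ.
  by rewrite bZ mulr1.
have /negbTE -> : ~~ b (prefix_tuple X a w).
    by apply/negP => bw; move: bZ; rewrite notin_setE; apply.
  by rewrite mulr0.
Qed.

(** Testing on the events where the difference is positive or negative gives mean absolute
    difference 0 at the prefix. Exchangeability carries this to any a distinct indices, which is
    where the kernels evaluate [g]. *)
Lemma projection_unique J : uniq J -> size J = a ->
  {ae P, forall w, seq_extension g (sample J w) = projection (sample J w)}.
Proof.
move=> uJ sJ.
have mabs : measurable_on_tuples (fun s => `|diff s|).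
  by move=> k; apply: (@measurableT_comp _ _ _ _ _ _ (fun x : R => `|x|)) => //;
     exact: measurable_diff.
have mpos : measurable_on_tuples (fun s => 0 < diff s).
  by move=> k; apply: measurable_fun_ltr => //; exact: measurable_diff.
have mneg : measurable_on_tuples (fun s => diff s < 0).
  by move=> k; apply: measurable_fun_ltr => //; exact: measurable_diff.
have iabs : P.-integrable setT (fun w => `|diff (Z w)|%:E).
  by have := integrable_abse integrable_diff; apply: eq_integrable.
have abs0 : \int[P]_w `|diff (Z w)| = 0.
  transitivity (\int[P]_w (diff (Z w) * (0 < diff (Z w))%R%:R -
      diff (Z w) * (diff (Z w) < 0)%R%:R)).
    apply: eq_Rintegral => w _; case: (ltrgt0P (diff (Z w))) => //.
    - by move=> _; rewrite mulr1 mulr0 subr0.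
    - by move=> _; rewrite mulr1 mulr0 sub0r.
    - by move=> ->; rewrite !mul0r subrr.
  rewrite RintegralB//.
  - by rewrite (test mpos) (test mneg) subrr.
  - exact: (bool_mul measurable_diff (measurable_boolR mpos)).
  - exact: (bool_mul measurable_diff (measurable_boolR mneg)).
have absJ0 : (\int[P]_w `|(diff (sample J w))%:E| = 0)%E.
  transitivity (\int[P]_w (`|diff (sample J w)|)%:E)%E; first by [].
  rewrite (integral_sample_law X_polya D_limit (J' := iota 0 a) uJ _ _ mabs)
    ?iota_uniq ?size_iota//.
  by rewrite -(fineK (integrable_fin_num measurableT iabs)); congr (_%:E); exact: abs0.
have mdJ : measurable_fun setT (fun w => (diff (sample J w))%:E).
  by apply/measurable_EFinP; exact: measurable_sample.
have := (ae_eq_integral_abs P measurableT mdJ).1 absJ0.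
apply: filterS => w /= /(_ Logic.I) [] /eqP; rewrite subr_eq0 => /eqP.
exact.
Qed.


End projection_uniqueness.

(** * Covariances of Hoeffding kernels over two blocks of the sequence *)

Lemma Rintegral_bilinear d (T : measurableType d) (R : realType)
    (mu : {measure set T -> \bar R}) (I : eqType) (r1 r2 : seq I) (a b : I -> R)
    (U W : I -> T -> R) :
    (forall i j, mu.-integrable setT (fun x => (U i x * W j x)%:E)) ->
  \int[mu]_x ((\sum_(i <- r1) a i * U i x) * (\sum_(j <- r2) b j * W j x)) =
  \sum_(i <- r1) a i * \sum_(j <- r2) b j * \int[mu]_x (U i x * W j x).
Proof.
move=> iUW.
have ib i j : mu.-integrable setT (fun x => (b j * (U i x * W j x))%:E).
  exact: (integrableZl measurableT (b j) (iUW i j)).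
have sj i := @Rintegral_sum _ _ _ mu _ r2 (fun j x => b j * (U i x * W j x))
  (fun j _ => ib i j).
have si := @Rintegral_sum _ _ _ mu _ r1
  (fun i x => a i * \sum_(j <- r2) b j * (U i x * W j x))
  (fun i _ => integrableZl measurableT (a i) (sj i).2).
transitivity (\int[mu]_x \sum_(i <- r1) a i * \sum_(j <- r2) b j * (U i x * W j x)).
  apply: eq_Rintegral => x _; rewrite mulr_suml; apply: eq_bigr => i _.
  rewrite -mulrA; congr (_ * _); rewrite mulr_sumr; apply: eq_bigr => j _.
  by rewrite mulrCA.
rewrite si.1; apply: eq_bigr => i _; rewrite RintegralZl//; last exact: (sj i).2.
rewrite (sj i).1; congr (_ * _); apply: eq_bigr => j _.
by rewrite RintegralZl//; exact: iUW.
Qed.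

Section polya_covariance.
Context (R : realType) d (T : measurableType d).
Variable alpha : {finite_measure set T -> \bar R}.
Hypothesis alpha_gt0 : (0 < alpha [set: T])%E.
Context d' (Omega : measurableType d') (P : probability Omega R).
Variables (X : nat -> {RV P >-> T}) (D : {RV P >-> pprobability T R}).
Hypotheses (X_polya : polya_sequence alpha X) (D_limit : empirical_limit X D).
Local Notation c := (total_mass alpha).
Local Notation sample := (subsample X).
Variables (n : nat) (f h : n.-tuple T -> R).
Hypotheses (f_sym : symmetric_fun f) (h_sym : symmetric_fun h)
  (f_meas : measurable_fun setT f) (h_meas : measurable_fun setT h)
  (f_sqr : P.-integrable setT (fun w => (f (prefix_tuple X n w) ^+ 2)%:E))
  (h_sqr : P.-integrable setT (fun w => (h (prefix_tuple X n w) ^+ 2)%:E))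
  (f_centered : \int[P]_w f (prefix_tuple X n w) = 0)
  (h_centered : \int[P]_w h (prefix_tuple X n w) = 0).
Variable theta : nat -> nat -> R.
Hypothesis thetaP : is_theta c n theta.
Local Notation ts := (theta_star n theta).
Local Notation pf := (projection alpha f).
Local Notation ph := (projection alpha h).

Let V := 'I_(n + n).
Implicit Types I J K S : {set V}.

Let idx I : seq nat := [seq val i | i <- enum I].

Let idx_uniq I : uniq (idx I).
Proof. by rewrite map_inj_uniq ?enum_uniq//; exact: val_inj. Qed.

Let size_idx I : size (idx I) = #|I|. Proof. by rewrite size_map -cardE. Qed.

Let mem_idx I (i : V) : (val i \in idx I) = (i \in I).
Proof. by rewrite mem_map ?mem_enum//; exact: val_inj. Qed.

Let perm_idxU1 (p : V) I : p \notin I -> perm_eq (rcons (idx I) p) (idx (p |: I)).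
Proof.
move=> pI; rewrite perm_rcons -[_ :: _]/[seq val i | i <- p :: enum I].
apply: perm_map; apply: uniq_perm; rewrite ?enum_uniq//=.
  by rewrite mem_enum pI enum_uniq.
by move=> i; rewrite mem_enum in_setU1 in_cons mem_enum.
Qed.

Section moments.
Variables (m : nat) (u : m.-tuple T -> R) (v : seq T -> R).
Hypotheses (u_sym : symmetric_fun u) (u_meas : measurable_fun setT u)
  (u_sqr : P.-integrable setT (fun w => (u (prefix_tuple X m w) ^+ 2)%:E))
  (v_meas : measurable_on_tuples v) (v_sqr : forall k, square_integrable X v k).

Let pu := projection alpha u.

(** [predict_shift] for sets of indices, whose order is immaterial by symmetry. Here [v] is
    arbitrary, so the lemma serves h against f and f against h. *)
Lemma projection_shift (p : V) K I J : p \notin K -> I \subset K -> J \subset K ->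
    (#|I| < m)%N ->
  (c + #|K|%:R) * \int[P]_w (pu (sample (idx (p |: I)) w) * v (sample (idx J) w)) =
  (c + #|I|%:R) * \int[P]_w (pu (sample (idx I) w) * v (sample (idx J) w)) +
  \sum_(k in K :\: I) \int[P]_w (pu (sample (idx (k |: I)) w) * v (sample (idx J) w)).
Proof.
move=> pK IK JK Im.
have psym := projection_symmetric alpha u_sym.
have idxU1 (k : V) w : k \notin I ->
    pu (sample (idx (k |: I)) w) = pu (sample (rcons (idx I) k) w).
  by move=> kI; apply: psym; rewrite perm_sym; apply: perm_map; exact: perm_idxU1.
have pI : p \notin I by apply: contra pK; exact/fintype.subsetP.
under eq_Rintegral do rewrite idxU1//.
rewrite -!size_idx (predict_shift alpha_gt0 X_polya D_limit).
- congr (_ * _ + _).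
    apply: eq_Rintegral => w _; rewrite /pu -projection_predict//.
    by rewrite size_map size_idx.
  rewrite big_map big_enum_cond/=; apply: eq_big => [k|k /andP[_ kI]].
    by rewrite finset.in_setD mem_idx andbC.
  by apply: eq_Rintegral => w _; rewrite idxU1// -mem_idx.
- exact: measurable_projection.
- exact: v_meas.
- exact: (square_integrable_projection alpha_gt0 X_polya D_limit).
- exact: v_sqr.
- by rewrite rcons_uniq mem_idx pK idx_uniq.
- exact: idx_uniq.
- exact: idx_uniq.
- by move=> _ /mapP[i iI ->]; rewrite mem_idx; move: iI; rewrite mem_enum; exact/fintype.subsetP.
- by move=> _ /mapP[i iI ->]; rewrite mem_idx; move: iI; rewrite mem_enum; exact/fintype.subsetP.
Qed.

End moments.

Let B I J := \int[P]_w (ph (sample (idx I) w) * pf (sample (idx J) w)).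

Let square_integrable_pf I : P.-integrable setT (fun w => (pf (sample (idx I) w) ^+ 2)%:E).
Proof. exact: (square_integrable_sample_projection alpha_gt0 X_polya D_limit). Qed.

Let square_integrable_ph I : P.-integrable setT (fun w => (ph (sample (idx I) w) ^+ 2)%:E).
Proof. exact: (square_integrable_sample_projection alpha_gt0 X_polya D_limit). Qed.

Let mf : measurable_on_tuples pf. Proof. exact: measurable_projection. Qed.
Let mh : measurable_on_tuples ph. Proof. exact: measurable_projection. Qed.

Let integrable_prod I J :
  P.-integrable setT (fun w => (ph (sample (idx I) w) * pf (sample (idx J) w))%:E).
Proof.
apply: integrable_mul_L2 => //.
- exact: (measurable_sample X (idx I) mh).
- exact: (measurable_sample X (idx J) mf).
Qed.

Let hoeffding_sum2_integral S :
  hoeffding_sum2 ts B S S =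
  \int[P]_w (hoeffding_sum ts (fun I => ph (sample (idx I) w)) S *
             hoeffding_sum ts (fun I => pf (sample (idx I) w)) S).
Proof.
pose r := [seq A : {set V} <- index_enum {set V} | A \subset S].
transitivity (\int[P]_w ((\sum_(I <- r) ts #|S| #|I| * ph (sample (idx I) w)) *
   (\sum_(I <- r) ts #|S| #|I| * pf (sample (idx I) w)))); last first.
  by apply: eq_Rintegral => w _; rewrite /hoeffding_sum !big_filter.
rewrite Rintegral_bilinear// /hoeffding_sum2 /hoeffding_sum big_filter.
by apply: eq_bigr => I _; rewrite big_filter.
Qed.

Let E s := \int[P]_w (
   hoeffding_kernel n theta (fun a (x : a.-tuple T) => ph x) (prefix_tuple X s w) *
   hoeffding_kernel n theta (fun a (x : a.-tuple T) => pf x) (prefix_tuple X s w)).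

Let ph0 : ph [::] = 0.
Proof. exact: (projection_nil alpha_gt0 X_polya D_limit h_meas h_sqr). Qed.

Let pf0 : pf [::] = 0.
Proof. exact: (projection_nil alpha_gt0 X_polya D_limit f_meas f_sqr). Qed.

Let hoeffding_seq_meas s (k : seq T -> R) : measurable_on_tuples k ->
  measurable_on_tuples (hoeffding_seq ts k s).
Proof.
move=> mk l; apply: measurable_sum => I; apply: measurable_funM => //.
exact: (measurable_on_tuples_map (enum I) (fun i : 'I_s => val i) mk).
Qed.

(** By exchangeability the diagonal terms depend on #|S| only: the sample along S may be replaced by
    the prefix of the same length, where the sum over subsets is [hoeffding_kernel]. *)
Let hoeffding_sum2_diag S : hoeffding_sum2 ts B S S = E #|S|.
Proof.
rewrite hoeffding_sum2_integral.
set s := #|S|; pose e : 'I_s -> V := enum_val.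
have einj : injective e by exact: enum_val_inj.
have SE : S = e @: [set: 'I_s]%SET.
  apply/setP => i; apply/idP/imsetP => [iS|[j _ ->]]; last exact: enum_valP.
  by exists (enum_rank_in iS i) => //; apply/esym; exact: enum_rankK_in.
pose J := [seq val (e i) | i <- enum 'I_s].
have uJ : uniq J.
  by rewrite map_inj_uniq ?enum_uniq// => i j /val_inj /einj.
have sJ : size J = s by rewrite size_map size_enum_ord.
have sumE (k : seq T -> R) w : symmetric_kernel k ->
    hoeffding_sum ts (fun I => k (sample (idx I) w)) S =
    hoeffding_seq ts k s (sample J w).
  move=> ks; rewrite {1}SE /subsample -map_comp.
  rewrite -(hoeffding_sumE ts (fun i : V => X (val i) w) einj ks).
  by apply: eq_bigr => I _; rewrite /idx -map_comp.
transitivity (\int[P]_w (hoeffding_seq ts ph s (sample J w) * hoeffding_seq ts pf s (sample J w))).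
  by apply: eq_Rintegral => w _; rewrite !sumE//; exact: projection_symmetric.
have mhs := hoeffding_seq_meas s mh; have mfs := hoeffding_seq_meas s mf.
rewrite (Rintegral_sample_law X_polya D_limit (J' := iota 0 s)
  (u := fun t => hoeffding_seq ts ph s t * hoeffding_seq ts pf s t)) ?iota_uniq ?size_iota//.
  apply: eq_Rintegral => w _; rewrite sample_iota.
  by rewrite (hoeffding_kernelE n theta _ ph0) (hoeffding_kernelE n theta _ pf0).
by move=> k; apply: measurable_funM; [exact: mhs|exact: mfs].
Qed.

Lemma polya_hoeffding_covariance :
  \int[P]_w (h (prefix_tuple X n w) * pf (sample (iota n n) w)) =
  \sum_(1 <= s < n.+1) ('C(n, s)%:R ^+ 2 *
      \prod_(1 <= l < s.+1) ((s%:R - l%:R + 1) / (c + s%:R + l%:R - 1))) * E s.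
Proof.
pose W1 : {set V} := [set i : V | (i < n)%N]%SET.
pose W2 : {set V} := [set i : V | (n <= i)%N]%SET.
have pW1 : perm_eq (idx W1) (iota 0 n).
  apply: uniq_perm => //; first exact: iota_uniq.
  move=> i; rewrite mem_iota add0n/=; apply/idP/idP => [|ni].
    by move=> /mapP[j]; rewrite mem_enum inE => jn ->.
  have inn : (i < n + n)%N by rewrite ltn_addr.
  by rewrite -[i]/(val (Ordinal inn)) mem_idx inE.
have pW2 : perm_eq (idx W2) (iota n n).
  apply: uniq_perm => //; first exact: iota_uniq.
  move=> i; rewrite mem_iota; apply/idP/andP => [|[ni inn]].
    by move=> /mapP[j]; rewrite mem_enum inE => jn ->; split => //; exact: ltn_ord.
  by rewrite -[i]/(val (Ordinal inn)) mem_idx inE.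
have cW1 : #|W1| = n by rewrite -size_idx (perm_size pW1) size_iota.
have cW2 : #|W2| = n by rewrite -size_idx (perm_size pW2) size_iota.
have W12 : [disjoint W1 & W2]%B.
  by rewrite finset.disjoints_subset; apply/fintype.subsetP => i; rewrite !inE -ltnNge.
have c0 : 0 < c := total_mass_gt0 alpha_gt0.
have symf := projection_symmetric alpha f_sym.
have symh := projection_symmetric alpha h_sym.
rewrite -(hoeffding_covariance c0 (theta_star_rec c0 thetaP) (theta_star_sum thetaP)
  (B := B) (E := E) (W1 := W1) (W2 := W2))//.
- apply: eq_Rintegral => w _; congr (_ * _); last first.
    by apply: symf; rewrite perm_sym; exact: perm_map.
  rewrite -(projection_full alpha h) -sample_iota.
  by apply: symh; rewrite perm_sym; exact: perm_map.
- move=> J; rewrite /B; under eq_Rintegral do rewrite /idx enum_set0/= ph0 mul0r.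
  by rewrite /Rintegral integral0.
- move=> J; rewrite /B; under eq_Rintegral do rewrite /(idx finset.set0) enum_set0/= pf0 mulr0.
  by rewrite /Rintegral integral0.
- move=> p K I J pK IK JK In; apply: projection_shift => //.
  by move=> k; exact: (square_integrable_projection alpha_gt0 X_polya D_limit).
(* The rule in the second variable is the same lemma with the two factors exchanged. *)
- move=> p K I J pK IK JK Jn; rewrite /B.
  under eq_Rintegral do rewrite mulrC.
  under [in RHS]eq_Rintegral do rewrite mulrC.
  under [X in _ = _ + X]eq_bigr do under eq_Rintegral do rewrite mulrC.
  apply: projection_shift => //.
  by move=> k; exact: (square_integrable_projection alpha_gt0 X_polya D_limit).
Qed.

End polya_covariance.

(** * Random product measures: X is conditionally i.i.d. given D *)

Section product_boxes.
Context d (T : measurableType d) (R : realType).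

Lemma prod_prob_box n (mu : 'I_n -> probability T R) (B : 'I_n -> set T) :
    (forall i, measurable (B i)) ->
  prod_prob mu (box B) = (\prod_(i < n) fine (mu i (B i)))%:E.
Proof.
elim: n mu B => [|n IH] mu B mB.
  rewrite big_ord0/= /dirac indicE mem_set// => i.
  by case: i.
rewrite big_ord_recl/= /distribution /pushforward.
have -> : @cons_pair d T n @^-1` box B =
    B ord0 `*` box (fun i => B (lift ord0 i)).
  apply/seteqP; split=> -[a x].
    by move=> h; split=> [|i]; [have := h ord0|have := h (lift ord0 i); rewrite tnthS].
  case=> /= Ba Bx i; case: (unliftP ord0 i) => [j ->|->] //.
  by rewrite tnthS; exact: Bx.
rewrite product_measure1E//; last exact: measurable_box.
rewrite EFinM; congr (_ * _)%E; first by rewrite fineK// fin_num_measure.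
exact: IH.
Qed.

Lemma measurable_cat_tuple m n :
  measurable_fun [set: m.-tuple T * n.-tuple T] (fun z => cat_tuple z.1 z.2).
Proof.
apply/measurable_fun_tnthP => i; case: (split_ordP i) => j ->.
  rewrite (_ : _ \o _ = @tnth m T ^~ j \o fst); last first.
    by apply/funext => z; rewrite /= tnth_lshift.
  by apply: measurableT_comp => //; exact: measurable_tnth.
rewrite (_ : _ \o _ = @tnth n T ^~ j \o snd); last first.
  by apply/funext => z; rewrite /= tnth_rshift.
by apply: measurableT_comp => //; exact: measurable_tnth.
Qed.

(** Because the [m w] are probabilities, the sets with measurable evaluation form a Dynkin system,
    and boxes are stable under intersection. *)
Lemma measurable_box_family d' (S : measurableType d') k
    (m : S -> probability (k.-tuple T) R) :
    (forall B : 'I_k -> set T, (forall i, measurable (B i)) ->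
      measurable_fun setT (fun w => m w (box B))) ->
  forall C, measurable C -> measurable_fun setT (fun w => m w C).
Proof.
move=> mbox C mC.
apply: (dynkin_induction (@measurable_boxes _ T k) (@boxes_setI _ T k)
  (P := fun C => measurable_fun setT (fun w => m w C))).
- by under eq_fun do rewrite probability_setT; exact: measurable_cst.
- by move=> _ [B mB <-]; exact: mbox.
- move=> A mA mmA; under eq_fun do rewrite probability_setC//.
  exact: emeasurable_funB.
- move=> F mF tF mmF.
  apply: (eq_measurable_fun (fun w => \sum_(0 <= i <oo) m w (F i))%E).
    by move=> w _; rewrite measure_semi_bigcup//; exact: bigcup_measurable.
  exact: ge0_emeasurable_sum.
- by rewrite -measurable_boxes.
Qed.


End product_boxes.

Section random_product.
Context (R : realType) d (T : measurableType d).
Variable alpha : {finite_measure set T -> \bar R}.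
Context d' (Omega : measurableType d') (P : probability Omega R).
Variables (X : nat -> {RV P >-> T}) (D : {RV P >-> pprobability T R}).
Hypotheses (X_polya : polya_sequence alpha X) (D_limit : empirical_limit X D).
Local Notation sample := (subsample X).

Let Dn k (w : Omega) : giry (k.-tuple T) R := prod_prob (fun _ : 'I_k => D w).

Let measurable_Dn k : measurable_fun [set: Omega] (Dn k).
Proof.
apply: measurable_giry_codensity => // C mC.
apply: (measurable_box_family (m := fun w => prod_prob (fun _ : 'I_k => D w))) => // B mB.
under eq_fun do rewrite prod_prob_box//.
apply/measurable_EFinP; apply: measurable_prod => i _.
exact: measurable_random_probability.
Qed.

Lemma measurable_ge0_integral_prod k (G : k.-tuple T -> \bar R) :
    measurable_fun setT G -> (forall z, 0 <= G z)%E ->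
  measurable_fun [set: Omega] (fun w => \int[prod_prob (fun _ : 'I_k => D w)]_x G x)%E.
Proof.
move=> mG G0.
rewrite -[X in measurable_fun _ X]/((giry_int ^~ G) \o Dn k).
by apply: measurableT_comp; [exact: measurable_giry_int|exact: measurable_Dn].
Qed.

Section two_samples.
Variables m n : nat.

(** Given w, the law of a sample of size m followed by an independent one of size n, both drawn from
    [D w]. *)
Let nu (w : Omega) : giry ((m + n).-tuple T) R :=
  giry_map (@measurable_cat_tuple _ T m n) (giry_prod (Dn m w, Dn n w)).

Let measurable_nu : measurable_fun [set: Omega] nu.
Proof.
apply: (@measurableT_comp _ _ _ _ _ _ (giry_map (@measurable_cat_tuple _ T m n))).
  exact: measurable_giry_map.
apply: (@measurableT_comp _ _ _ _ _ _ giry_prod); first exact: measurable_giry_prod.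
by apply: measurable_fun_pair; exact: measurable_Dn.
Qed.

Let nu_box w (B : 'I_(m + n) -> set T) : (forall i, measurable (B i)) ->
  nu w (box B) = (\prod_(i < m + n) fine (D w (B i)))%:E.
Proof.
move=> mB; rewrite big_split_ord/=.
have -> : nu w (box B) = giry_prod (Dn m w, Dn n w)
   (box (fun i => B (lshift n i)) `*` box (fun i => B (rshift m i))).
  rewrite /nu /giry_map /= /pushforward; congr (_ _).
  apply/seteqP; split=> -[x y].
    move=> h; split=> i; first by have := h (lshift n i); rewrite tnth_lshift.
    by have := h (rshift m i); rewrite tnth_rshift.
  case=> /= hx hy i; case: (split_ordP i) => j ->.
    by rewrite tnth_lshift; exact: hx.
  by rewrite tnth_rshift; exact: hy.
rewrite /giry_prod/= product_measure1E//; try exact: measurable_box.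
by rewrite EFinM; congr (_ * _)%E; exact: prod_prob_box.
Qed.

(** The mixture of the laws [nu w] over P and the law of the first m + n variables agree on boxes by
    [polya_injective]. This is conditional independence given D, in integrated form. *)
Lemma ge0_integral_random_product (G : (m + n).-tuple T -> \bar R) :
    measurable_fun setT G -> (forall z, 0 <= G z)%E ->
  (\int[P]_w \int[prod_prob (fun _ : 'I_m => D w)]_x
     \int[prod_prob (fun _ : 'I_n => D w)]_y G (cat_tuple x y) =
   \int[P]_w G (prefix_tuple X (m + n) w))%E.
Proof.
move=> mG G0.
pose Q := giry_bind (P : giry Omega R) measurable_nu.
have QE : (\int[Q]_z G z = \int[P]_w \int[prod_prob (fun _ : 'I_m => D w)]_x
     \int[prod_prob (fun _ : 'I_n => D w)]_y G (cat_tuple x y))%E.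
  have := giry_int_bind (P : giry Omega R) measurable_nu mG G0.
  rewrite /giry_int => ->; apply: eq_integral => w _.
  have := giry_int_map (@measurable_cat_tuple _ T m n) (giry_prod (Dn m w, Dn n w)) mG G0.
  rewrite /giry_int => ->.
  rewrite -[LHS]/(giry_int (giry_prod (Dn m w, Dn n w)) (G \o (fun z => cat_tuple z.1 z.2))).
  rewrite giry_int_prod1//; last by move=> z; exact: G0.
  by apply: measurableT_comp => //; exact: measurable_cat_tuple.
rewrite -QE.
have mpre : measurable_fun setT (prefix_tuple X (m + n)).
  apply/measurable_fun_tnthP => i; rewrite (_ : _ \o _ = X i)//.
  by apply/funext => w; rewrite /= tnth_mktuple.
transitivity (\int[image_measure mpre P]_z G z)%E; last by rewrite ge0_integral_image.
apply/esym; apply: integral_boxes.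
  change (P (prefix_tuple X (m + n) @^-1` setT) < +oo)%E.
  by rewrite preimage_setT probability_setT ltry.
move=> B mB; transitivity (P [set w | forall i, B i (X i w)]).
  change (P (prefix_tuple X (m + n) @^-1` box B) = P [set w | forall i, B i (X i w)]).
  congr (P _); apply/seteqP; split=> w h i; first by have := h i; rewrite tnth_mktuple.
  by rewrite tnth_mktuple.
rewrite (polya_injective X_polya D_limit)//; last exact: val_inj.
rewrite /Q /giry_bind /=.
have := giry_int_map measurable_nu (P : giry Omega R)
  (measurable_giry_ev (measurable_box mB)) (fun mu => measure_ge0 mu _).
rewrite /giry_int => ->; apply: eq_integral => w _.
by rewrite -nu_box.
Qed.

End two_samples.
End random_product.

(** On [0, +oo] a product is infinite only if a factor is, and [fine] sends +oo to 0, so both sides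
    are then 0. *)
Lemma fine_ge0M (R : realDomainType) (x y : \bar R) : (0 <= x)%E -> (0 <= y)%E ->
  fine (x * y)%E = fine x * fine y.
Proof.
case: x => [a| |] //; case: y => [b| |] //; rewrite ?lee_fin.
- by rewrite le0r => /predU1P[->|a0] _; rewrite ?mul0e ?mul0r// gt0_muley ?lte_fin//= mulr0.
- by move=> _; rewrite le0r => /predU1P[->|b0]; rewrite ?mule0 ?mulr0// gt0_mulye ?lte_fin//= mul0r.
- by move=> _ _; rewrite mulyy/= mul0r.
Qed.

(** * Moments of the random integrals, for signed functions *)

Section random_product_moments.
Context (R : realType) d (T : measurableType d).
Variable alpha : {finite_measure set T -> \bar R}.
Context d' (Omega : measurableType d') (P : probability Omega R).
Variables (X : nat -> {RV P >-> T}) (D : {RV P >-> pprobability T R}).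
Hypotheses (X_polya : polya_sequence alpha X) (D_limit : empirical_limit X D).
Local Notation sample := (subsample X).
Variable n : nat.
Implicit Types k : n.-tuple T -> R.
Local Notation Dn w := (prod_prob (fun _ : 'I_n => D w)).

Let I k w := \int[Dn w]_x k x.
Let Y k w := k (prefix_tuple X n w).
Let Y' k w := seq_extension k (sample (iota n n) w).

Let measurable_Y k : measurable_fun setT k -> measurable_fun setT (Y k).
Proof.
move=> mk; apply: (measurableT_comp mk); apply/measurable_fun_tnthP => i.
rewrite (_ : _ \o _ = X i)//.
by apply/funext => w; rewrite /= tnth_mktuple.
Qed.

Let measurable_Y' k : measurable_fun setT k -> measurable_fun setT (Y' k).
Proof. by move=> mk; apply: measurable_sample; exact: measurable_seq_extension. Qed.

(** On a sample of size 2n drawn from D, [k1] reads the first n entries and [k2] the last n, so the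
    product of the two integrals becomes an expectation over disjoint blocks of X. *)
Let ge0_moment k1 k2 : measurable_fun setT k1 -> measurable_fun setT k2 ->
    (forall x, 0 <= k1 x) -> (forall x, 0 <= k2 x) ->
  (\int[P]_w ((\int[Dn w]_x (k1 x)%:E) * (\int[Dn w]_x (k2 x)%:E)) =
   \int[P]_w (Y k1 w * Y' k2 w)%:E)%E.
Proof.
move=> mk1 mk2 k10 k20.
have ext0 k s : (forall x, 0 <= k x) -> 0 <= seq_extension k s.
  by move=> k0; rewrite /seq_extension; case: insub => /=.
pose G (z : (n + n).-tuple T) :=
  (seq_extension k1 [seq nth point z i | i <- iota 0 n] *
   seq_extension k2 [seq nth point z i | i <- iota n n]).
have mG : measurable_fun setT (EFin \o G).
  apply/measurable_EFinP; apply: measurable_funM.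
    exact: (measurable_on_tuples_map (iota 0 n) id (measurable_seq_extension mk1)).
  exact: (measurable_on_tuples_map (iota n n) id (measurable_seq_extension mk2)).
have := ge0_integral_random_product X_polya D_limit (m := n) (n := n) mG.
move=> H; transitivity (\int[P]_w (EFin \o G) (prefix_tuple X (n + n) w))%E; last first.
  apply: eq_integral => w _; rewrite /= /G -sample_iota; congr (_ * _)%:E.
    rewrite /Y -seq_extensionE -sample_iota; congr seq_extension.
    rewrite map_nth_iota0 ?size_map ?size_iota ?leq_addr//.
    by rewrite /subsample -map_take take_iota (minn_idPl _)// leq_addr.
  rewrite /Y'; congr seq_extension.
  rewrite map_nth_iota ?size_map ?size_iota ?addnK// /subsample -map_drop drop_iota.
  by rewrite addnK take_oversize// size_map size_iota.
rewrite -H; last by move=> z; rewrite lee_fin mulr_ge0 ?ext0.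
apply: eq_integral => w _.
rewrite -ge0_integralZr//; last 3 first.
- exact/measurable_EFinP.
- by move=> x _; rewrite lee_fin.
- by apply: integral_ge0 => x _; rewrite lee_fin.
apply: eq_integral => x _; rewrite -ge0_integralZl//; last 3 first.
- exact/measurable_EFinP.
- by move=> y _; rewrite lee_fin.
- by rewrite lee_fin.
apply: eq_integral => y _; rewrite -EFinM /= /G; congr (_ * _)%:E.
  rewrite -[LHS]seq_extensionE; congr seq_extension.
  by rewrite map_nth_iota0 ?size_tuple ?leq_addr// take_size_cat ?size_tuple.
rewrite -[LHS]seq_extensionE; congr seq_extension.
by rewrite map_nth_iota ?size_tuple ?addnK// drop_size_cat ?size_tuple// take_oversize ?size_tuple.
Qed.

Let ge0_RV_moment k1 k2 : measurable_fun setT k1 -> measurable_fun setT k2 ->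
    (forall x, 0 <= k1 x) -> (forall x, 0 <= k2 x) ->
    P.-integrable setT (fun w => (Y k1 w * Y' k2 w)%:E) ->
  P.-integrable setT (fun w => (I k1 w * I k2 w)%:E) /\
  \int[P]_w (I k1 w * I k2 w) = \int[P]_w (Y k1 w * Y' k2 w).
Proof.
move=> mk1 mk2 k10 k20 iY.
pose F w := ((\int[Dn w]_x (k1 x)%:E) * (\int[Dn w]_x (k2 x)%:E))%E.
have i1 w : (0 <= \int[Dn w]_x (k1 x)%:E)%E by apply: integral_ge0 => x _; rewrite lee_fin.
have i2 w : (0 <= \int[Dn w]_x (k2 x)%:E)%E by apply: integral_ge0 => x _; rewrite lee_fin.
have FE w : fine (F w) = I k1 w * I k2 w.
  by rewrite /F fine_ge0M.
have mF : measurable_fun setT F.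
  by apply: emeasurable_funM; apply: measurable_ge0_integral_prod => //;
    try exact/measurable_EFinP; move=> x; rewrite lee_fin.
have iF : P.-integrable setT F.
  apply/integrableP; split => //.
  under eq_integral do rewrite gee0_abs ?mule_ge0//.
  rewrite ge0_moment//; move/integrableP : iY => [_]; apply: le_lt_trans.
  rewrite le_eqVlt; apply/orP; left; apply/eqP; apply: eq_integral => w _.
  rewrite gee0_abs// lee_fin mulr_ge0//; first exact: k10.
  by rewrite /Y' /seq_extension; case: insub => /=.
have [h1 h2] := fine_integrable measurableT iF.
split; first by move: h1; under eq_fun do rewrite FE.
by rewrite /Rintegral -ge0_moment// -h2; under eq_integral do rewrite -FE.
Qed.

Let measurable_I k : measurable_fun setT k -> measurable_fun setT (I k).
Proof.
move=> mk; have mEk : measurable_fun setT (EFin \o k) by exact/measurable_EFinP.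
apply: measurableT_comp => //.
rewrite (_ : (fun _ => _) = (fun w => \int[Dn w]_x (EFin \o k)^\+ x -
    \int[Dn w]_x (EFin \o k)^\- x)%E); last by apply/funext => w; rewrite integralE.
apply: emeasurable_funB; apply: measurable_ge0_integral_prod => //.
- exact: measurable_funepos.
- exact: measurable_funeneg.
Qed.

(** With the second factor equal to 1, the previous identity makes the mean of the random integral
    finite, hence the integral itself almost surely finite. *)
Let ae_integrable k : measurable_fun setT k -> (forall x, 0 <= k x) ->
    P.-integrable setT (fun w => (Y k w)%:E) ->
  {ae P, forall w, (Dn w).-integrable setT (EFin \o k)}.
Proof.
move=> mk k0 ik.
have mEk : measurable_fun setT (EFin \o k) by exact/measurable_EFinP.
have ext1 w : Y' (fun=> 1) w = 1.
  rewrite /Y'; have sz : size (sample (iota n n) w) == n by rewrite size_map size_iota.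
  by rewrite -[sample _ _]/(val (Tuple sz)) seq_extensionE.
have F0 w : (0 <= \int[Dn w]_x (k x)%:E)%E by apply: integral_ge0 => x _; rewrite lee_fin.
have iF : P.-integrable setT (fun w => \int[Dn w]_x (k x)%:E)%E.
  apply/integrableP; split.
    by apply: measurable_ge0_integral_prod => // x; rewrite lee_fin.
  have := ge0_moment mk (k2 := fun=> 1) (measurable_cst _) k0 (fun=> ler01).
  under [in X in _ = X -> _]eq_integral do rewrite ext1 mulr1.
  rewrite (_ : (\int[P]_w _)%E = (\int[P]_w \int[Dn w]_x (k x)%:E)%E); last first.
    by apply: eq_integral => w _; rewrite integral_cst//= probability_setT !mule1.
  move=> E; under eq_integral do rewrite gee0_abs//.
  rewrite E; move/integrableP : ik => [_]; apply: le_lt_trans.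
  rewrite le_eqVlt; apply/orP; left; apply/eqP; apply: eq_integral => w _.
  by rewrite gee0_abs// lee_fin; exact: k0.
have := integrable_ae measurableT iF; apply: filterS => w /(_ Logic.I) fw.
apply/integrableP; split => //; under eq_integral do rewrite gee0_abs ?lee_fin//.
by move: fw; rewrite ge0_fin_numE.
Qed.

Lemma random_product_moment (h f : n.-tuple T -> R) :
    measurable_fun setT h -> measurable_fun setT f ->
    P.-integrable setT (fun w => (h (prefix_tuple X n w) ^+ 2)%:E) ->
    P.-integrable setT (fun w => (f (prefix_tuple X n w) ^+ 2)%:E) ->
  ('E_P[fun w => (\int[Dn w]_x h x * \int[Dn w]_x f x)%R] =
   (\int[P]_w (h (prefix_tuple X n w) * seq_extension f (sample (iota n n) w)))%:E)%E.
Proof.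
move=> mh mf h2 f2.
pose pos k x := Num.max (k x) (0 : R); pose neg k x := Num.max (- k x) (0 : R).
have posB (u : R) : u = Num.max u 0 - Num.max (- u) 0.
  by case: (lerP u 0) => ? ; case: (lerP (- u) 0) => ?; lra.
have pos_sqr (u : R) : Num.max u 0 ^+ 2 <= u ^+ 2.
  by case: (lerP u 0) => // _; rewrite expr0n sqr_ge0.
have pos0 k x : 0 <= pos k x by rewrite le_max lexx orbT.
have neg0 k x : 0 <= neg k x by rewrite le_max lexx orbT.
have mpos k : measurable_fun setT k -> measurable_fun setT (pos k).
  by move=> mk; exact: measurable_maxr.
have mneg k : measurable_fun setT k -> measurable_fun setT (neg k).
  by move=> mk; apply: measurable_maxr => //; exact: measurableT_comp.
have sqr_le k1 k2 : measurable_fun setT k1 -> (forall x, k1 x ^+ 2 <= k2 x ^+ 2) ->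
    P.-integrable setT (fun w => (Y k2 w ^+ 2)%:E) ->
    P.-integrable setT (fun w => (Y k1 w ^+ 2)%:E).
  move=> mk1 k12; apply: le_integrable => //.
    by apply/measurable_EFinP; apply: measurable_funX; exact: measurable_Y.
  by move=> w _; rewrite /= lee_fin !ger0_norm ?sqr_ge0 //; exact: k12.
have ipos k : measurable_fun setT k -> P.-integrable setT (fun w => (Y k w ^+ 2)%:E) ->
    P.-integrable setT (fun w => (Y (pos k) w ^+ 2)%:E).
  by move=> mk; apply: sqr_le; [exact: mpos|move=> x; exact: pos_sqr].
have ineg k : measurable_fun setT k -> P.-integrable setT (fun w => (Y k w ^+ 2)%:E) ->
    P.-integrable setT (fun w => (Y (neg k) w ^+ 2)%:E).
  by move=> mk; apply: sqr_le; [exact: mneg|move=> x; rewrite -(sqrrN (k x)); exact: pos_sqr].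
have shift k : measurable_fun setT k -> P.-integrable setT (fun w => (Y k w ^+ 2)%:E) ->
    P.-integrable setT (fun w => (Y' k w ^+ 2)%:E).
  move=> mk ik.
  apply: (integrable_sample_law X_polya D_limit (J := iota 0 n) (J' := iota n n)
    (u := fun s => seq_extension k s ^+ 2)); rewrite ?iota_uniq ?size_iota//.
    by move=> l; apply: measurable_funX; exact: measurable_seq_extension.
  by under eq_fun do rewrite sample_iota seq_extensionE.
have iYY k1 k2 : measurable_fun setT k1 -> measurable_fun setT k2 ->
    P.-integrable setT (fun w => (Y k1 w ^+ 2)%:E) ->
    P.-integrable setT (fun w => (Y k2 w ^+ 2)%:E) ->
    P.-integrable setT (fun w => (Y k1 w * Y' k2 w)%:E).
  move=> m1 m2 i1 i2; apply: integrable_mul_L2.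
  - exact: measurable_Y.
  - exact: measurable_Y'.
  - exact: i1.
  - exact: shift.
(* Only almost sure: on a null set a part of [k] may fail to be integrable, and the real integral
   then takes a default value. *)
have ae_split k : measurable_fun setT k -> P.-integrable setT (fun w => (Y k w ^+ 2)%:E) ->
    {ae P, forall w, I k w = I (pos k) w - I (neg k) w}.
  move=> mk ik.
  have := ae_integrable (mpos _ mk) (pos0 k)
    (integrable_L2 (measurable_Y (mpos _ mk)) (ipos _ mk ik)).
  have := ae_integrable (mneg _ mk) (neg0 k)
    (integrable_L2 (measurable_Y (mneg _ mk)) (ineg _ mk ik)).
  apply: filterS2 => w i1 i2; rewrite /I -RintegralB//.
  by apply: eq_Rintegral => x _; exact: posB.
have mom k1 k2 (m1 : measurable_fun setT k1) (m2 : measurable_fun setT k2)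
    (k10 : forall x, 0 <= k1 x) (k20 : forall x, 0 <= k2 x)
    (i1 : P.-integrable setT (fun w => (Y k1 w ^+ 2)%:E))
    (i2 : P.-integrable setT (fun w => (Y k2 w ^+ 2)%:E)) :=
  ge0_RV_moment m1 m2 k10 k20 (iYY _ _ m1 m2 i1 i2).
have [mhp mhn mfp mfn] := And4 (mpos _ mh) (mneg _ mh) (mpos _ mf) (mneg _ mf).
have [ihp ihn] := (ipos _ mh h2, ineg _ mh h2).
have [ifp ifn] := (ipos _ mf f2, ineg _ mf f2).
have [ipp Epp] := mom _ _ mhp mfp (pos0 h) (pos0 f) ihp ifp.
have [ipn Epn] := mom _ _ mhp mfn (pos0 h) (neg0 f) ihp ifn.
have [inp Enp] := mom _ _ mhn mfp (neg0 h) (pos0 f) ihn ifp.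
have [inn Enn] := mom _ _ mhn mfn (neg0 h) (neg0 f) ihn ifn.
have expand (a1 a2 b1 b2 : Omega -> R) :
    P.-integrable setT (fun w => (a1 w * b1 w)%:E) ->
    P.-integrable setT (fun w => (a1 w * b2 w)%:E) ->
    P.-integrable setT (fun w => (a2 w * b1 w)%:E) ->
    P.-integrable setT (fun w => (a2 w * b2 w)%:E) ->
    P.-integrable setT (fun w => ((a1 w - a2 w) * (b1 w - b2 w))%:E) /\
    \int[P]_w ((a1 w - a2 w) * (b1 w - b2 w)) =
    (\int[P]_w (a1 w * b1 w) - \int[P]_w (a1 w * b2 w)) -
    (\int[P]_w (a2 w * b1 w) - \int[P]_w (a2 w * b2 w)).
  move=> i1 i2 i3 i4.
  have E w : (a1 w - a2 w) * (b1 w - b2 w) =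
    (a1 w * b1 w - a1 w * b2 w) - (a2 w * b1 w - a2 w * b2 w) by ring.
  have j1 := integrableB measurableT i1 i2; have j2 := integrableB measurableT i3 i4.
  split; first by under eq_fun do rewrite E; exact (integrableB measurableT j1 j2).
  under eq_Rintegral do rewrite E.
  rewrite (RintegralB measurableT j1 j2) (RintegralB measurableT i1 i2).
  by rewrite (RintegralB measurableT i3 i4).
have [iI EI] := expand _ _ _ _ ipp ipn inp inn.
rewrite unlock.
transitivity (\int[P]_w ((I (pos h) w - I (neg h) w) * (I (pos f) w - I (neg f) w))%:E)%E.
  apply: ae_eq_integral => //.
  - by apply/measurable_EFinP; apply: measurable_funM; exact: measurable_I.
  - exact: (measurable_int P).
  - have := ae_split h mh h2; have := ae_split f mf f2.
    by apply: filterS2 => w Ef Eh _; rewrite -Ef -Eh.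
rewrite -(fineK (integrable_fin_num measurableT iI)); congr (_%:E).
rewrite -[LHS]/(\int[P]_w ((I (pos h) w - I (neg h) w) * (I (pos f) w - I (neg f) w))) EI.
rewrite Epp Epn Enp Enn.
have [_ <-] := expand (Y (pos h)) (Y (neg h)) (Y' (pos f)) (Y' (neg f))
  (iYY _ _ mhp mfp ihp ifp) (iYY _ _ mhp mfn ihp ifn)
  (iYY _ _ mhn mfp ihn ifp) (iYY _ _ mhn mfn ihn ifn).
apply: eq_Rintegral => w _; congr (_ * _); first by rewrite [RHS]posB.
by rewrite /Y' /seq_extension; case: insub => [x|] /=; rewrite ?subrr// [RHS]posB.
Qed.

End random_product_moments.

(** * From the explicit version to the given conditional expectations *)

Section hoeffding_kernel_samples.
Context (R : realType) d (T : measurableType d).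
Context d' (Omega : measurableType d') (P : probability Omega R).
Variables (X : nat -> {RV P >-> T}) (n : nat) (theta : nat -> nat -> R).
Implicit Types g : forall a, a.-tuple T -> R.
Local Notation sample := (subsample X).

Lemma map_prefix_tuple s a (j : a.-tuple 'I_s) w :
  map_tuple (tnth (prefix_tuple X s w)) j = sample [seq val i | i <- j] w :> seq T.
Proof. by rewrite /= /subsample -map_comp; apply: eq_map => i; rewrite /= tnth_mktuple. Qed.

Lemma measurable_hoeffding_kernel g s : (s <= n)%N ->
    (forall a, (1 <= a <= n)%N -> measurable_fun setT (g a)) ->
  measurable_fun setT (fun w => hoeffding_kernel n theta g (prefix_tuple X s w)).
Proof.
move=> sn mg; rewrite /hoeffding_kernel; under eq_fun do rewrite big_nat_cond big_mkcond.
apply: measurable_sum => a.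
have [as1|_] := boolP ((1 <= a < s.+1)%N && true); last exact: measurable_cst.
apply: measurable_funM => //; under eq_fun do rewrite big_mkcond.
apply: measurable_sum => j.
have [_|_] := boolP (sorted ltn (map val j)); last exact: measurable_cst.
apply: (measurableT_comp (f := g a)); first by apply: mg; lia.
apply/measurable_fun_tnthP => i; rewrite (_ : _ \o _ = X (tnth j i))//.
by apply/funext => w; rewrite /= tnth_map tnth_mktuple.
Qed.

End hoeffding_kernel_samples.

Section conditional_versions.
Context (R : realType) d (T : measurableType d).
Variable alpha : {finite_measure set T -> \bar R}.
Hypothesis alpha_gt0 : (0 < alpha [set: T])%E.
Context d' (Omega : measurableType d') (P : probability Omega R).
Variables (X : nat -> {RV P >-> T}) (D : {RV P >-> pprobability T R}).
Hypotheses (X_polya : polya_sequence alpha X) (D_limit : empirical_limit X D).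
Local Notation sample := (subsample X).
Variables (n : nat) (theta : nat -> nat -> R).
Implicit Types g : forall a, a.-tuple T -> R.

Variable f : n.-tuple T -> R.
Hypotheses (f_meas : measurable_fun setT f)
  (f_sqr : P.-integrable setT (fun w => (f (prefix_tuple X n w) ^+ 2)%:E)).
Local Notation pf := (fun a (x : a.-tuple T) => projection alpha f x).

Lemma square_integrable_hoeffding_kernel s :
  P.-integrable setT
    (fun w => (hoeffding_kernel n theta pf (prefix_tuple X s w) ^+ 2)%:E).
Proof.
have mk a (j : a.-tuple 'I_s) : measurable_fun setT
    (fun w => projection alpha f (map_tuple (tnth (prefix_tuple X s w)) j)).
  under eq_fun do rewrite map_prefix_tuple.
  by apply: measurable_sample; exact: measurable_projection.
apply: integrable_sqr_sum => [a|a _].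
  by apply: measurable_funM => //; under eq_fun do rewrite -big_filter; exact: measurable_sum.
apply: integrable_sqrZ; under eq_fun do rewrite -big_filter.
apply: integrable_sqr_sum => // j; rewrite mem_filter => /andP[sj _].
under eq_fun do rewrite map_prefix_tuple.
apply: (square_integrable_sample_projection alpha_gt0 X_polya D_limit) => //.
exact: (sorted_uniq ltn_trans ltnn).
Qed.

(** Countably many orders and finitely many index tuples for each are involved, so the exceptional
    sets of [projection_unique] have a null union. *)
Lemma hoeffding_kernel_version g s : (s <= n)%N ->
    (forall a, (1 <= a <= n)%N ->
      is_cond_expectation P (fun w => f (prefix_tuple X n w)) (prefix_tuple X a) (g a)) ->
  {ae P, forall w, hoeffding_kernel n theta g (prefix_tuple X s w) =
                   hoeffding_kernel n theta pf (prefix_tuple X s w)}.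
Proof.
move=> sn g_cond.
have : {ae P, forall w, forall a (j : a.-tuple 'I_s), (1 <= a <= n)%N -> sorted ltn (map val j) ->
   g a (map_tuple (tnth (prefix_tuple X s w)) j) =
   projection alpha f (map_tuple (tnth (prefix_tuple X s w)) j)}.
  apply/ae_foralln => a; apply: filter_forall => j.
  have [an|an] := boolP (1 <= a <= n)%N; last by apply: nearW.
  have [sj|sj] := boolP (sorted ltn (map val j)); last by apply: nearW.
  have uj : uniq (map val j) by exact: (sorted_uniq ltn_trans ltnn).
  have := projection_unique alpha_gt0 X_polya D_limit f_meas f_sqr (andP an).2 (g_cond a an) uj.
  rewrite size_map size_tuple => /(_ erefl); apply: filterS => w.
  by rewrite -map_prefix_tuple seq_extensionE.
apply: filterS => w E; apply: eq_big_nat => a as1; congr (_ * _).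
by apply: eq_bigr => j sj; apply: E => //; lia.
Qed.

End conditional_versions.

Lemma dirichlet_product_covariance (R : realType) d (T : measurableType d)
  (alpha : {finite_measure set T -> \bar R}) (alpha_gt0 : (0 < alpha [set: T])%E)
  d' (Omega : measurableType d') (P : probability Omega R)
  (X : nat -> {RV P >-> T}) (D : {RV P >-> pprobability T R})
  (X_polya : polya_sequence alpha X) (D_limit : empirical_limit X D)
  (n : nat) (f h : n.-tuple T -> R)
  (f_sym : symmetric_fun f) (h_sym : symmetric_fun h)
  (f_meas : measurable_fun setT f) (h_meas : measurable_fun setT h)
  (f_L2 : (fun w => f (prefix_tuple X n w)) \in Lfun P 2%:E)
  (h_L2 : (fun w => h (prefix_tuple X n w)) \in Lfun P 2%:E)
  (f_centered : ('E_P[fun w => f (prefix_tuple X n w)] = 0)%E)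
  (h_centered : ('E_P[fun w => h (prefix_tuple X n w)] = 0)%E)
  (gf gh : forall a : nat, a.-tuple T -> R)
  (gf_cond : forall a : nat, (1 <= a <= n)%N ->
    is_cond_expectation P (fun w => f (prefix_tuple X n w)) (prefix_tuple X a) (gf a))
  (gh_cond : forall a : nat, (1 <= a <= n)%N ->
    is_cond_expectation P (fun w => h (prefix_tuple X n w)) (prefix_tuple X a) (gh a))
  (theta : nat -> nat -> R) (thetaP : is_theta (total_mass alpha) n theta) :
  ('E_P[fun w => (\int[prod_prob (fun _ : 'I_n => D w)]_x h x *
                  \int[prod_prob (fun _ : 'I_n => D w)]_x f x)%R] =
   \sum_(1 <= s < n.+1)
     ('C(n, s)%:R ^+ 2 *
      \prod_(1 <= l < s.+1)
        ((s%:R - l%:R + 1) / (total_mass alpha + s%:R + l%:R - 1)))%R%:E *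
     'E_P[fun w => (hoeffding_kernel n theta gh (prefix_tuple X s w) *
                    hoeffding_kernel n theta gf (prefix_tuple X s w))%R])%E.
Proof.
have f_sqr := Lfun2_integrable_sqr f_L2; have h_sqr := Lfun2_integrable_sqr h_L2.
have fc : \int[P]_w f (prefix_tuple X n w) = 0.
  by move: f_centered; rewrite unlock /Rintegral => ->.
have hc : \int[P]_w h (prefix_tuple X n w) = 0.
  by move: h_centered; rewrite unlock /Rintegral => ->.
rewrite (random_product_moment X_polya D_limit h_meas f_meas h_sqr f_sqr).
(* At length n the projection is the extension of f itself, so the second block can be treated as a
   projection. *)
transitivity (\int[P]_w (h (prefix_tuple X n w) *
    projection alpha f (subsample X (iota n n) w)))%:E.
  congr (_%:E); apply: eq_Rintegral => w _.
  by rewrite /projection size_map size_iota subnn.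
rewrite (polya_hoeffding_covariance alpha_gt0 X_polya D_limit f_sym h_sym f_meas h_meas
  f_sqr h_sqr fc hc thetaP).
rewrite -sumEFin; apply: eq_big_nat => s /andP[s1 sn]; rewrite ltnS in sn.
rewrite EFinM; congr (_ * _)%E.
have mpf (u : n.-tuple T -> R) : measurable_fun setT u ->
    forall a, measurable_fun setT (fun x : a.-tuple T => projection alpha u x).
  by move=> mu a; exact: measurable_projection.
pose pr (u : n.-tuple T -> R) a (x : a.-tuple T) := projection alpha u x.
have iE : P.-integrable setT (fun w =>
    (hoeffding_kernel n theta (pr h) (prefix_tuple X s w) *
     hoeffding_kernel n theta (pr f) (prefix_tuple X s w))%:E).
  apply: integrable_mul_L2.
  - by apply: measurable_hoeffding_kernel => // a _; exact: mpf.
  - by apply: measurable_hoeffding_kernel => // a _; exact: mpf.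
  - exact: (square_integrable_hoeffding_kernel alpha_gt0 X_polya D_limit).
  - exact: (square_integrable_hoeffding_kernel alpha_gt0 X_polya D_limit).
rewrite [X in (X%:E)]/Rintegral fineK; last exact: (integrable_fin_num measurableT iE).
rewrite unlock; apply: ae_eq_integral => //.
- exact: (measurable_int P).
- apply/measurable_EFinP; apply: measurable_funM; apply: measurable_hoeffding_kernel => // a an.
    by have [] := gh_cond a an.
  by have [] := gf_cond a an.
- have := hoeffding_kernel_version alpha_gt0 X_polya D_limit theta f_meas f_sqr sn gf_cond.
  have := hoeffding_kernel_version alpha_gt0 X_polya D_limit theta h_meas h_sqr sn gh_cond.
  by apply: filterS2 => w -> -> _.
Qed.

Theorem proposition3 (R : realType) (A : ptopologicalType)
  (polishA : polish R A)
  (alpha : {finite_measure set (borel A) -> \bar R})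
  (alpha_gt0 : (0 < alpha [set: borel A])%E)
  (d : measure_display) (Omega : measurableType d) (P : probability Omega R)
  (X : nat -> {RV P >-> borel A})
  (X_polya : polya_sequence alpha X)
  (D : {RV P >-> pprobability (borel A) R})
  (D_dirichlet : dirichlet_ferguson alpha D)
  (D_limit : empirical_limit X D)
  (n : nat) (n_gt0 : (0 < n)%N)
  (f h : n.-tuple (borel A) -> R)
  (f_sym : symmetric_fun f) (h_sym : symmetric_fun h)
  (f_meas : measurable_fun [set: n.-tuple (borel A)] f)
  (h_meas : measurable_fun [set: n.-tuple (borel A)] h)
  (f_L2 : (fun w => f (prefix_tuple X n w)) \in Lfun P 2%:E)
  (h_L2 : (fun w => h (prefix_tuple X n w)) \in Lfun P 2%:E)
  (f_centered : ('E_P[fun w => f (prefix_tuple X n w)] = 0)%E)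
  (h_centered : ('E_P[fun w => h (prefix_tuple X n w)] = 0)%E)
  (gf gh : forall a : nat, a.-tuple (borel A) -> R)
  (gf_cond : forall a : nat, (1 <= a <= n)%N ->
    is_cond_expectation P (fun w => f (prefix_tuple X n w))
      (prefix_tuple X a) (gf a))
  (gh_cond : forall a : nat, (1 <= a <= n)%N ->
    is_cond_expectation P (fun w => h (prefix_tuple X n w))
      (prefix_tuple X a) (gh a))
  (theta : nat -> nat -> R)
  (theta_spec : is_theta (total_mass alpha) n theta) :
  ('E_P[fun w => (\int[prod_prob (fun _ : 'I_n => D w)]_x h x *
                  \int[prod_prob (fun _ : 'I_n => D w)]_x f x)%R] =
   \sum_(1 <= s < n.+1)
     ('C(n, s)%:R ^+ 2 *
      \prod_(1 <= l < s.+1)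
        ((s%:R - l%:R + 1) / (total_mass alpha + s%:R + l%:R - 1)))%R%:E *
     'E_P[fun w => (hoeffding_kernel n theta gh (prefix_tuple X s w) *
                    hoeffding_kernel n theta gf (prefix_tuple X s w))%R])%E.
Proof.
exact: (dirichlet_product_covariance alpha_gt0 X_polya D_limit).
Qed.
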